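(* Let $d\ge 2$, let $\mathcal D\subset\mathbb R^d$ be a bounded domain with $C^{1,1}$ boundary and $0\in\mathcal D$, and let $\Psi\in\mathcal B_0$ (with zero drift) satisfy the WLSC property with parameters $(\underline\mu,\underline c,\underline\theta)$. Let $f:\mathcal D\to\mathbb R$ be continuous, and let $u\in C_{\rm b}(\mathbb R^d)$ be a viscosity sub-solution of $$-\Psi(-\Delta)u=-f\quad\text{in } \{u>0\}\cap\mathcal D,\qquad\text{with}\qquad u\le 0\quad\text{in }\mathcal D^c .$$ Then for every $p>\frac{d}{2\underline\mu}$ there exists a constant $C=C(p,\Psi,\operatorname{diam}\mathcal D)$ (depending on $\mathcal D$ only through its diameter, and not on $f$ or $u$) such that $$\sup_{\mathcal D}u^+\le C\,\|f^+\|_{L^p(\mathcal D)} .$$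
   Context: A Bernstein function is $\Psi\in C^\infty((0,\infty))$ with $\Psi\ge 0$ and $(-1)^n\Psi^{(n)}\le 0$ for all $n\ge1$; $\mathcal B_0$ is the set of Bernstein functions with $\lim_{x\downarrow 0}\Psi(x)=0$. Zero drift means $\Psi(x)=\int_{(0,\infty)}(1-e^{-yx})\,\mathfrak m(dy)$ for a Borel measure $\mathfrak m$ on $(0,\infty)$ with $\int (y\wedge 1)\,\mathfrak m(dy)<\infty$. Set $j(r)=\int_0^\infty(4\pi t)^{-d/2}e^{-r^2/(4t)}\,\mathfrak m(dt)$, $r>0$; it is assumed that $j:(0,\infty)\to(0,\infty)$ (i.e. $\Psi\not\equiv 0$). WLSC (weak lower scaling) with parameters $\underline\mu>0$, $\underline c\in(0,1]$, $\underline\theta\ge 0$: $\Psi(\gamma x)\ge\underline c\,\gamma^{\underline\mu}\Psi(x)$ for all $x>\underline\theta$, $\gamma\ge 1$. $C_{\rm b}(\mathbb R^d)$ is the space of bounded continuous functions on $\mathbb R^d$. $C^2_{\rm b}(x)$ is the set of bounded (Borel) functions on $\mathbb R^d$ that are twice continuously differentiable in a neighbourhood of $x$. For $\varphi\in C^2_{\rm b}(x)$, $$-\Psi(-\Delta)\varphi(x)=\tfrac12\int_{\mathbb R^d}\big(\varphi(x+z)+\varphi(x-z)-2\varphi(x)\big)j(|z|)\,dz .$$ Viscosity sub-solution: for an open set $U\subset\mathbb R^d$ and $h:U\to\mathbb R$, $u\in C_{\rm b}(\mathbb R^d)$ is a viscosity sub-solution of $-\Psi(-\Delta)u=h$ in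 $U$ if for every $x\in U$ and every $\varphi\in C^2_{\rm b}(x)$ with $\varphi(x)=u(x)$ and $\varphi(y)>u(y)$ for $y\ne x$, one has $-\Psi(-\Delta)\varphi(x)\ge h(x)$. Also $u^+=\max(u,0)$. *)

(* Defs.v *)
From HB Require Import structures.
From mathcomp Require Import all_boot all_order all_algebra.
From mathcomp Require Import all_classical all_reals all_analysis.
From mathcomp Require Import measurable_realfun.

Set Implicit Arguments.
Unset Strict Implicit.
Unset Printing Implicit Defensive.

Import Order.TTheory GRing.Theory Num.Theory.
Import numFieldNormedType.Exports.

Local Open Scope classical_set_scope.
Local Open Scope ring_scope.

Definition borel_rV_display : measure_display.
Proof. exact: default_measure_display. Qed.

Section borel_rV.
Context {R : realType} {n : nat}.

Definition borel_rV : set (set 'rV[R]_n) := <<s [set A | open A] >>.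

Let borel_rV0 : borel_rV set0.
Proof. exact: sigma_algebra0. Qed.

Let borel_rVC A : borel_rV A -> borel_rV (~` A).
Proof. exact: sigma_algebraC. Qed.

Let borel_rV_bigcup (F : (set 'rV[R]_n)^nat) :
  (forall i, borel_rV (F i)) -> borel_rV (\bigcup_i F i).
Proof. exact: sigma_algebra_bigcup. Qed.

HB.instance Definition _ := @isMeasurable.Build borel_rV_display
  'rV[R]_n borel_rV borel_rV0 borel_rVC borel_rV_bigcup.

End borel_rV.

Section borel_rV_lemmas.
Context {R : realType}.

Lemma measurable_coord n (i : 'I_n) :
  measurable_fun [set: 'rV[R]_n] (fun x => x ord0 i).
Proof.
apply: (measurability _ (RGenOInfty.measurableE R)).
move=> _ [_ [a ->] <-]; rewrite setTI; apply: sub_sigma_algebra => /=.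
apply: open_comp => [x _|]; first exact: coord_continuous.
exact: interval_open.
Qed.

Lemma open_rV_bigcup n (U : set 'rV[R]_n) : open U ->
  U = \bigcup_(p : ('rV[rat]_n * nat)%type)
        (if `[< ball (map_mx ratr p.1 : 'rV[R]_n) (p.2.+1%:R^-1) `<=` U >]
         then ball (map_mx ratr p.1 : 'rV[R]_n) (p.2.+1%:R^-1) else set0).
Proof.
move=> oU; apply/seteqP; split; last first.
  by move=> x [p _]; case: ifPn => [/asboolP|_ //]; apply.
move=> x Ux.
have /nbhs_ballP[e /= e0 xeU] : nbhs x U by exact: open_nbhs_nbhs.
have [k ke] : exists k, k.+1%:R^-1 < e / 2 :> R.
  have e20 : 0 < e / 2 by rewrite divr_gt0.
  have [k _ Hk] := near_infty_natSinv_lt (PosNum e20).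
  by exists k; apply: (Hk k) => /=.
have k0 : 0 < k.+1%:R^-1 :> R by rewrite invr_gt0.
have q_ (i : 'I_n) : {q : rat | `|x ord0 i - ratr q| < k.+1%:R^-1}.
  apply: cid.
  have /rat_in_itvoo[q /=] : x ord0 i - k.+1%:R^-1 < x ord0 i + k.+1%:R^-1.
    by rewrite ltrD2l gtrN.
  rewrite in_itv/= => /andP[q1 q2]; exists q.
  by rewrite distrC ltr_distl q1 q2.
pose q : 'rV[rat]_n := \row_i sval (q_ i).
have qx : ball (map_mx ratr q : 'rV[R]_n) k.+1%:R^-1 x.
  split => // i j; rewrite (ord1 i) !mxE -ball_normE /= distrC.
  exact: (svalP (q_ j)).
exists (q, k) => //=; case: ifPn => // /asboolP; apply => y qy; apply: xeU.
rewrite (splitr e); apply: (@ball_triangle _ _ (map_mx ratr q : 'rV[R]_n)).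
  by apply: ball_sym; apply: le_ball qx; exact: ltW.
by apply: le_ball qy; exact: ltW.
Qed.

Lemma measurable_fun_rV d (T : measurableType d) n (f : T -> 'rV[R]_n) :
  (forall i, measurable_fun [set: T] (fun t => f t ord0 i)) ->
  measurable_fun [set: T] f.
Proof.
move=> mf; apply: (@measurability _ _ _ _ _ _ [set A : set 'rV[R]_n | open A]) => //.
move=> _ [U oU <-]; rewrite setTI (open_rV_bigcup oU) preimage_bigcup.
apply: countable_bigcupT_measurable; first exact: countableP.
move=> p; case: ifPn => _; last by rewrite preimage_set0.
set q := map_mx ratr _; set e := _^-1.
rewrite (_ : _ @^-1` _ = \bigcap_(i in [set: 'I_n])
    ((fun t => f t ord0 i) @^-1` ball (q ord0 i) e)); last first.
  apply/seteqP; split => t /= => [[e0 tq] i _|tq]; first exact: tq.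
  split; first by rewrite invr_gt0.
  by move=> i j; rewrite (ord1 i); exact: tq.
apply: fin_bigcap_measurable => [|i _]; first exact: finite_finset.
by rewrite -[X in measurable X]setTI; apply: mf => //; exact: measurable_ball.
Qed.

End borel_rV_lemmas.

Section lebesgue_rV.
Context {R : realType}.

Definition rV_cons n (p : R * 'rV[R]_n) : 'rV[R]_n.+1 :=
  row_mx (p.1)%:M p.2 : 'rV_(1 + n).

Lemma rV_cons0 n p : @rV_cons n p ord0 ord0 = p.1.
Proof.
rewrite /rV_cons mxE; case: splitP => [j _|//].
by rewrite (ord1 j) mxE eqxx.
Qed.

Lemma rV_consS n p i : @rV_cons n p ord0 (lift ord0 i) = p.2 ord0 i.
Proof.
rewrite /rV_cons mxE; case: splitP => [[[]]//|j]; rewrite lift0 add1n => -[ij].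
by congr (p.2 _ _); apply: val_inj.
Qed.

Lemma measurable_rV_cons n :
  measurable_fun [set: (measurableTypeR R * 'rV[R]_n)%type] (@rV_cons n).
Proof.
apply: measurable_fun_rV => i; case: (unliftP ord0 i) => [j ->|->].
  rewrite [X in measurable_fun _ X](_ : _ =
    (fun x : 'rV[R]_n => x ord0 j) \o snd); last first.
    by apply/funext => p; exact: rV_consS.
  by apply: measurableT_comp => //; exact: measurable_coord.
rewrite [X in measurable_fun _ X](_ : _ = fst) //.
by apply/funext => p; exact: rV_cons0.
Qed.

Section step.
Variables (n : nat) (mu : {sigma_finite_measure set 'rV[R]_n -> \bar R}).

Definition lebesgue_rVS : set 'rV[R]_n.+1 -> \bar R :=
  pushforward (lebesgue_measure \x mu)%E (@rV_cons n).

Let mc := @measurable_rV_cons n.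

Let lebesgue_rVS0 : lebesgue_rVS set0 = 0%E.
Proof. by rewrite /lebesgue_rVS /pushforward preimage_set0 measure0. Qed.

Let lebesgue_rVS_ge0 A : (0 <= lebesgue_rVS A)%E.
Proof. exact: measure_ge0. Qed.

Let lebesgue_rVS_sigma_additive : semi_sigma_additive lebesgue_rVS.
Proof.
exact: (@measure_semi_sigma_additive _ _ _
  (pushforward (lebesgue_measure \x mu)%E (@rV_cons n))).
Qed.

HB.instance Definition _ := isMeasure.Build _ _ _ lebesgue_rVS
  lebesgue_rVS0 lebesgue_rVS_ge0 lebesgue_rVS_sigma_additive.

Let lebesgue_rVS_sigma_finite : sigma_finite [set: 'rV[R]_n.+1] lebesgue_rVS.
Proof.
have /sigma_finiteP[F [FT Fnd mF]] :=
  sigma_finiteT (@lebesgue_measure R : {sigma_finite_measure set _ -> \bar R}).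
have /sigma_finiteP[G [GT Gnd mG]] := sigma_finiteT mu.
pose tl (x : 'rV[R]_n.+1) : 'rV[R]_n := \row_i x ord0 (lift ord0 i).
have mtl : measurable_fun setT tl.
  apply: measurable_fun_rV => i.
  rewrite [X in measurable_fun _ X](_ : _ =
    (fun x : 'rV[R]_n.+1 => x ord0 (lift ord0 i))).
    exact: measurable_coord.
  by apply/funext => x; rewrite mxE.
have mhd := @measurable_coord R n.+1 ord0.
exists (fun k => ((fun x : 'rV[R]_n.+1 => x ord0 ord0) @^-1` F k) `&`
                 (tl @^-1` G k)).
  apply/esym; rewrite -subTset => x _.
  have : [set: R] (x ord0 ord0) by [].
  rewrite FT => -[i _ Fi].
  have : [set: 'rV[R]_n] (tl x) by [].
  rewrite GT => -[j _ Gj].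
  exists (maxn i j) => //; split.
    by have /subsetPset := Fnd _ _ (leq_maxl i j); exact.
  by have /subsetPset := Gnd _ _ (leq_maxr i j); exact.
move=> k; have [mFk Fk] := mF k; have [mGk Gk] := mG k; split.
  apply: measurableI.
    by rewrite -[X in measurable X]setTI; exact: mhd.
  by rewrite -[X in measurable X]setTI; exact: mtl.
rewrite /lebesgue_rVS /pushforward.
rewrite (_ : _ @^-1` _ = F k `*` G k); last first.
  apply/seteqP; split => p /=; rewrite rV_cons0.
    move=> [Fp Gp]; split => //.
    by rewrite (_ : p.2 = tl (rV_cons p))//; apply/rowP => i;
      rewrite mxE rV_consS.
  move=> [Fp Gp]; split => //.
  by rewrite (_ : tl (rV_cons p) = p.2)//; apply/rowP => i;
    rewrite mxE rV_consS.
by rewrite [ltLHS]product_measure1E//= lte_mul_pinfty// ge0_fin_numE.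
Qed.

HB.instance Definition _ := Measure_isSigmaFinite.Build _ _ _ lebesgue_rVS
  lebesgue_rVS_sigma_finite.

End step.

(* d-dimensional Lebesgue measure, as the d-fold product of lebesgue_measure. *)
Fixpoint lebesgue_rV n : {sigma_finite_measure set 'rV[R]_n -> \bar R} :=
  if n is m.+1 then lebesgue_rVS (lebesgue_rV m) else dirac (0 : 'rV[R]_0).

Lemma lebesgue_rV_box n (A : 'I_n -> set R) : (forall i, measurable (A i)) ->
  lebesgue_rV n [set x | forall i, A i (x ord0 i)] =
  (\prod_(i < n) lebesgue_measure (A i))%E.
Proof.
elim: n A => [|n IHn] A mA.
  by rewrite big_ord0 /= diracE mem_set// => -[].
rewrite big_ord_recl /= /lebesgue_rVS /pushforward.
rewrite -IHn// -product_measure1E; last first.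
  rewrite [X in measurable X](_ : _ = \bigcap_(i in [set: 'I_n])
    ((fun x : 'rV[R]_n => x ord0 i) @^-1` A (lift ord0 i))); last first.
    by apply/seteqP; split => x /= => [xA i _|xA i]; exact: xA.
  apply: fin_bigcap_measurable => [|i _]; first exact: finite_finset.
  by rewrite -[X in measurable X]setTI; exact: measurable_coord.
  exact: mA.
congr ((_ \x _)%E _); apply/seteqP; split => p /=.
  move=> Ap; split; first by rewrite -rV_cons0; exact: Ap.
  by move=> i; rewrite -rV_consS; exact: Ap.
move=> [Ap0 Ap] i; case: (unliftP ord0 i) => [j ->|->].
  by rewrite rV_consS; exact: Ap.
by rewrite rV_cons0.
Qed.

End lebesgue_rV.

Section bernstein.
Context {R : realType}.
Implicit Types (Psi : R -> R) (m : {measure set (measurableTypeR R) -> \bar R}).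

(* Functions on (0, +oo) are total functions on R: only the values at x > 0
   are constrained. *)
Definition bernstein_function Psi :=
  [/\ forall n (x : R), 0 < x -> derivable (derive1n n Psi) x 1,
      forall x : R, 0 < x -> 0 <= Psi x
    & forall n (x : R), (0 < n)%N -> 0 < x -> (-1) ^+ n * derive1n n Psi x <= 0].

Definition bernstein_function0 Psi :=
  bernstein_function Psi /\ Psi x @[x --> 0^'+] --> (0 : R).

(* Only the restriction of m to (0, +oo) matters. *)
Definition zero_drift_measure Psi m :=
  (\int[m]_(y in `]0%R, +oo[) (Num.min y 1)%:E < +oo)%E /\
  forall x : R, 0 < x ->
    (Psi x)%:E = (\int[m]_(y in `]0%R, +oo[) (1 - expR (- (y * x)))%:E)%E.

Definition WLSC Psi (mu c theta : R) :=
  forall x gamma : R, theta < x -> 1 <= gamma ->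
    c * gamma `^ mu * Psi x <= Psi (gamma * x).

Definition jump_kernel m (d : nat) (r : R) : \bar R :=
  (\int[m]_(t in `]0%R, +oo[)
    ((4 * pi * t) `^ (- (d%:R / 2)) * expR (- (r ^+ 2 / (4 * t))))%:E)%E.

End bernstein.

Section euclidean.
Context {R : realType}.

(* The library norm on 'rV[R]_d is the sup norm. *)
Definition enorm d (x : 'rV[R]_d) : R := Num.sqrt (\sum_(i < d) x ord0 i ^+ 2).

Definition diam d (D : set 'rV[R]_d) : R :=
  sup [set enorm (x - y) | x in D & y in D].

Definition C11_function n (g : 'rV[R]_n -> R) :=
  (forall x : 'rV[R]_n, differentiable g x) /\
  exists L : R, forall x y v : 'rV[R]_n,
    `|'d g x v - 'd g y v| <= L * enorm (x - y) * enorm v.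

(* Near each boundary point, in suitable orthonormal coordinates (x', x_d) of
   R^d, D is the strict epigraph of a C^{1,1} function of x'. The rows of Q,
   together with e, are the orthonormal frame: x' = x *m Q^T and
   x_d = x *m e^T. *)
Definition C11_boundary d (D : set 'rV[R]_d) :=
  forall x0 : 'rV[R]_d, (closure D `\` D°) x0 ->
    exists r : R, 0 < r /\
    exists (Q : 'M[R]_(d.-1, d)) (e : 'rV[R]_d) (g : 'rV[R]_d.-1 -> R),
      [/\ [/\ Q *m Q^T = 1%:M, Q *m e^T = 0 & e *m e^T = 1%:M],
          C11_function g
        & forall x : 'rV[R]_d, enorm (x - x0) < r ->
            (D x <-> g (x *m Q^T) < (x *m e^T) ord0 ord0)].

Definition C11_domain d (D : set 'rV[R]_d) :=
  [/\ open D, connected D, D !=set0 & C11_boundary D].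

Definition Cb d (u : 'rV[R]_d -> R) := continuous u /\ bounded_fun u.

Definition partial d (i : 'I_d) (phi : 'rV[R]_d -> R) : 'rV[R]_d -> R :=
  'D_(delta_mx ord0 i) phi.

Definition C2b_at d (x : 'rV[R]_d) (phi : 'rV[R]_d -> R) :=
  [/\ bounded_fun phi,
      measurable_fun [set: 'rV[R]_d] phi
    & \forall y \near x,
        {for y, continuous phi} /\
        forall i : 'I_d, [/\ derivable phi y (delta_mx ord0 i),
                      {for y, continuous (partial i phi)}
          & forall j : 'I_d, derivable (partial i phi) y (delta_mx ord0 j) /\
                      {for y, continuous (partial j (partial i phi))}]].

End euclidean.

Section viscosity.
Context {R : realType}.
Variable m : {measure set (measurableTypeR R) -> \bar R}.

(* - Psi(- Delta) phi x. The value of the kernel at z = 0 is irrelevant, since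
   the second difference vanishes there. *)
Definition psi_laplacian d (phi : 'rV[R]_d -> R) (x : 'rV[R]_d) : R :=
  2^-1 * \int[lebesgue_rV d]_z
    ((phi (x + z) + phi (x - z) - 2 * phi x) *
     fine (jump_kernel m d (enorm z))).

(* u is a viscosity sub-solution of - Psi(- Delta) u = h in U *)
Definition viscosity_subsolution d (U : set 'rV[R]_d) (h u : 'rV[R]_d -> R) :=
  [/\ open U, Cb u
    & forall x, U x -> forall phi, C2b_at x phi ->
        phi x = u x -> (forall y, y != x -> u y < phi y) ->
        h x <= psi_laplacian phi x].

End viscosity.

(* Main.v *)
From HB Require Import structures.
Require Import Defs.
From mathcomp Require Import all_boot all_order all_algebra.
From mathcomp Require Import all_classical all_reals all_analysis.
From mathcomp Require Import measurable_realfun ring lra zify.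
Set Implicit Arguments.
Unset Strict Implicit.
Unset Printing Implicit Defensive.
Import Order.TTheory GRing.Theory Num.Theory.
Import numFieldNormedType.Exports.
Local Open Scope classical_set_scope.
Local Open Scope ring_scope.

(* Let g be f^+ cut off to the superlevel sets {u >= eta}, and w_t its
   convolution with the Gaussian heat kernel of variance 2t. By Hoelder
   0 <= w_t <= C t^(-d/(2p)) ||g||_p, and - Psi(- Delta) w_t is the integral of
   w_(t+s) - w_t against m(ds). The potential of g would be the integral of w_t
   against the potential measure of the subordinator; here that measure is
   replaced by finitely many weights u_n at times t_n = eps + n h, the renewal
   sequence of the tails of m on a lattice of small mesh h. The elementary
   bound on the partial sums of a renewal sequence and WLSC give
   sum_(k <= n) u_k <= C t_n^mu, so W = sum_n u_n w_(t_n) is bounded by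
   C ||g||_p as soon as d/(2p) < mu, while
   - Psi(- Delta) W <= - g + C ||g||_p + o(1) on compact sets: the sum is cut
   at a fixed time T, which is where C ||g||_p comes from. That error is
   absorbed by a multiple of the indicator of a ball of radius diam D + 1, on
   which jumps out of the ball give - Psi(- Delta) <= - kappa < 0 in D. Testing
   the viscosity inequality at a maximum point of u - W over {u >= eta}, with a
   small quadratic cap making the maximum strict, gives the bound. *)

(** The obstacle is a bound on the potential that is uniform as the smoothing time [eps] tends to 0.
    For the potential measure U of the subordinator, the convolution of U with the tail of [m] is
    the constant 1; on a lattice this identity becomes a triangular recursion, solved term by term
    without constructing U. With weights solving it, the weighted sum of the integrated increments
    of W telescopes to a final value minus W at [eps]. The price is the rounding of jumps to the
    lattice, at most the Lipschitz constant of W times the integral of min(s, h), for each unit of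
    weight. That Lipschitz constant depends on g and [eps], so the mesh is chosen after both; this
    is harmless because the bounds on the weights do not see the mesh. The condition p > d/(2 mu)
    says that a = d/(2p) is less than mu: the sum of u_n t_n^(-a) then behaves like the integral of
    t^(-a) against d(t^mu), which converges at 0. Concavity of Psi and WLSC are compatible only for
    mu <= 1; as d >= 2 this gives p > 1, as Hoelder requires. *)

Section heat_kernel.
Context {R : realType}.

(** * The Gaussian heat kernel: total mass, semigroup law, time doubling *)

Definition sqn d (z : 'rV[R]_d) : R := \sum_(i < d) z ord0 i ^+ 2.

Definition heat d (t : R) (z : 'rV[R]_d) : R :=
  (4 * pi * t) `^ (- (d%:R / 2)) * expR (- (sqn z / (4 * t))).

Lemma sqn_ge0 d (z : 'rV[R]_d) : 0 <= sqn z.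
Proof. by apply: sumr_ge0 => i _; rewrite sqr_ge0. Qed.

Lemma enorm_sqr d (z : 'rV[R]_d) : enorm z ^+ 2 = sqn z.
Proof. by rewrite /enorm sqr_sqrtr// sqn_ge0. Qed.

Lemma heat_ge0 d t (z : 'rV[R]_d) : 0 <= heat t z.
Proof. by rewrite mulr_ge0 ?powR_ge0 ?expR_ge0. Qed.

Lemma heat_gt0 d t (z : 'rV[R]_d) : 0 < t -> 0 < heat t z.
Proof. by move=> t0; rewrite mulr_gt0 ?powR_gt0 ?expR_gt0 ?mulr_gt0 ?pi_gt0. Qed.

Lemma sqn_rV_cons d (p : R * 'rV[R]_d) : sqn (rV_cons p) = p.1 ^+ 2 + sqn p.2.
Proof.
rewrite /sqn big_ord_recl rV_cons0; congr (_ + _).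
by apply: eq_bigr => i _; rewrite rV_consS.
Qed.

(** Splitting off one coordinate as a normal density of variance 2t drives the induction on the
    dimension that computes the total mass. *)
Lemma heat_rV_cons d t (p : R * 'rV[R]_d) (a : 'rV[R]_d.+1) : 0 < t ->
  heat t (rV_cons p - a) = normal_pdf (a ord0 ord0) (Num.sqrt (2 * t)) p.1 *
    heat t (p.2 - \row_i a ord0 (lift ord0 i)).
Proof.
move=> t0; have pt : 0 < 4 * pi * t by rewrite !mulr_gt0 ?pi_gt0.
have -> : rV_cons p - a =
    rV_cons (p.1 - a ord0 ord0, p.2 - \row_i a ord0 (lift ord0 i)).
  apply/rowP => i; case: (unliftP ord0 i) => [j ->|->].
    by rewrite rV_consS [LHS]mxE rV_consS [in LHS]mxE/= !mxE.
  by rewrite rV_cons0 [LHS]mxE rV_cons0 [in LHS]mxE.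
rewrite /heat sqn_rV_cons /=.
rewrite normal_pdfE ?gt_eqF ?sqrtr_gt0 ?mulr_gt0// /normal_peak /normal_fun.
rewrite sqr_sqrtr ?mulr_ge0 ?ltW//.
rewrite [(_ + sqn _) / _]mulrDl opprD expRD.
have -> : 2 * t *+ 2 = 4 * t by rewrite -mulr_natr; ring.
have -> : 2 * t * pi *+ 2 = 4 * pi * t by rewrite -mulr_natr; ring.
have -> : (4 * pi * t) `^ (- (d.+1%:R / 2)) =
    (Num.sqrt (4 * pi * t))^-1 * (4 * pi * t) `^ (- (d%:R / 2)).
  rewrite -powR12_sqrt ?ltW// -powRN -powRD ?(gt_eqF pt) ?implybT//.
  by congr (_ `^ _); rewrite -natr1; field.
rewrite mulNr; ring.
Qed.

Lemma measurable_sqn d : measurable_fun [set: 'rV[R]_d] (@sqn d).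
Proof.
by apply: measurable_sum => i; apply: measurable_funX; exact: measurable_coord.
Qed.

Lemma measurable_sqn_comp d0 (T : measurableType d0) d (f : T -> 'rV[R]_d) :
  (forall i, measurable_fun setT (fun x => f x ord0 i)) ->
  measurable_fun setT (fun x => sqn (f x)).
Proof. by move=> mf; apply: measurable_sum => i; exact: measurable_funX. Qed.

Lemma measurable_heat_comp d0 (T : measurableType d0) d t (f : T -> 'rV[R]_d) :
  (forall i, measurable_fun setT (fun x => f x ord0 i)) ->
  measurable_fun setT (fun x => heat t (f x)).
Proof.
move=> mf; apply: measurable_funM => //; apply: measurableT_comp => //.
apply: measurableT_comp => //; apply: measurable_funM => //.
exact: measurable_sqn_comp.
Qed.

Lemma measurable_coordB d (a : 'rV[R]_d) i :
  measurable_fun setT (fun z : 'rV[R]_d => (z - a) ord0 i).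
Proof.
rewrite (_ : (fun _ => _) = (fun z : 'rV[R]_d => z ord0 i - a ord0 i)).
  by apply: measurable_funB => //; exact: measurable_coord.
by apply/funext => z; rewrite !mxE.
Qed.

Lemma measurable_heatB d t (a : 'rV[R]_d) :
  measurable_fun setT (fun z : 'rV[R]_d => heat t (z - a)).
Proof. by apply: measurable_heat_comp => i; exact: measurable_coordB. Qed.

Lemma integral_lebesgue_rVS d (f : 'rV[R]_d.+1 -> \bar R) :
  measurable_fun setT f -> (forall x, (0 <= f x)%E) ->
  (\int[lebesgue_rV d.+1]_x f x =
   \int[lebesgue_measure]_a \int[lebesgue_rV d]_y f (rV_cons (a, y)))%E.
Proof.
move=> mf f0.
rewrite (_ : (\int[_]_x f x)%E = (\int[lebesgue_measure \x lebesgue_rV d]_p f (rV_cons p))%E).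
  by rewrite fubini_tonelli1//; apply: measurableT_comp => //; exact: measurable_rV_cons.
have := @ge0_integral_pushforward _ _ _ _ R _ (@measurable_rV_cons R d)
  (lebesgue_measure \x lebesgue_rV d)%E setT f measurableT mf.
by rewrite preimage_setT; apply.
Qed.

Lemma integral_heat d t (a : 'rV[R]_d) : 0 < t ->
  (\int[lebesgue_rV d]_z (heat t (z - a))%:E = 1)%E.
Proof.
move=> t0; elim: d a => [|d IH] a.
  rewrite /= integral_dirac//=; last first.
    by apply/measurable_EFinP; exact: measurable_heatB.
  by rewrite diracT mul1e /heat /sqn big_ord0 !mul0r !oppr0 powRr0 expR0 mulr1.
rewrite integral_lebesgue_rVS; last 2 first.
- by apply/measurable_EFinP; exact: measurable_heatB.
- by move=> x; rewrite lee_fin heat_ge0.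
rewrite -[RHS](integral_normal_pdf (a ord0 ord0) (Num.sqrt (2 * t))).
apply: eq_integral => x _.
under eq_integral do rewrite heat_rV_cons// EFinM /=.
rewrite ge0_integralZl_EFin//.
- by rewrite IH mule1.
- by move=> y _; rewrite lee_fin heat_ge0.
- by apply/measurable_EFinP; exact: measurable_heatB.
- exact: normal_pdf_ge0.
Qed.

(* Completing the square. *)
Lemma heatM d s t (b z : 'rV[R]_d) : 0 < s -> 0 < t ->
  heat s z * heat t (b + z) =
  heat (s + t) b * heat (s * t / (s + t)) (z - (- (s / (s + t))) *: b).
Proof.
move=> s0 t0; have st0 : 0 < s + t by rewrite addr_gt0.
have pi4 : 0 < 4 * pi :> R by rewrite mulr_gt0 ?pi_gt0.
rewrite /heat mulrACA [RHS]mulrACA; congr (_ * _).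
  rewrite -!powRM ?mulr_ge0 ?invr_ge0 ?pi_ge0 ?(ltW s0) ?(ltW t0) ?(ltW st0)//.
  by congr (_ `^ _); field; rewrite gt_eqF.
rewrite -!expRD; congr expR; rewrite -!opprD; congr (- _).
rewrite /sqn !mulr_suml -!big_split/=; apply: eq_bigr => i _; rewrite !mxE.
by field; rewrite !gt_eqF ?addr_gt0.
Qed.

Lemma integral_heatM d s t (b : 'rV[R]_d) : 0 < s -> 0 < t ->
  (\int[lebesgue_rV d]_z (heat s z * heat t (b + z))%:E = (heat (s + t) b)%:E)%E.
Proof.
move=> s0 t0; under eq_integral do rewrite heatM// EFinM.
rewrite ge0_integralZl_EFin ?heat_ge0//.
- by rewrite integral_heat ?mule1// divr_gt0 ?mulr_gt0 ?addr_gt0.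
- by move=> y _; rewrite lee_fin heat_ge0.
- by apply/measurable_EFinP; exact: measurable_heatB.
Qed.

Lemma heatN d t (z : 'rV[R]_d) : heat t (- z) = heat t z.
Proof.
by rewrite /heat /sqn; under eq_bigr do rewrite mxE sqrrN.
Qed.

Lemma integral_heatMB d s t (b : 'rV[R]_d) : 0 < s -> 0 < t ->
  (\int[lebesgue_rV d]_z (heat s z * heat t (b - z))%:E = (heat (s + t) b)%:E)%E.
Proof.
move=> s0 t0; rewrite -(heatN (s + t) b) -(integral_heatM (- b) s0 t0).
by apply: eq_integral => z _; rewrite -[b - z]opprK heatN opprB addrC.
Qed.

Lemma le_heat_peak d t (z : 'rV[R]_d) : 0 < t ->
  heat t z <= (4 * pi * t) `^ (- (d%:R / 2)).
Proof.
move=> t0; rewrite ler_piMr ?powR_ge0// -[leRHS]expR0 ler_expR oppr_le0.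
by rewrite divr_ge0 ?sqn_ge0 ?mulr_ge0 ?ltW.
Qed.

(** Doubling the time leaves a spare Gaussian factor. It absorbs polynomial factors in [z], and it
    makes the mass far from the origin small. *)
Lemma heat_double d t (z : 'rV[R]_d) : 0 < t ->
  heat t z = 2 `^ (d%:R / 2) * heat (2 * t) z * expR (- (sqn z / (8 * t))).
Proof.
move=> t0; have pt : 0 < 4 * pi * t by rewrite !mulr_gt0 ?pi_gt0.
rewrite /heat.
have -> : 4 * pi * (2 * t) = 2 * (4 * pi * t) by ring.
rewrite [(2 * _) `^ _]powRM ?(ltW pt)// !mulrA -powRD ?pnatr_eq0 ?implybT// subrr powRr0 mul1r
  -[RHS]mulrA -expRD.
by congr (_ * expR _); field; rewrite gt_eqF.
Qed.

Lemma exprM_exp_le (x : R) : x * expR (- x) <= 1.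
Proof.
rewrite expRN ler_pdivrMr ?expR_gt0// mul1r.
by apply: le_trans (expR_ge1Dx x); rewrite lerDr.
Qed.

Lemma sqn_heat_le d t (z : 'rV[R]_d) : 0 < t ->
  sqn z * heat t z <= 8 * t * 2 `^ (d%:R / 2) * heat (2 * t) z.
Proof.
move=> t0; rewrite heat_double//.
have e : sqn z * expR (- (sqn z / (8 * t))) <= 8 * t.
  have := exprM_exp_le (sqn z / (8 * t)).
  by rewrite mulrAC ler_pdivrMr ?mulr_gt0// mul1r.
set e2 := expR _ in e *; set A := _ `^ _; set H := heat (2 * t) z.
have -> : sqn z * (A * H * e2) = sqn z * e2 * (A * H) by ring.
rewrite -[leRHS]mulrA.
by rewrite ler_wpM2r// mulr_ge0 ?powR_ge0 ?heat_ge0.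
Qed.

End heat_kernel.

(** * Renewal sequences and summation by parts *)

Section renewal.
Context {R : realType}.
Implicit Types (u N : nat -> R).

Lemma sum_triangle (F : nat -> nat -> R) m :
  \sum_(k < m) \sum_(n < k.+1) F n k = \sum_(n < m) \sum_(i < m - n) F n (n + i)%N.
Proof.
elim: m => [|m IH]; first by rewrite !big_ord0.
rewrite big_ord_recr/= IH [RHS]big_ord_recr/= subSnn big_ord_recr/= big_ord1 addn0.
rewrite addrA -big_split/=; congr (_ + _); apply: eq_bigr => i _.
by rewrite subSn ?(ltnW (ltn_ord i))// big_ord_recr/= subnKC// ltnW.
Qed.

Lemma ler_sum_widen (G : nat -> R) m n : (m <= n)%N -> (forall k, 0 <= G k) ->
  \sum_(k < m) G k <= \sum_(k < n) G k.
Proof.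
by move=> mn G0; rewrite -(subnKC mn) big_split_ord/= lerDl sumr_ge0.
Qed.

(** The recursion determines each new term from the previous ones. The term is nonnegative because
    [N] decreases: moving from [n] to [n.+1] can only lower the partial convolution, which was 1. *)
Lemma renewal_exists N n : (forall i j, (i <= j)%N -> N j <= N i) ->
  (forall i, 0 <= N i) -> 0 < N 0%N ->
  exists2 u : nat -> R, (forall k, 0 <= u k) &
    forall i, (i <= n)%N -> \sum_(k < i.+1) u k * N (i - k)%N = 1.
Proof.
move=> Nle N0 Npos; elim: n => [|n [u u0 IH]].
  exists (fun=> (N 0%N)^-1) => [k|[|//] _]; first by rewrite invr_ge0 ltW.
  by rewrite big_ord1 mulVf// gt_eqF.
pose s := \sum_(k < n.+1) u k * N (n.+1 - k)%N.
pose v k := if k == n.+1 then (1 - s) / N 0%N else u k.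
have vu i k : (i <= n.+1)%N -> (k < i)%N -> v k = u k.
  by move=> ni ki; rewrite /v ltn_eqF// (leq_trans ki).
exists v => [k|i].
  rewrite /v; case: ifP => // _; rewrite divr_ge0// subr_ge0 -(IH n (leqnn _)).
  apply: ler_sum => k0 _; rewrite ler_wpM2l// Nle// leq_sub2r//.
rewrite leq_eqVlt => /predU1P[->|ni].
  rewrite big_ord_recr/= subnn {2}/v eqxx divfK ?gt_eqF//.
  under eq_bigr => k _ do rewrite (vu n.+1)//.
  by rewrite -/s addrC subrK.
rewrite -[RHS](IH i)//; apply: eq_bigr => k _.
by rewrite (vu i.+1)//.
Qed.

(** Expanding the product gives the terms u_k N_j with k, j <= K. They all have k + j <= 2K, hence
    occur among the 2K + 1 convolutions equal to 1. *)
Lemma renewal_sum_le u N K : (forall k, 0 <= u k) -> (forall i, 0 <= N i) ->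
  (forall i, (i <= 2 * K)%N -> \sum_(k < i.+1) u k * N (i - k)%N = 1) ->
  (\sum_(k < K.+1) u k) * (\sum_(j < K.+1) N j) <= (2 * K).+1%:R.
Proof.
move=> u0 N0 E.
have -> : (2 * K).+1%:R = \sum_(i < (2 * K).+1) \sum_(k < i.+1) u k * N (i - k)%N.
  rewrite (eq_bigr (fun=> 1)); last by move=> i _; rewrite E// -ltnS.
  by rewrite sumr_const card_ord.
rewrite (sum_triangle (fun k i => u k * N (i - k)%N)) mulr_suml.
pose G n := \sum_(i < (2 * K).+1 - n) u n * N (n + i - n)%N.
have KK : (K.+1 <= (2 * K).+1)%N by lia.
apply: (le_trans _ (@ler_sum_widen G _ _ KK _)).
  apply: ler_sum => k _; rewrite /G; under [leRHS]eq_bigr do rewrite addKn.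
  rewrite -mulr_sumr ler_wpM2l// ler_sum_widen//.
  by have := ltn_ord k; lia.
by move=> k; rewrite sumr_ge0// => i _; rewrite mulr_ge0.
Qed.

(** Integral comparison for a t^(b-1), without integrals: in logarithmic variables it reads 1 -
    e^(-ar) <= ar <= (a/b)(e^(br) - 1), with r the logarithm of s/t. *)
Lemma sum_powR_shift_le (a b t s : R) : 0 < a -> 0 < b -> 0 < t -> t <= s ->
  t `^ (a + b) * (t `^ (- a) - s `^ (- a)) <= a / b * (s `^ b - t `^ b).
Proof.
move=> a0 b0 t0 ts; have s0 := lt_le_trans t0 ts.
have E (x r : R) : 0 < x -> x `^ r = expR (r * ln x).
  by move=> x0; rewrite /powR gt_eqF.
rewrite !E//; set x := ln t; set y := ln s.
have xy : 0 <= y - x by rewrite subr_ge0 ler_ln.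
have -> : expR ((a + b) * x) * (expR (- a * x) - expR (- a * y)) =
    expR (b * x) * (1 - expR (- (a * (y - x)))).
  rewrite !mulrBr mulr1 -!expRD; congr (expR _ - expR _); ring.
have -> : expR (b * y) - expR (b * x) = expR (b * x) * (expR (b * (y - x)) - 1).
  rewrite mulrBr mulr1 -expRD; congr (expR _ - _); ring.
rewrite mulrCA ler_pM2l ?expR_gt0//.
apply: (@le_trans _ _ (a * (y - x))).
  by rewrite lerBlDr addrC -lerBlDr; apply: le_trans (expR_ge1Dx _).
rewrite -mulrA ler_pM2l// ler_pdivlMl// lerBrDl; exact: expR_ge1Dx.
Qed.

(** Abel summation: growth of order a + b of the partial sums leaves growth of order b after
    weighting by t^(-a). The constant does not depend on the spacing of the [t k]. *)
Lemma abel_powR_le (u t : nat -> R) (a b C : R) n : 0 < a -> 0 < b -> 0 <= C ->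
  (forall k, 0 <= u k) -> (forall k, 0 < t k) -> (forall k, t k <= t k.+1) ->
  (forall k, (k <= n)%N -> \sum_(i < k.+1) u i <= C * t k `^ (a + b)) ->
  \sum_(i < n.+1) u i * t i `^ (- a) <= C * (1 + a / b) * t n `^ b.
Proof.
move=> a0 b0 C0 u0 t0 tS uC.
have E k : t k `^ (a + b) * t k `^ (- a) = t k `^ b.
  by rewrite -powRD ?(gt_eqF (t0 k)) ?implybT// addrAC subrr add0r.
(* Subtracting the initial power makes the base case an equality and lets the induction
   telescope. *)
suff H k : (k <= n)%N -> \sum_(i < k.+1) u i * t i `^ (- a) <=
    (\sum_(i < k.+1) u i) * t k `^ (- a) + C * (a / b) * (t k `^ b - t 0%N `^ b).
  apply: (le_trans (H n (leqnn n))).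
  rewrite [C * (1 + _)]mulrDr mulr1 [(C + _) * _]mulrDl lerD//.
    by rewrite -E mulrA ler_wpM2r ?powR_ge0// uC.
  by rewrite ler_wpM2l ?mulr_ge0 ?invr_ge0 ?(ltW a0) ?(ltW b0)// gerBl powR_ge0.
elim: k => [|k IH] kn; first by rewrite !big_ord1 subrr mulr0 addr0.
rewrite big_ord_recr/= [in leRHS]big_ord_recr/= mulrDl addrAC lerD2r.
apply: (le_trans (IH (ltnW kn))).
set U := \sum_(i < _) _.
rewrite -lerBlDl addrAC -mulrBr.
have -> : C * (a / b) * (t k.+1 `^ b - t 0%N `^ b) =
  C * (a / b) * (t k.+1 `^ b - t k `^ b) + C * (a / b) * (t k `^ b - t 0%N `^ b).
  by rewrite -mulrDr; congr (_ * _); ring.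
rewrite lerD2r.
apply: (@le_trans _ _ (C * t k `^ (a + b) * (t k `^ (- a) - t k.+1 `^ (- a)))).
  rewrite ler_wpM2r ?uC 1?ltnW// subr_ge0 !powRN lef_pV2 ?posrE ?powR_gt0//.
  by rewrite ge0_ler_powR ?nnegrE// ?(ltW a0)// ltW.
by rewrite -!mulrA ler_wpM2l// mulrA sum_powR_shift_le.
Qed.

End renewal.

(** * Linearity of real-valued integrals *)

Section Rintegral_extra.
Context d (T : measurableType d) {R : realType}.
Variables (mu : {measure set T -> \bar R}) (D : set T).
Hypothesis mD : measurable D.

Lemma integrable_sumR n (f : nat -> T -> R) :
  (forall i, (i < n)%N -> mu.-integrable D (EFin \o f i)) ->
  mu.-integrable D (EFin \o (fun x => \sum_(i < n) f i x)).
Proof.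
move=> fi; have := @integrable_sum _ _ R mu D mD _ (index_enum 'I_n) xpredT
  (fun i x => (f i x)%:E) (fun i _ => fi _ (ltn_ord i)).
apply: eq_integrable => // x _ /=.
by rewrite sumEFin.
Qed.

Lemma Rintegral_sum n (f : nat -> T -> R) :
  (forall i, (i < n)%N -> mu.-integrable D (EFin \o f i)) ->
  \int[mu]_(x in D) (\sum_(i < n) f i x) = \sum_(i < n) \int[mu]_(x in D) f i x.
Proof.
elim: n => [|n IH] fi.
  rewrite big_ord0 (_ : (fun=> _) = cst 0).
    by rewrite /Rintegral integral0.
  by apply/funext => x; rewrite big_ord0.
rewrite big_ord_recr/= -IH; last by move=> i ni; apply: fi; exact: ltnW.
rewrite -RintegralD//; last 2 first.
- by apply: integrable_sumR => i ni; apply: fi; exact: ltnW.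
- exact: fi.
by apply: eq_Rintegral => x _; rewrite big_ord_recr.
Qed.

Lemma integrableZlR (k : R) (f : T -> R) : mu.-integrable D (EFin \o f) ->
  mu.-integrable D (EFin \o (fun x => k * f x)).
Proof. by move=> /(integrableZl mD k); apply: eq_integrable. Qed.

Lemma integrableDR (f g : T -> R) : mu.-integrable D (EFin \o f) ->
  mu.-integrable D (EFin \o g) -> mu.-integrable D (EFin \o (fun x => f x + g x)).
Proof. by move=> fi /(integrableD mD fi); apply: eq_integrable. Qed.

Lemma integrableBR (f g : T -> R) : mu.-integrable D (EFin \o f) ->
  mu.-integrable D (EFin \o g) -> mu.-integrable D (EFin \o (fun x => f x - g x)).
Proof. by move=> fi /(integrableB mD fi); apply: eq_integrable. Qed.

Lemma Rintegral_EFin (f : T -> R) : mu.-integrable D (EFin \o f) ->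
  (\int[mu]_(x in D) f x)%:E = (\int[mu]_(x in D) (f x)%:E)%E.
Proof. by move=> fi; rewrite fineK// integrable_fin_num. Qed.

End Rintegral_extra.

(** * Tails and truncated first moment of the Levy measure, and their link with Psi *)

Section levy.
Context {R : realType}.
Variable m : {measure set (measurableTypeR R) -> \bar R}.
Hypothesis m1 : (\int[m]_(y in `]0%R, +oo[) (Num.min y 1)%:E < +oo)%E.
Local Notation D := (`]0%R, +oo[%classic : set (measurableTypeR R)).

Let mD : measurable D. Proof. exact: measurable_itv. Qed.

Let D0 s : D s -> 0 < s. Proof. by rewrite /= in_itv/= andbT. Qed.

Lemma measurable_fun_min (t : R) :
  measurable_fun setT (fun s : measurableTypeR R => Num.min s t).
Proof. exact: measurable_minr. Qed.

Lemma levy_integrable (f : R -> R) (C : R) : measurable_fun D f ->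
  (forall s, 0 < s -> `|f s| <= C * Num.min s 1) -> m.-integrable D (EFin \o f).
Proof.
move=> mf fC.
have i1 : m.-integrable D (EFin \o (fun s : measurableTypeR R => C * Num.min s 1)).
  apply: integrableZlR => //; apply/integrableP; split.
    by apply/measurable_EFinP/measurable_funTS; exact: measurable_fun_min.
  apply: le_lt_trans m1; rewrite le_eqVlt; apply/orP; left; apply/eqP.
  by apply: eq_integral => s /set_mem/D0 s0 /=; rewrite ger0_norm// le_min ltW//=.
apply: le_integrable i1 => //; first exact/measurable_EFinP.
move=> s /D0 s0 /=; rewrite lee_fin (le_trans (fC _ s0))// ler_norm//.
Qed.

Lemma min_le_scale (s t : R) : 0 < s -> 0 <= t ->
  Num.min s t <= (1 + t) * Num.min s 1.
Proof.
move=> s0 t0; rewrite minr_pMr ?addr_ge0// mulr1 le_min !ge_min.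
by rewrite mulrDl mul1r lerDl mulr_ge0 ?(ltW s0)//= lerDr ler01 orbT.
Qed.

Lemma integrable_min t : 0 <= t -> m.-integrable D (EFin \o (fun s => Num.min s t)).
Proof.
move=> t0; apply: (@levy_integrable _ (1 + t)).
  by apply/measurable_funTS; exact: measurable_fun_min.
move=> s s0; rewrite ger0_norm; first exact: min_le_scale.
by rewrite le_min (ltW s0).
Qed.

Lemma indic_le_min (x s : R) : 0 < x -> 0 < s -> \1_(`[x, +oo[) s <= x^-1 * Num.min s x.
Proof.
move=> x0 s0; rewrite ler_pdivlMl// indicE mem_setE in_itv/= andbT.
have [xs|xs] := leP x s; first by rewrite mulr1.
by rewrite mulr0 ltW.
Qed.

Lemma integrable_tail x : 0 < x -> m.-integrable D (EFin \o \1_(`[x, +oo[)).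
Proof.
move=> x0; apply: (@levy_integrable _ (x^-1 * (1 + x))).
  by apply: measurable_indic; exact: measurable_itv.
move=> s s0; rewrite ger0_norm; last by rewrite indicE ler0n.
rewrite (le_trans (indic_le_min x0 s0))// -mulrA ler_wpM2l ?invr_ge0 ?(ltW x0)//.
by apply: min_le_scale => //; exact: ltW.
Qed.

Definition levy_tail (x : R) : R := \int[m]_(s in D) \1_(`[x, +oo[) s.

(* Comparable to t Psi(1/t), see [levy_trunc_ge]. *)
Definition levy_trunc (t : R) : R := \int[m]_(s in D) Num.min s t.

Lemma levy_tail_ge0 x : 0 <= levy_tail x.
Proof. by apply: Rintegral_ge0 => s _; rewrite indicE ler0n. Qed.

Lemma levy_tail_le x y : 0 < x -> x <= y -> levy_tail y <= levy_tail x.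
Proof.
move=> x0 xy; apply: le_Rintegral => //.
- by apply: integrable_tail; exact: lt_le_trans xy.
- exact: integrable_tail.
- move=> s _; rewrite !indicE !mem_setE !in_itv/= !andbT ler_nat.
  by have [ys|//] := leP y s; rewrite (le_trans xy ys).
Qed.

Lemma levy_trunc_ge0 t : 0 <= t -> 0 <= levy_trunc t.
Proof. by move=> t0; apply: Rintegral_ge0 => s /D0 s0; rewrite le_min ltW. Qed.

Lemma levy_trunc_le s t : 0 <= s -> s <= t -> levy_trunc s <= levy_trunc t.
Proof.
move=> s0 st; apply: le_Rintegral => //; [exact: integrable_min|
  by apply: integrable_min; exact: le_trans st|].
by move=> x _; rewrite le_min !ge_min lexx st orbT.
Qed.

(** Dominated convergence along h = 1/(n+1), with majorant min(s, 1), followed by monotonicity in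
    h. *)
Lemma levy_trunc_small e : 0 < e ->
  exists2 h0, 0 < h0 & forall h, 0 < h -> h <= h0 -> levy_trunc h <= e.
Proof.
move=> e0.
pose f n (s : measurableTypeR R) := (Num.min s n.+1%:R^-1)%:E.
have mf n : measurable_fun D (f n).
  by apply/measurable_EFinP/measurable_funTS; exact: measurable_fun_min.
have f0 : {ae m, forall s, D s -> f n s @[n --> \oo] --> cst 0%E s}.
  apply/aeW => s /D0 s0; apply: cvg_EFin; first by apply/nearW.
  apply: (@squeeze_cvgr _ _ _ _ (cst 0) (@harmonic R)); last exact: cvg_harmonic.
    by apply: nearW => n; rewrite /= le_min ge_min (ltW s0) invr_ge0 ler0n lexx orbT.
  exact: cvg_cst.
have fb : {ae m, forall s n, D s -> (`|f n s| <= (Num.min s 1)%:E)%E}.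
  apply/aeW => s n /D0 s0; rewrite lee_fin ger0_norm; last first.
    by rewrite le_min (ltW s0) invr_ge0 ler0n.
  by rewrite le_min !ge_min lexx invf_le1 ?ler1n// orbT.
have [_ _] := dominated_convergence mD mf (measurable_cst _) f0 (integrable_min ler01) fb.
rewrite integral0 => /fine_cvg/cvgrPdist_lt/(_ _ e0)[n _ /(_ n (leqnn n))] /= en.
exists n.+1%:R^-1; first by rewrite invr_gt0.
move=> h h0 hn; apply: (le_trans (levy_trunc_le (ltW h0) hn)).
by move: en; rewrite sub0r normrN => /ltW; apply: le_trans; exact: ler_norm.
Qed.

(** The sum is h times the smaller of K + 1 and the integer part of s/h; rounding down loses at most
    min(s, h). *)
Lemma indic_sum_ge (h s : R) K : 0 < h -> 0 < s ->
  Num.min s (K.+1%:R * h) - Num.min s h <=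
  \sum_(j < K.+1) h * \1_(`[j.+1%:R * h, +oo[) s.
Proof.
move=> h0 s0.
have [sh|hs] := ltP s h.
  rewrite min_l; last first.
    by rewrite (le_trans (ltW sh))// ler_peMl ?ler1n// ltW.
  by rewrite subrr sumr_ge0// => j _; rewrite mulr_ge0 ?(ltW h0)// indicE ler0n.
have A k : Num.min s (k.+1%:R * h) - h <= \sum_(j < k) h * \1_(`[j.+1%:R * h, +oo[) s.
  elim: k => [|k IH]; first by rewrite big_ord0 mul1r subr_le0 ge_min lexx orbT.
  rewrite big_ord_recr/= indicE mem_setE in_itv/= andbT.
  have E : k.+2%:R * h = k.+1%:R * h + h by rewrite -natr1 mulrDl mul1r.
  set S := \sum_(j < _) _ in IH *.
  have [ks|sk] := leP (k.+1%:R * h) s.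
    rewrite mulr1; move: IH; rewrite (min_r ks) => IH.
    have : Num.min s (k.+2%:R * h) <= k.+2%:R * h by rewrite ge_min lexx orbT.
    by rewrite {2}E; lra.
  rewrite mulr0 addr0; apply: le_trans IH; rewrite lerD2r le_min !ge_min lexx/=.
  by rewrite (ltW sk).
apply: le_trans (A K.+1); rewrite lerD2r le_min !ge_min lexx/=.
by rewrite ler_pM2r// ler_nat leqnSn orbT.
Qed.

(** Riemann sum form of the identity between [levy_trunc] and the integral of the tail. The right
    endpoints avoid the tail at 0, which may be infinite; the cost is [levy_trunc m h]. *)
Lemma levy_tail_sum_ge (h : R) K : 0 < h ->
  levy_trunc (K.+1%:R * h) - levy_trunc h <=
  h * \sum_(j < K.+1) levy_tail (j.+1%:R * h).
Proof.
move=> h0; have jh j : 0 < j.+1%:R * h by rewrite mulr_gt0.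
have it j : m.-integrable D (EFin \o (fun s => h * \1_(`[j.+1%:R * h, +oo[) s)).
  by apply: integrableZlR => //; exact: integrable_tail.
rewrite mulr_sumr (eq_bigr (fun j : 'I_K.+1 =>
    \int[m]_(s in D) (h * \1_(`[j.+1%:R * h, +oo[) s))); last first.
  by move=> j _; rewrite RintegralZl//; exact: integrable_tail.
rewrite -(@Rintegral_sum _ _ _ m D mD K.+1 (fun j s => h * \1_(`[j.+1%:R * h, +oo[) s))//.
rewrite /levy_trunc -RintegralB//; try by apply: integrable_min; rewrite ltW.
apply: le_Rintegral => //.
- by apply: integrableBR => //; apply: integrable_min; rewrite ltW.
- exact: (@integrable_sumR _ _ _ m D mD K.+1 (fun j s => h * \1_(`[j.+1%:R * h, +oo[) s)).
- by move=> s /D0 s0; exact: indic_sum_ge.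
Qed.


Section bernstein_bounds.
Variable Psi : R -> R.
Hypothesis PsiE : forall x : R, 0 < x ->
  (Psi x)%:E = (\int[m]_(y in `]0%R, +oo[) (1 - expR (- (y * x)))%:E)%E.

Let ge0_1mexp (y x : R) : 0 < y -> 0 < x -> 0 <= 1 - expR (- (y * x)).
Proof.
by move=> y0 x0; rewrite subr_ge0 -expR0 ler_expR oppr_le0 mulr_ge0// ltW.
Qed.

Let measurable_1mexp (x : R) :
  measurable_fun setT (fun y : measurableTypeR R => 1 - expR (- (y * x))).
Proof.
apply: measurable_funB => //; apply: measurableT_comp => //.
by apply: measurableT_comp => //; exact: measurable_funM.
Qed.

(** Integrate 1 - e^(-r) <= min(r, 1) at r = s/t. Through this inequality the lower scaling of Psi
    becomes a lower bound on tail sums. *)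
Lemma psi_le_trunc t : 0 < t -> t * Psi t^-1 <= levy_trunc t.
Proof.
move=> t0; have t10 : 0 < t^-1 by rewrite invr_gt0.
rewrite mulrC -ler_pdivlMr// mulrC -lee_fin PsiE// EFinM.
rewrite Rintegral_EFin//; last by apply: integrable_min; exact: ltW.
rewrite -ge0_integralZl_EFin//; last 3 first.
- by move=> s /D0 s0; rewrite lee_fin le_min !ltW.
- by apply/measurable_EFinP/measurable_funTS; exact: measurable_fun_min.
- exact: ltW.
apply: ge0_le_integral => //.
- by move=> s /D0 s0; rewrite lee_fin ge0_1mexp.
- by apply/measurable_EFinP/measurable_funTS; exact: measurable_1mexp.
- apply: measurable_funeM.
  by apply/measurable_EFinP/measurable_funTS; exact: measurable_fun_min.
- move=> s /D0 s0; rewrite -EFinM lee_fin ler_pdivlMl// le_min.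
  have := expR_ge1Dx (- (s / t)); have := expR_ge0 (- (s / t)) => e0 e1.
  apply/andP; split; last by rewrite ler_piMr ?(ltW t0)//; lra.
  rewrite mulrC -ler_pdivlMr//; lra.
Qed.

Lemma psi_le_scale (x g : R) : 0 < x -> 1 <= g -> Psi (g * x) <= g * Psi x.
Proof.
move=> x0 g1; have g0 : 0 < g by exact: lt_le_trans g1.
rewrite -lee_fin EFinM PsiE ?mulr_gt0// PsiE//.
rewrite -ge0_integralZl_EFin//; last 3 first.
- by move=> s /D0 s0; rewrite lee_fin ge0_1mexp.
- by apply/measurable_EFinP/measurable_funTS; exact: measurable_1mexp.
- exact: ltW.
apply: ge0_le_integral => //.
- by move=> s /D0 s0; rewrite lee_fin ge0_1mexp// mulr_gt0.
- by apply/measurable_EFinP/measurable_funTS; exact: measurable_1mexp.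
- apply: measurable_funeM.
  by apply/measurable_EFinP/measurable_funTS; exact: measurable_1mexp.
- move=> s /D0 s0; rewrite -EFinM lee_fin.
  set a := s * x; have -> : s * (g * x) = g * a by rewrite /a; ring.
  (* tangent line at [a] to the convex function [r |-> expR (- r)] *)
  have -> : - (g * a) = - a + - ((g - 1) * a) by ring.
  rewrite expRD.
  have := expR_ge1Dx (- ((g - 1) * a)); have := expR_ge1Dx a.
  have : 0 < expR (- a) by exact: expR_gt0.
  have : expR (- a) * expR a = 1 by rewrite expRN mulVf// gt_eqF// expR_gt0.
  move=> e1 e2 e3 e4.
  have h1 : expR (- a) * (1 + - ((g - 1) * a)) <= expR (- a) * expR (- ((g - 1) * a)).
    by rewrite ler_pM2l.
  have h2 : expR (- a) * (1 + a) <= 1 by rewrite -[leRHS]e1 ler_pM2l.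
  have h3 : (g - 1) * (expR (- a) * (1 + a)) <= (g - 1) * 1.
    by rewrite ler_wpM2l// subr_ge0.
  nra.
Qed.

Lemma psi_gt0 (x : R) : m D != 0%E -> 0 < x -> 0 < Psi x.
Proof.
move=> mD0 x0; rewrite lt_neqAle -lee_fin PsiE//; apply/andP; split; last first.
  by apply: integral_ge0 => s /D0 s0; rewrite lee_fin ge0_1mexp.
apply: contra mD0 => /eqP P0.
have mf : measurable_fun D (fun y : measurableTypeR R => (1 - expR (- (y * x)))%:E).
  by apply/measurable_EFinP/measurable_funTS; exact: measurable_1mexp.
have := PsiE x0; rewrite -P0 => /esym I0.
have /(ae_eq_integral_abs _ mD mf) : (\int[m]_(y in D) `|(1 - expR (- (y * x)))%:E| = 0)%E.
  rewrite -[RHS]I0; apply: eq_integral => s /set_mem/D0 s0.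
  by rewrite gee0_abs// lee_fin ge0_1mexp.
move=> [N [mN N0 DN]].
rewrite -measure_le0 -N0 le_measure ?inE// => s /D0 s0.
apply: DN => /=; apply/not_implyP; split; first by rewrite /= in_itv/= s0.
move=> [] /eqP; rewrite subr_eq0 gt_eqF// -expR0 ltr_expR oppr_lt0.
exact: mulr_gt0.
Qed.

End bernstein_bounds.

End levy.

(** * The generator of the subordinator tested on a lattice *)

Section lattice.
Context {R : realType}.
Variable m : {measure set (measurableTypeR R) -> \bar R}.
Hypothesis m1 : (\int[m]_(y in `]0%R, +oo[) (Num.min y 1)%:E < +oo)%E.
Local Notation D := (`]0%R, +oo[%classic : set (measurableTypeR R)).

Let mD : measurable D. Proof. exact: measurable_itv. Qed.

Let D0 s : D s -> 0 < s. Proof. by rewrite /= in_itv/= andbT. Qed.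

Lemma telescope_minn (w : nat -> R) (n j M : nat) :
  \sum_(i < M) (w (n + i).+1 - w (n + i)%N) * (i < j)%N%:R =
  w (n + minn j M)%N - w n.
Proof.
elim: M => [|M IH]; first by rewrite big_ord0 minn0 addn0 subrr.
rewrite big_ord_recr/= IH; case: (ltnP M j) => Mj.
  by rewrite (minn_idPr Mj) mulr1 addnS; ring.
by rewrite (minn_idPl (leqW Mj)) mulr0 addr0.
Qed.

Section generator.
Variables (W : R -> R) (K B Om eps h : R) (N : nat) (u : nat -> R).
Hypotheses (h0 : 0 < h) (e0 : 0 < eps) (K0 : 0 <= K).
Hypothesis WB : forall s, eps <= s -> 0 <= W s <= B.
Hypothesis WK : forall s s', eps <= s -> eps <= s' -> `|W s - W s'| <= K * `|s - s'|.
Hypothesis WOm : forall s, eps + N.+1%:R * h <= s -> W s <= Om.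
Let t n : R := eps + n%:R * h.
Let w n := if (n <= N)%N then W (t n) else Om.

(** The jump [s] is rounded down to j h. The lattice part of the increment is written as single
    steps, each charged to the event that [s] reaches its height, so that integration produces
    tails; the remainder s - j h is at most min(s, h). *)
Lemma lattice_step_le n s : (n <= N)%N -> 0 < s ->
  W (t n + s) - W (t n) <=
  \sum_(i < N.+1 - n) (w (n + i).+1 - w (n + i)%N) * \1_(`[i.+1%:R * h, +oo[) s
  + K * Num.min s h.
Proof.
move=> nN s0; pose j := Num.truncn (s / h).
have sh0 : 0 <= s / h by rewrite divr_ge0// ltW.
have /andP[] := truncn_itv sh0; rewrite -/j ler_pdivlMr// ltr_pdivrMr// => jh js.
have -> : \sum_(i < N.+1 - n) (w (n + i).+1 - w (n + i)%N) * \1_(`[i.+1%:R * h, +oo[) s =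
    w (n + minn j (N.+1 - n))%N - w n.
  rewrite -telescope_minn; apply: eq_bigr => i _; congr (_ * _).
  rewrite indicE mem_setE in_itv/= andbT; congr (_%:R); congr nat_of_bool.
  apply/idP/idP => [ih|ij].
    by rewrite -ltnS -(ltr_nat R) -(ltr_pM2r h0) (le_lt_trans ih).
  by rewrite (le_trans _ jh)// ler_pM2r// ler_nat.
rewrite {2}/w nN.
have Kmin : 0 <= K * Num.min s h by rewrite mulr_ge0// le_min !ltW.
have tn : eps <= t n by rewrite lerDl mulr_ge0// ltW.
(* A jump past the last node lands where W is at most [Om], the value given to [w] at index N +
   1. *)
have [Nj|jN] := leqP (N.+1 - n) j.
  rewrite subnKC; last exact: leqW.
  rewrite /w ltnn; suff : W (t n + s) <= Om by lra.
  apply: WOm; rewrite /t -addrA lerD2l.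
  have : (N.+1 - n)%:R * h <= s.
    by rewrite (le_trans _ jh)// ler_pM2r// ler_nat.
  rewrite natrB 1?leqW// mulrBl; lra.
have njN : (n + j <= N)%N by rewrite -leq_subRL// -ltnS -subSn.
rewrite /w njN.
have tnj : t (n + j)%N = t n + j%:R * h by rewrite /t natrD mulrDl addrA.
have : W (t n + s) - W (t (n + j)%N) <= K * (s - j%:R * h).
  apply: (le_trans (ler_norm _)); apply: (le_trans (WK _ _)).
  - by rewrite ler_wpDr// ltW.
  - by rewrite tnj ler_wpDr// mulr_ge0// ltW.
  - rewrite ler_wpM2l// tnj opprD addrACA subrr add0r ger0_norm// subr_ge0//.
have : K * (s - j%:R * h) <= K * Num.min s h.
  rewrite ler_wpM2l// le_min lerBlDr lerDl mulr_ge0 ?(ltW h0)//=.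
  by move: js; rewrite -natr1 mulrDl mul1r; lra.
lra.
Qed.

Let B0 : 0 <= B.
Proof. by have /andP[h1 h2] := WB (lexx eps); exact: le_trans h2. Qed.

Lemma lattice_increment_integrable x : eps <= x ->
  m.-integrable D (EFin \o (fun s => W (x + s) - W x)).
Proof.
move=> ex; apply: (@levy_integrable _ _ m1 _ (K + B)).
  (* W is controlled only on [eps, +oo), so [s] is replaced by its positive part to obtain a
     function continuous on the whole line. *)
  have mV : measurable_fun setT (fun s : R => W (x + Num.max s 0)).
    apply: continuous_measurable_fun => s; apply/cvgrPdist_le => e e_gt0.
    have K1 : 0 < K + 1 by rewrite ltr_wpDl.
    near=> s'.
    apply: (le_trans (WK _ _)); rewrite ?ler_wpDr// ?le_max ?lexx ?orbT//.
    rewrite opprD addrACA subrr add0r.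
    apply: (@le_trans _ _ ((K + 1) * `|s - s'|)).
      apply: ler_pM => //; first by rewrite lerDl.
      have n1 := ler_norm (s - s'); have := ler_norm (s' - s); rewrite distrC => n2.
      have n3 := normr_ge0 (s - s').
      by rewrite ler_norml; case: (leP s 0) => ?; case: (leP s' 0) => ?;
        apply/andP; split; lra.
    rewrite mulrC -ler_pdivlMr//; near: s'.
    by apply: cvgr_dist_le; [exact: cvg_id|rewrite divr_gt0].
  apply: (eq_measurable_fun (fun s : measurableTypeR R => W (x + Num.max s 0) - W x)).
    by move=> s /set_mem/D0 s0; rewrite max_l// ltW.
  by apply: measurable_funTS; exact: measurable_funB.
move=> s s0; have xs : eps <= x + s by rewrite ler_wpDr// ltW.
case: (leP s 1) => s1.
  apply: (le_trans (WK xs ex)).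
  by rewrite addrAC subrr add0r ger0_norm ?(ltW s0)// mulrDl lerDl mulr_ge0// ltW.
rewrite mulr1; have /andP[a1 a2] := WB xs; have /andP[a3 a4] := WB ex.
rewrite ler_norml; apply/andP; split.
  by rewrite opprD (le_trans (y := - B))// ?gerDr ?oppr_le0// -[- B]add0r lerD// lerN2.
by rewrite (le_trans (y := B))// ?lerDr// -[leRHS]subr0 lerB.
Unshelve. all: by end_near.
Qed.

(** After exchanging the order of summation, the step from node k to node k + 1 has coefficient
    equal to the renewal convolution at k, which is 1. The steps then telescope to [Om - W eps], and
    only the rounding error is left. *)
Lemma lattice_generator_le :
  (forall k, 0 <= u k) ->
  (forall i, (i <= N)%N ->
     \sum_(k < i.+1) u k * levy_tail m ((i - k).+1%:R * h) = 1) ->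
  \sum_(n < N.+1) u n * \int[m]_(s in D) (W (t n + s) - W (t n)) <=
  Om - W eps + K * levy_trunc m h * \sum_(n < N.+1) u n.
Proof.
move=> u0 uE.
pose dw n := w n.+1 - w n.
have it i : m.-integrable D (EFin \o \1_(`[i.+1%:R * h, +oo[)).
  by apply: integrable_tail => //; rewrite mulr_gt0.
have id n i : m.-integrable D
    (EFin \o (fun s => dw (n + i)%N * \1_(`[i.+1%:R * h, +oo[) s)).
  exact: integrableZlR.
have imin : m.-integrable D (EFin \o (fun s => K * Num.min s h)).
  by apply: integrableZlR => //; apply: integrable_min => //; exact: ltW.
have step (n : 'I_N.+1) : \int[m]_(s in D) (W (t n + s) - W (t n)) <=
    \sum_(i < N.+1 - n) dw (n + i)%N * levy_tail m (i.+1%:R * h) + K * levy_trunc m h.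
  have nN : (n <= N)%N by rewrite -ltnS.
  apply: (@le_trans _ _ (\int[m]_(s in D)
    (\sum_(i < N.+1 - n) dw (n + i)%N * \1_(`[i.+1%:R * h, +oo[) s + K * Num.min s h))).
    apply: le_Rintegral => //.
    - by apply: lattice_increment_integrable; rewrite lerDl mulr_ge0// ltW.
    - apply: integrableDR => //.
      exact: (@integrable_sumR _ _ _ m D mD _
        (fun i s => dw (n + i)%N * \1_(`[i.+1%:R * h, +oo[) s)).
    - by move=> s /D0 s0; exact: lattice_step_le.
  rewrite RintegralD//; last first.
    exact: (@integrable_sumR _ _ _ m D mD _
        (fun i s => dw (n + i)%N * \1_(`[i.+1%:R * h, +oo[) s)).
  rewrite (@Rintegral_sum _ _ _ m D mD _
        (fun i s => dw (n + i)%N * \1_(`[i.+1%:R * h, +oo[) s))//.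
  rewrite RintegralZl//; last by apply: integrable_min => //; exact: ltW.
  by rewrite lerD2r; apply: ler_sum => i _; rewrite RintegralZl.
apply: (@le_trans _ _ (\sum_(n < N.+1) u n *
  (\sum_(i < N.+1 - n) dw (n + i)%N * levy_tail m (i.+1%:R * h) + K * levy_trunc m h))).
  by apply: ler_sum => n _; rewrite ler_wpM2l.
under eq_bigr do rewrite mulrDr mulr_sumr.
rewrite big_split/= -mulr_suml [X in _ + X]mulrC lerD2r.
have -> : \sum_(n < N.+1) \sum_(i < N.+1 - n)
    u n * (dw (n + i)%N * levy_tail m (i.+1%:R * h)) =
  \sum_(k < N.+1) \sum_(n < k.+1) u n * levy_tail m ((k - n).+1%:R * h) * dw k.
  rewrite (sum_triangle (fun n k => u n * levy_tail m ((k - n).+1%:R * h) * dw k)).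
  by apply: eq_bigr => n _; apply: eq_bigr => i _; rewrite addKn; ring.
have -> : \sum_(k < N.+1) \sum_(n < k.+1) u n * levy_tail m ((k - n).+1%:R * h) * dw k =
    \sum_(k < N.+1) dw k.
  apply: eq_bigr => k _; rewrite -mulr_suml uE ?mul1r//.
  by rewrite -ltnS.
have := @telescope_minn w 0 N.+1 N.+1; rewrite minnn add0n => E.
have -> : \sum_(k < N.+1) dw k = w N.+1 - w 0%N.
  by rewrite -E; apply: eq_bigr => i _; rewrite ltn_ord mulr1 add0n.
by rewrite /w ltnn /= /t mul0r addr0.
Qed.

End generator.
End lattice.

(** * Weights approximating the potential measure, from WLSC *)

Section weights.
Context {R : realType}.
Variable m : {measure set (measurableTypeR R) -> \bar R}.
Hypothesis m1 : (\int[m]_(y in `]0%R, +oo[) (Num.min y 1)%:E < +oo)%E.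
Hypothesis mD0 : m (`]0%R, +oo[%classic : set (measurableTypeR R)) != 0%E.
Variable Psi : R -> R.
Hypothesis PsiE : forall x : R, 0 < x ->
  (Psi x)%:E = (\int[m]_(y in `]0%R, +oo[) (1 - expR (- (y * x)))%:E)%E.
Variables (mu c theta : R).
Hypotheses (mu0 : 0 < mu) (c0 : 0 < c) (theta0 : 0 <= theta).
Hypothesis wlsc : WLSC Psi mu c theta.

(** Concavity gives Psi(gx) <= g Psi(x) for g >= 1, so c g^mu <= g for all such g. The chosen [g]
    has g^(mu - 1) = 1 + 1/c, which would give c + 1 <= 1. *)
Lemma WLSC_le1 : mu <= 1.
Proof.
rewrite leNgt; apply/negP => mu1.
pose x := theta + 1; have x0 : 0 < x by rewrite ltr_wpDl.
have P0 : 0 < Psi x by exact: (psi_gt0 PsiE).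
pose g := (1 + c^-1) `^ ((mu - 1)^-1).
have mu10 : 0 < mu - 1 by rewrite subr_gt0.
have c10 : 0 < c^-1 by rewrite invr_gt0.
have g1 : 1 <= g.
  rewrite /g -[leLHS](powRr0 (1 + c^-1)) ler_powR ?lerDl ?invr_ge0 ?ltW//.
have xx : theta < x by rewrite ltrDl.
have := le_trans (wlsc xx g1) (psi_le_scale PsiE x0 g1).
rewrite ler_pM2r// => cg.
have g0 : 0 < g by exact: lt_le_trans g1.
have : c * g `^ (mu - 1) <= 1.
  rewrite powRD ?(gt_eqF g0) ?implybT// powR_inv1 ?(ltW g0)// mulrA.
  by rewrite ler_pdivrMr// mul1r.
rewrite /g -powRrM mulVf ?gt_eqF// powRr1; last by rewrite addr_ge0// ltW.
by rewrite mulrDr mulfV ?gt_eqF// mulr1 gerDr leNgt c0.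
Qed.

(** WLSC is used from the single base point theta + 1 up to 1/t, which is why t is limited to
    [x^-1]. *)
Lemma levy_trunc_lower : exists c1 T0, [/\ 0 < c1, 0 < T0 &
  forall t, 0 < t -> t <= T0 -> c1 * t <= levy_trunc m t * t `^ mu].
Proof.
pose x := theta + 1; have x0 : 0 < x by rewrite ltr_wpDl.
have P0 : 0 < Psi x by exact: (psi_gt0 PsiE).
exists (c * Psi x * x `^ (- mu)), x^-1; split.
- by rewrite !mulr_gt0// powR_gt0.
- by rewrite invr_gt0.
move=> t t0 tx; have xt : theta < x by rewrite ltrDl.
have g1 : 1 <= (t * x)^-1.
  by rewrite invf_ge1 ?mulr_gt0// -ler_pdivlMr// div1r.
have := wlsc xt g1.
have -> : (t * x)^-1 * x = t^-1 by field; rewrite !gt_eqF.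
have -> : (t * x)^-1 `^ mu = t `^ (- mu) * x `^ (- mu).
  rewrite -[_^-1]powR_inv1 ?mulr_ge0 ?(ltW t0) ?(ltW x0)// -powRrM mulN1r.
  by rewrite powRM ?(ltW t0) ?(ltW x0).
move=> h1.
have h2 := psi_le_trunc m1 PsiE t0.
have tmu : 0 < t `^ mu by rewrite powR_gt0.
have -> : c * Psi x * x `^ (- mu) * t =
   t * (c * (t `^ (- mu) * x `^ (- mu)) * Psi x) * t `^ mu.
  by rewrite [t `^ (- mu)]powRN; field; rewrite gt_eqF.
rewrite ler_wpM2r ?(ltW tmu)//; apply: le_trans h2.
by rewrite ler_wpM2l// (ltW t0).
Qed.

(* The weights are the truncated renewal sequence of the tails of [m] on the
   lattice [h * nat], with [h] small compared to [eps] and [del]. *)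
Lemma potential_weights a : 0 < a -> a < mu ->
  exists C1 T, [/\ 0 < C1, 0 < T & forall eps del, 0 < eps -> eps <= T -> 0 < del ->
    exists N (u t : nat -> R), [/\ forall k, 0 <= u k, forall k, eps <= t k,
      \sum_(n < N.+1) u n * t n `^ (- a) <= C1 &
      forall (W : R -> R) (K B Om : R), 0 <= K ->
        (forall s, eps <= s -> 0 <= W s <= B) ->
        (forall s s', eps <= s -> eps <= s' -> `|W s - W s'| <= K * `|s - s'|) ->
        (forall s, T <= s -> W s <= Om) ->
        \sum_(n < N.+1) u n * \int[m]_(s in `]0%R, +oo[) (W (t n + s) - W (t n)) <=
        Om - W eps + K * del]].
Proof.
move=> a0 amu; have [c1 [T0 [c10 T00 HI]]] := levy_trunc_lower.
have T0' : 0 < T0 / 2 by rewrite divr_gt0.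
pose b := mu - a; have b0 : 0 < b by rewrite subr_gt0.
have ab : a + b = mu by rewrite /b addrC subrK.
(* The 6 is 2 times 3: half of [levy_trunc] is lost to the first lattice cell, and 2(n + K0) + 1 is
   at most 3(n + K0). *)
pose C := 6 / c1; have C0 : 0 < C by rewrite divr_gt0.
exists (C * (1 + a / b) * T0 `^ b), (T0 / 2); split => //.
  by rewrite mulr_gt0 ?powR_gt0// mulr_gt0// addr_gt0// divr_gt0.
move=> eps del e0 eT del0.
have Ipos t : 0 < t -> t <= T0 -> 0 < levy_trunc m t.
  move=> t0 /(HI _ t0) h1; have := lt_le_trans (mulr_gt0 c10 t0) h1.
  by rewrite pmulr_lgt0 ?powR_gt0.
have eT0 : eps <= T0 by lra.
(* The first bound keeps at least half of [levy_trunc] in the lattice tail sums; the second turns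
   the total rounding error into at most K times [del]. *)
pose q := Num.min (levy_trunc m eps / 2) (del / (C * T0 `^ mu)).
have q0 : 0 < q.
  have CT : 0 < C * T0 `^ mu by rewrite mulr_gt0// powR_gt0.
  by rewrite lt_min divr_gt0 ?Ipos//= divr_gt0.
have [h0 h00 Hh0] := levy_trunc_small m1 q0.
(* The mesh divides [eps], so that t_n = (n + K0) h is a lattice point; K0 >= 1 keeps it
   positive. *)
pose K0 := (Num.truncn (eps / h0)).+1.
pose h := eps / K0%:R.
have h_gt0 : 0 < h by rewrite divr_gt0// ltr0n.
have hh0 : h <= h0.
  rewrite /h ler_pdivrMr ?ltr0n// mulrC -ler_pdivrMr// ltW//.
  by rewrite truncnS_gt.
have := Hh0 _ h_gt0 hh0; rewrite le_min => /andP[Ih1 Ih2].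
(* All nodes stay below T0, where the lower bound on [levy_trunc] holds, while index N + 1 passes
   T0/2, where [Om] takes over. *)
pose N := Num.truncn (T0 / 2 / h).
have /andP[NT TN] : N%:R * h <= T0 / 2 < N.+1%:R * h.
  have p0 : 0 <= T0 / 2 / h by rewrite divr_ge0// ltW.
  by have := truncn_itv p0; rewrite -/N ler_pdivlMr// ltr_pdivrMr.
have epsE : eps = K0%:R * h by rewrite mulrC divfK// gt_eqF// ltr0n.
pose Nn j := levy_tail m (j.+1%:R * h).
have jh j : 0 < j.+1%:R * h by rewrite mulr_gt0.
have Nle i j : (i <= j)%N -> Nn j <= Nn i.
  by move=> ij; apply: levy_tail_le => //; rewrite ler_pM2r// ler_nat.
have N0 i : 0 <= Nn i by exact: levy_tail_ge0.
pose t n : R := eps + n%:R * h.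
have tE n : t n = (n + K0)%:R * h by rewrite /t natrD mulrDl epsE addrC.
have te n : eps <= t n by rewrite lerDl mulr_ge0// ltW.
have tpos n : 0 < t n by exact: lt_le_trans (te n).
have sumN n : levy_trunc m (t n) / 2 <= h * \sum_(j < (n + K0).+1) Nn j.
  apply: le_trans (levy_tail_sum_ge m1 _ h_gt0).
  have l1 : levy_trunc m (t n) <= levy_trunc m ((n + K0).+1%:R * h).
    by apply: levy_trunc_le => //; [exact: ltW|rewrite tE ler_pM2r// ler_nat].
  have l2 : levy_trunc m eps <= levy_trunc m (t n).
    by apply: levy_trunc_le => //; exact: ltW.
  lra.
have Npos : 0 < Nn 0%N.
  rewrite lt_neqAle N0 andbT; apply/eqP => N00.
  have := sumN 0%N; rewrite big1 ?mulr0; last first.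
    by move=> j _; apply/eqP; rewrite eq_le N0 andbT N00 Nle.
  by rewrite /t mul0r addr0 leNgt divr_gt0// Ipos.
have [u u0 uE] := renewal_exists (2 * (N + K0)) Nle N0 Npos.
(* The sum up to n is enlarged to n + K0, so the elementary renewal bound is read at time t_n = (n +
   K0) h and not at n h. In this way the offset [eps] is accounted for, also at n = 0. *)
have uC n : (n <= N)%N -> \sum_(k < n.+1) u k <= C * t n `^ (a + b).
  move=> nN; rewrite ab.
  have tT : t n <= T0.
    have : n%:R * h <= N%:R * h by rewrite ler_pM2r// ler_nat.
    by rewrite /t; lra.
  have := HI _ (tpos n) tT.
  have := @renewal_sum_le _ u Nn (n + K0) u0 N0 _.
  move=> /(_ (fun i iN => uE i (leq_trans iN (leq_mul (leqnn 2) (leq_add nN (leqnn K0)))))).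
  set U' := \sum_(k < _) u k => h1 h2.
  have UU' : \sum_(k < n.+1) u k <= U'.
    by apply: ler_sum_widen => //; rewrite ltnS leq_addr.
  apply: (le_trans UU').
  have U'0 : 0 <= U' by apply: sumr_ge0.
  have h3 : U' * (levy_trunc m (t n) / 2) <= 3 * t n.
    apply: (le_trans (ler_wpM2l U'0 (sumN n))).
    rewrite mulrCA; apply: (@le_trans _ _ (h * (2 * (n + K0)).+1%:R)).
      by rewrite ler_wpM2l// ltW.
    rewrite tE mulrA [leRHS]mulrC ler_pM2l// -natrM ler_nat.
    by rewrite -addn1 (mulSn 2) addnC leq_add2r addn_gt0 orbT.
  have h4 : c1 * U' <= 6 * t n `^ mu.
    have I0 := Ipos _ (tpos n) tT.
    rewrite -(ler_pM2r (tpos n)).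
    have -> : c1 * U' * t n = U' * (c1 * t n) by ring.
    apply: (le_trans (ler_wpM2l U'0 h2)).
    have -> : U' * (levy_trunc m (t n) * t n `^ mu) =
       2 * (U' * (levy_trunc m (t n) / 2)) * t n `^ mu by field.
    have -> : 6 * t n `^ mu * t n = 2 * (3 * t n) * t n `^ mu by ring.
    by rewrite ler_wpM2r ?powR_ge0// ler_wpM2l.
  by rewrite /C mulrAC ler_pdivlMr// mulrC.
exists N, u, t; split => //.
- apply: (le_trans (abel_powR_le a0 b0 (ltW C0) u0 tpos _ uC)).
    by move=> k; rewrite /t lerD2l ler_pM2r// ler_nat.
  have Cab : 0 <= C * (1 + a / b) by rewrite ltW// mulr_gt0// addr_gt0// divr_gt0.
  apply: (ler_wpM2l Cab).
  by rewrite ge0_ler_powR ?nnegrE ?(ltW b0) ?(ltW (tpos N)) ?(ltW T00)// /t; lra.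
- move=> W K B Om Kp WB WK WOm.
  have WOm' s : eps + N.+1%:R * h <= s -> W s <= Om.
    by move=> hs; apply: WOm; lra.
  apply: (le_trans (lattice_generator_le m1 h_gt0 Kp WB WK WOm' u0 _)).
    move=> i iN; apply: uE; apply: (leq_trans iN).
    by rewrite (leq_trans (leq_addr K0 N))// leq_pmull.
  rewrite lerD2l -mulrA ler_wpM2l//.
  have U0 : 0 <= \sum_(n < N.+1) u n by exact: sumr_ge0.
  have tNT : t N <= T0 by rewrite /t; lra.
  have UT : \sum_(n < N.+1) u n <= C * T0 `^ mu.
    apply: (le_trans (uC _ (leqnn N))); rewrite ab ler_wpM2l ?(ltW C0)//.
    by rewrite ge0_ler_powR ?nnegrE ?(ltW mu0) ?(ltW (tpos N)) ?(ltW T00).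
  apply: (@le_trans _ _ (levy_trunc m h * (C * T0 `^ mu))).
    by rewrite ler_wpM2l// levy_trunc_ge0// ltW.
  by rewrite -ler_pdivlMr// mulr_gt0// powR_gt0.
Qed.

End weights.

(** * Lipschitz dependence of the heat kernel on time *)

Section heat_time.
Context {R : realType}.

(** The prefactor is handled through its logarithm and the exponential through x e^(-x) <= 1 at x =
    |z|^2/(4t'). The latter bound is uniform in [z]. *)
Lemma heat_time_lipschitz d (eps : R) : 0 < eps ->
  exists2 K, 0 <= K & forall (t t' : R) (z : 'rV[R]_d), eps <= t -> eps <= t' ->
    `|heat t z - heat t' z| <= K * `|t - t'|.
Proof.
move=> e0; pose k : R := d%:R / 2; pose P (t : R) := (4 * pi * t) `^ (- k).
have k0 : 0 <= k by rewrite divr_ge0.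
have p4 : 0 < 4 * pi :> R by rewrite mulr_gt0// pi_gt0.
have P0 (t : R) : 0 <= P t by exact: powR_ge0.
have PE (t : R) : 0 < t -> P t = expR (- k * ln (4 * pi * t)).
  by move=> t0; rewrite /P /powR gt_eqF// !mulr_gt0 ?pi_gt0.
have lnB (t t' : R) : 0 < t -> t <= t' -> 0 <= ln (4 * pi * t') - ln (4 * pi * t) <= (t' - t) / t.
  move=> t0 tt'; have t'0 := lt_le_trans t0 tt'.
  have l0 : ln (4 * pi * t) <= ln (4 * pi * t').
    by rewrite ler_ln ?posrE ?mulr_gt0 ?pi_gt0// ler_pM2l.
  rewrite subr_ge0 l0/=.
  have u0 : 0 <= (t' - t) / t by rewrite divr_ge0 ?subr_ge0// ltW.
  have u1 : 0 < 1 + (t' - t) / t by rewrite ltr_pwDl.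
  have -> : ln (4 * pi * t') = ln (4 * pi * t) + ln (1 + (t' - t) / t).
    rewrite -lnM ?posrE ?mulr_gt0 ?pi_gt0//; congr ln; field.
    by rewrite gt_eqF.
  rewrite addrAC subrr add0r.
  by apply: le_ln1Dx; rewrite (lt_le_trans _ u0)// ltrN10.
have Ple (t t' : R) : 0 < t -> t <= t' -> P t' <= P t.
  move=> t0 tt'; have t'0 := lt_le_trans t0 tt'.
  rewrite !PE// ler_expR !mulNr lerN2 ler_wpM2l//.
  by have /andP[] := lnB _ _ t0 tt'; rewrite subr_ge0.
exists (P eps * (k + 1) / eps).
  by rewrite divr_ge0 ?(ltW e0)// mulr_ge0// addr_ge0.
suff H (t t' : R) (z : 'rV[R]_d) : eps <= t -> t <= t' ->
    `|heat t z - heat t' z| <= P eps * (k + 1) / eps * (t' - t).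
  move=> t t' z et et'; have [tt'|t't] := leP t t'.
    by rewrite [`|t - t'|]distrC [`|t' - t|]ger0_norm ?subr_ge0//; exact: H.
  rewrite distrC [`|t - t'|]ger0_norm ?subr_ge0 ?(ltW t't)//.
  by apply: H => //; exact: ltW.
move=> et tt'; have t0 := lt_le_trans e0 et; have t'0 := lt_le_trans t0 tt'.
set q := sqn z; have q0 : 0 <= q by exact: sqn_ge0.
pose E (t : R) := expR (- (q / (4 * t))).
have E01 (s : R) : 0 < s -> 0 <= E s <= 1.
  move=> s0; rewrite expR_ge0/= -[leRHS]expR0 ler_expR oppr_le0 divr_ge0//.
  by rewrite mulr_ge0// ltW.
have h1 : 0 <= P t - P t' <= P eps * k * ((t' - t) / eps).
  rewrite subr_ge0 Ple//=.
  have [b1 b2] := andP (lnB _ _ t0 tt'); set L := ln _ - ln _ in b1 b2.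
  have -> : P t - P t' = P t * (1 - expR (- k * L)).
    by rewrite mulrBr mulr1 !PE// -expRD; congr (_ - expR _); rewrite /L; ring.
  have e1 := expR_ge1Dx (- k * L).
  rewrite -mulrA ler_pM//.
  - by rewrite subr_ge0 -expR0 ler_expR mulNr oppr_le0 mulr_ge0.
  - exact: Ple.
  - apply: (@le_trans _ _ (k * L)); first by move: e1; rewrite mulNr; lra.
    rewrite ler_wpM2l//; apply: (le_trans b2); rewrite ler_wpM2l ?subr_ge0//.
    by rewrite lef_pV2 ?posrE.
have h2 : 0 <= E t' - E t <= (t' - t) / eps.
  pose x := q / (4 * t').
  have -> : E t' - E t = E t' * (1 - expR (- (x * ((t' - t) / t)))).
    rewrite mulrBr mulr1 /E -expRD; congr (_ - expR _); rewrite /x.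
    by field; rewrite !gt_eqF.
  have x0 : 0 <= x by rewrite divr_ge0// mulr_ge0// ltW.
  have d0 : 0 <= (t' - t) / t by rewrite divr_ge0 ?subr_ge0// ltW.
  have /andP[E'0 E'1] := E01 _ t'0.
  have e1 := expR_ge1Dx (- (x * ((t' - t) / t))).
  apply/andP; split.
    rewrite mulr_ge0// subr_ge0 -expR0 ler_expR oppr_le0 mulr_ge0//.
  apply: (@le_trans _ _ (E t' * (x * ((t' - t) / t)))).
    by rewrite ler_wpM2l//; lra.
  rewrite mulrA -[leRHS]mul1r; apply: ler_pM => //; first exact: mulr_ge0.
    by rewrite mulrC; exact: (exprM_exp_le x).
  by rewrite ler_wpM2l ?subr_ge0// lef_pV2 ?posrE.
have PE0 : P t' <= P eps by apply: Ple => //; exact: le_trans tt'.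
have /andP[a1 a2] := h1; have /andP[b1 b2] := h2.
have /andP[E0 E1] := E01 _ t0.
have -> : heat t z - heat t' z = (P t - P t') * E t - P t' * (E t' - E t).
  by rewrite /heat -/q -/(E t) -/(E t') -/k -/(P t) -/(P t'); ring.
have u1 : 0 <= (P t - P t') * E t by rewrite mulr_ge0.
have u2 : (P t - P t') * E t <= P eps * k * ((t' - t) / eps).
  by rewrite -[leRHS]mulr1 ler_pM.
have u3 : 0 <= P t' * (E t' - E t) by rewrite mulr_ge0.
have u4 : P t' * (E t' - E t) <= P eps * ((t' - t) / eps) by rewrite ler_pM.
have -> : P eps * (k + 1) / eps * (t' - t) =
  P eps * k * ((t' - t) / eps) + P eps * ((t' - t) / eps) by field; rewrite gt_eqF.
by rewrite ler_norml; apply/andP; split; lra.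
Qed.

End heat_time.

(** * Space derivatives of the heat kernel *)

Section smooth.
Context {R : realType} {d : nat}.
Local Notation vec := ('rV[R]_d).
Local Notation e_ j := (delta_mx ord0 j : vec).

(** Directional derivatives are computed as one-variable derivatives at 0 along the line through
    [x]; [derive_lineP] goes the other way, at any point of the line. *)
Lemma is_derive_line (f : vec -> R) (x v : vec) (df : R) :
  is_derive (0 : R) 1 (fun h : R => f (h *: v + x)) df -> is_derive x v f df.
Proof.
have E : (fun h : R => h^-1 *: (f (h *: v + x) - f x)) =
    (fun h : R => h^-1 *: (f ((h *: 1 + 0) *: v + x) - f (0 *: v + x))).
  by apply/funext => h; rewrite addr0 [_%:A]mulr1 scale0r add0r.
by move=> [d1 d2]; apply: DeriveDef; rewrite /derivable /derive E.
Qed.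

Lemma derive_lineP (f : vec -> R) (x v : vec) (df : R) (h : R) :
  is_derive (h *: v + x) v f df ->
  is_derive h 1 (fun h : R => f (h *: v + x)) df.
Proof.
have E : (fun s : R => s^-1 *: (f (s *: v + (h *: v + x)) - f (h *: v + x))) =
    (fun s : R => s^-1 *: (f ((s *: 1 + h) *: v + x) - f (h *: v + x))).
  by apply/funext => s; rewrite [_%:A]mulr1 scalerDl addrA.
by move=> [d1 d2]; apply: DeriveDef; rewrite /derivable /derive -E.
Qed.

Lemma sqn_line (x : vec) j (h : R) :
  sqn (h *: e_ j + x) = sqn x + 2 * h * x ord0 j + h ^+ 2.
Proof.
rewrite /sqn (bigD1 j)//= [in RHS](bigD1 j)//= !mxE !eqxx/= mulr1.
rewrite (eq_bigr (fun i => x ord0 i ^+ 2)); last first.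
  by move=> i ij; rewrite !mxE eqxx/= (negbTE ij) mulr0 add0r.
by ring.
Qed.

Lemma is_derive_sqn (x : vec) j : is_derive x (e_ j) (@sqn R d) (2 * x ord0 j).
Proof.
apply: is_derive_line.
rewrite (_ : (fun h : R => _) =
  (fun h : R => sqn x + 2 * h * x ord0 j + h ^+ 2)); last first.
  by apply/funext => h; rewrite sqn_line.
apply: is_derive_eq; rewrite ?scaler0 ?expr1 /GRing.scale/=; ring.
Qed.

Lemma is_derive_coord (x : vec) i j :
  is_derive x (e_ j) (fun z : vec => z ord0 i) (i == j)%:R.
Proof.
apply: is_derive_line.
rewrite (_ : (fun h : R => _) = (fun h : R => h * (i == j)%:R + x ord0 i)).
  by apply: is_derive_eq; rewrite ?scaler0 /GRing.scale/=; ring.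
by apply/funext => h; rewrite !mxE eqxx.
Qed.

(** First partial derivative of the heat kernel in closed form; [heat2] is the second one. Their
    polynomial factors are absorbed by the Gaussian, so both are bounded. *)
Definition heat1 i (t : R) (z : vec) : R := - (z ord0 i / (2 * t)) * heat t z.

Definition heat2 i j (t : R) (z : vec) : R :=
  (z ord0 i * z ord0 j / (4 * t ^+ 2) - (i == j)%:R / (2 * t)) * heat t z.

Lemma is_derive_heat t (x : vec) j : 0 < t ->
  is_derive x (e_ j) (heat t) (heat1 j t x).
Proof.
move=> t0; apply: is_derive_line; rewrite /heat /heat1.
rewrite (_ : (fun h : R => _) = (fun h : R => (4 * pi * t) `^ (- (d%:R / 2)) *
  expR (- ((sqn x + 2 * h * x ord0 j + h ^+ 2) / (4 * t))))); last first.
  by apply/funext => h; rewrite sqn_line.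
apply: is_derive_eq; rewrite ?scaler0 ?expr1 /GRing.scale/=.
rewrite !(mulr0, expr0n, addr0, mul0r)/= /heat; field.
by rewrite gt_eqF.
Qed.

Lemma is_derive_heat1 t (x : vec) i j : 0 < t ->
  is_derive x (e_ j) (heat1 i t) (heat2 i j t x).
Proof.
move=> t0.
have h1 := is_derive_coord x i j; have h2 := is_derive_heat x j t0.
have -> : heat1 i t = (fun z : vec => - (2 * t)^-1 *: (z ord0 i * heat t z)).
  by apply/funext => z; rewrite /heat1 /GRing.scale/=; ring.
apply: is_derive_eq; rewrite /GRing.scale/= /heat1 /heat2.
by field; rewrite gt_eqF.
Qed.

Lemma continuous_coord i : continuous (fun z : vec => z ord0 i).
Proof. by move=> z; exact: coord_continuous. Qed.

Lemma continuous_sqn : continuous (@sqn R d).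
Proof.
rewrite /sqn; apply: continuous_big => [|i _]; first exact: add_continuous.
move=> z; apply: (continuous_comp (f := fun z : vec => z ord0 i) (g := fun r : R => r ^+ 2)).
  exact: continuous_coord.
exact: exprn_continuous.
Qed.

Lemma continuous_heat t : continuous (@heat R d t).
Proof. 
move=> z; apply: (@continuousM _ _ (fun=> (4 * pi * t) `^ (- (d%:R / 2)))
  (fun z : vec => expR (- (sqn z / (4 * t))))); first exact: cst_continuous.
apply: (continuous_comp (f := fun z : vec => - (sqn z / (4 * t))) (g := expR)).
  apply: continuousN; apply: continuousM; first exact: continuous_sqn.
  exact: cst_continuous.
exact: continuous_expR.
Qed.

Lemma continuous_heat1 i t : continuous (heat1 i t).
Proof.
move=> z; apply: (@continuousM _ _ (fun z : vec => - (z ord0 i / (2 * t))) (heat t)).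
  apply: continuousN; apply: continuousM; first exact: continuous_coord.
  exact: cst_continuous.
exact: continuous_heat.
Qed.

Lemma continuous_heat2 i j t : continuous (heat2 i j t).
Proof.
move=> z; apply: (@continuousM _ _ (fun z : vec =>
  z ord0 i * z ord0 j / (4 * t ^+ 2) - (i == j)%:R / (2 * t)) (heat t)).
  apply: continuousB; last exact: cst_continuous.
  apply: continuousM; last exact: cst_continuous.
  by apply: continuousM; exact: continuous_coord.
exact: continuous_heat.
Qed.

Lemma sqn_heat_bounded t : 0 < t -> exists C, forall z : vec, sqn z * heat t z <= C.
Proof.
move=> t0; have t20 : 0 < 2 * t by rewrite mulr_gt0.
exists (8 * t * 2 `^ (d%:R / 2) * (4 * pi * (2 * t)) `^ (- (d%:R / 2))) => z.
apply: (le_trans (sqn_heat_le z t0)); rewrite ler_wpM2l ?le_heat_peak//.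
by rewrite mulr_ge0 ?powR_ge0// mulr_ge0// ltW.
Qed.

Lemma coord_sqr_le (z : vec) i : z ord0 i ^+ 2 <= sqn z.
Proof. by rewrite /sqn (bigD1 i)//= lerDl sumr_ge0// => j _; rewrite sqr_ge0. Qed.

Lemma coordM_le (z : vec) i j : `|z ord0 i * z ord0 j| <= sqn z.
Proof.
have := coord_sqr_le z i; have := coord_sqr_le z j.
rewrite ler_norml; set a := z ord0 i; set b := z ord0 j => ha hb.
have := sqr_ge0 (a + b); have := sqr_ge0 (a - b); rewrite sqrrB sqrrD => h1 h2.
by apply/andP; split; lra.
Qed.

Lemma heat_bounded t : 0 < t -> exists C, forall z : vec, `|heat t z| <= C.
Proof.
move=> t0; exists ((4 * pi * t) `^ (- (d%:R / 2))) => z.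
by rewrite ger0_norm ?heat_ge0// le_heat_peak.
Qed.

Lemma heat1_bounded t i : 0 < t -> exists C, forall z : vec, `|heat1 i t z| <= C.
Proof.
move=> t0; have [C1 H1] := heat_bounded t0; have [C2 H2] := sqn_heat_bounded t0.
exists ((2 * t)^-1 * (C1 + C2)) => z.
have H0 := heat_ge0 t z.
rewrite /heat1 normrM normrN normrM (ger0_norm H0) mulrAC mulrC.
have t2 : 0 <= (2 * t)^-1 by rewrite invr_ge0 mulr_ge0// ltW.
rewrite (ger0_norm t2) ler_wpM2l//.
have zi : `|z ord0 i| <= 1 + sqn z.
  have := coord_sqr_le z i; rewrite -real_normK ?num_real//.
  by have := sqr_ge0 (`|z ord0 i| - 1); rewrite sqrrB; have := normr_ge0 (z ord0 i); lra.
apply: (le_trans (ler_wpM2r H0 zi)); rewrite mulrDl mul1r lerD//.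
by rewrite -[heat t z](ger0_norm H0).
Qed.

Lemma heat2_bounded t i j : 0 < t -> exists C, forall z : vec, `|heat2 i j t z| <= C.
Proof.
move=> t0; have [C1 H1] := heat_bounded t0; have [C2 H2] := sqn_heat_bounded t0.
exists ((4 * t ^+ 2)^-1 * C2 + (2 * t)^-1 * C1) => z.
have H0 := heat_ge0 t z.
have t2 : 0 <= (2 * t)^-1 by rewrite invr_ge0 mulr_ge0// ltW.
have t4 : 0 <= (4 * t ^+ 2)^-1 by rewrite invr_ge0 mulr_ge0// sqr_ge0.
rewrite /heat2 mulrBl; apply: (le_trans (ler_normB _ _)); rewrite lerD//.
  rewrite normrM (ger0_norm H0) normrM (ger0_norm t4) mulrAC mulrC ler_wpM2l//.
  by apply: le_trans (H2 z); rewrite ler_wpM2r// coordM_le.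
rewrite normrM normrM (ger0_norm t2) mulrAC mulrC ler_wpM2l//.
apply: le_trans (H1 z); rewrite ger0_norm ?ler0n// ler_piMl//.
by rewrite lern1 leq_b1.
Qed.

End smooth.

(** * Convolution of an integrable function with bounded kernels *)

Section convolution.
Context {R : realType} {d : nat}.
Local Notation vec := ('rV[R]_d).
Local Notation leb := (@lebesgue_rV R d).
Variable g : vec -> R.
Hypothesis ig : leb.-integrable setT (EFin \o g).

Lemma continuous_measurable_rV (f : vec -> R) : continuous f -> measurable_fun setT f.
Proof.
move=> cf; apply: (measurability _ (RGenOInfty.measurableE R)).
move=> _ [_ [a ->] <-]; rewrite setTI; apply: sub_sigma_algebra => /=.
by apply: open_comp => [x _|]; [exact: cf|exact: interval_open].
Qed.

Lemma continuous_subC (k : vec -> R) (x : vec) : continuous k ->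
  continuous (fun y : vec => k (x - y)).
Proof.
move=> ck y; apply: (continuous_comp (f := fun y : vec => x - y) (g := k)); last exact: ck.
apply: (@continuousB _ _ _ (fun=> x) id); first exact: cst_continuous.
by [].
Qed.

Lemma conv_integrable (k : vec -> R) C x : continuous k ->
  (forall z, `|k z| <= C) -> leb.-integrable setT (EFin \o (fun y : vec => k (x - y) * g y)).
Proof.
move=> ck kC; apply: (@le_integrable _ _ _ leb _ measurableT _
    (EFin \o (fun y => C * g y))).
- apply/measurable_EFinP/measurable_funM.
    by apply: continuous_measurable_rV; exact: continuous_subC.
  by move/integrableP : ig => [/measurable_EFinP].
- move=> y _ /=; rewrite lee_fin !normrM ler_wpM2r//.
  by apply: (le_trans (kC _)); exact: ler_norm.
- exact: integrableZlR.
Qed.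

Definition conv (k : vec -> R) (x : vec) : R := \int[leb]_y (k (x - y) * g y).

(** A discontinuity at [x] would give points tending to [x] along which the convolution stays [e]
    away from its value there; dominated convergence along this sequence excludes it. *)
Lemma continuous_conv (k : vec -> R) C : continuous k -> (forall z, `|k z| <= C) ->
  continuous (conv k).
Proof.
move=> ck kC x; apply/(@cvgrPdist_lt _ _ _ (nbhs x) (nbhs_filter x)) => e e0; apply: contrapT => H.
have /choice[xs xsP] : forall n, exists x', ball x n.+1%:R^-1 x' /\
    e <= `|conv k x - conv k x'|.
  move=> n; apply: contrapT => /forallNP H'; apply: H.
  apply/nbhs_ballP; exists n.+1%:R^-1 => /=; first by rewrite invr_gt0.
  move=> x' xx' /=; rewrite ltNge; apply/negP => ex'.
  by apply: (H' x').
have xsx : xs n @[n --> \oo] --> x.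
  apply/cvg_ballP => r r0.
  have [N _ HN] := near_infty_natSinv_lt (PosNum r0).
  exists N => // n Nn; have [b _] := xsP n.
  by apply: le_ball b; apply: ltW; exact: HN.
pose f n y := (k (xs n - y) * g y)%:E.
have mf n : measurable_fun setT (f n).
  by have /integrableP[] := conv_integrable (xs n) ck kC.
have fx : {ae leb, forall y, setT y -> f n y @[n --> \oo] --> (k (x - y) * g y)%:E}.
  apply/aeW => y _; apply: cvg_EFin; first by apply: nearW.
  apply: cvgM; last exact: cvg_cst.
  apply: (continuous_cvg _ (ck (x - y))).
  by apply: cvgB; [exact: xsx|exact: cvg_cst].
have fb : {ae leb, forall y n, setT y -> (`|f n y| <= (C * `|g y|)%:E)%E}.
  by apply/aeW => y n _; rewrite lee_fin normrM ler_wpM2r.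
have ib : leb.-integrable setT (EFin \o (fun y => C * `|g y|)).
  by apply: integrableZlR => //; exact: integrable_norm.
have mfx : measurable_fun setT (fun y : vec => (k (x - y) * g y)%:E).
  by have /integrableP[] := conv_integrable x ck kC.
have [_ _] := dominated_convergence measurableT mf mfx fx ib fb.
have ifx := Rintegral_EFin measurableT (conv_integrable x ck kC).
rewrite -ifx => /fine_cvg/cvgrPdist_lt/(_ _ e0)[n _ /(_ n (leqnn n))] /= en.
by have [_] := xsP n; rewrite leNgt => /negP; apply.
Qed.

(** Along the line through [x] this is differentiation under the integral, on the window (-1, 1),
    with majorant [C1] times |g|. *)
Lemma is_derive_conv (k k1 : vec -> R) C C1 (x v : vec) :
  continuous k -> (forall z, `|k z| <= C) -> (forall z, `|k1 z| <= C1) ->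
  (forall z, is_derive z v k (k1 z)) ->
  is_derive x v (conv k) (conv k1 x).
Proof.
move=> ck kC k1C dk; apply: is_derive_line.
pose f (h : R) (y : vec) := k (h *: v + x - y) * g y.
have fd (h : R) (y : vec) : is_derive h 1 (f ^~ y) (k1 (h *: v + x - y) * g y).
  have dl : is_derive h 1 (fun h : R => k (h *: v + (x - y))) (k1 (h *: v + (x - y))).
    exact: derive_lineP.
  rewrite /f; under eq_fun do rewrite -addrA mulrC.
  by rewrite -addrA mulrC; exact: is_deriveZ.
have d1 (h : R) (y : vec) : partial1of2 f h y = k1 (h *: v + x - y) * g y.
  by rewrite partial1of2E; have /@derive_val := fd h y.
have I0 : `]-1, 1[%classic (0 : R) by rewrite /= in_itv/= oppr_lt0 ltr01.
have int_f (h : R) : `]-1, 1[%classic (h : R) -> leb.-integrable setT (EFin \o f h).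
  by move=> _; exact: conv_integrable.
have der (h : R) (y : vec) : `]-1, 1[%classic (h : R) -> setT y -> derivable (f ^~ y) h 1.
  by move=> _ _; have /@ex_derive := fd h y.
have C10 : 0 <= C1 by apply: le_trans (k1C 0).
have G0 (y : vec) : 0 <= C1 * `|g y| by rewrite mulr_ge0.
have iG : leb.-integrable setT (EFin \o (fun y : vec => C1 * `|g y|)).
  by apply: integrableZlR => //; exact: integrable_norm.
have Gub (h : R) (y : vec) : `]-1, 1[%classic (h : R) -> setT y -> `|partial1of2 f h y| <= C1 * `|g y|.
  by move=> _ _; rewrite d1 normrM ler_wpM2r.
apply: DeriveDef.
  exact: (derivable_under_integral measurableT I0 int_f der G0 iG Gub).
rewrite -derive1E (differentiation_under_integral measurableT I0 int_f der G0 iG Gub).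
by apply: eq_Rintegral => y _; rewrite d1 scale0r add0r.
Qed.

End convolution.

Section prod_coord.
Context {R : realType} {d : nat} d0 (T : measurableType d0).

Lemma measurable_fst_coord i :
  measurable_fun setT (fun p : 'rV[R]_d * T => p.1 ord0 i).
Proof.
exact: (measurableT_comp (@measurable_coord R d i) measurable_fst).
Qed.

Lemma measurable_snd_coord i :
  measurable_fun setT (fun p : T * 'rV[R]_d => p.2 ord0 i).
Proof.
exact: (measurableT_comp (@measurable_coord R d i) measurable_snd).
Qed.

End prod_coord.

(** * Convolution with the heat kernel *)

Section heat_conv.
Context {R : realType} {d : nat}.
Local Notation vec := ('rV[R]_d).
Local Notation leb := (@lebesgue_rV R d).
Variable g : vec -> R.
Hypothesis ig : leb.-integrable setT (EFin \o g).
Hypothesis g0 : forall y, 0 <= g y.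

Let mg : measurable_fun setT g.
Proof. by move/integrableP : ig => [/measurable_EFinP]. Qed.

Lemma conv_heat_integrable t x : 0 < t ->
  leb.-integrable setT (EFin \o (fun y : vec => heat t (x - y) * g y)).
Proof.
move=> t0; have [C HC] := heat_bounded (d := d) t0.
by apply: conv_integrable HC => //; exact: continuous_heat.
Qed.

Lemma conv_heatE t x : 0 < t ->
  (conv g (heat t) x)%:E = (\int[leb]_y (heat t (x - y) * g y)%:E)%E.
Proof. by move=> t0; apply: Rintegral_EFin => //; exact: conv_heat_integrable. Qed.

Lemma conv_heat_ge0 t x : 0 <= conv g (heat t) x.
Proof. by apply: Rintegral_ge0 => y _; rewrite mulr_ge0// heat_ge0. Qed.

Lemma continuous_conv_heat t : 0 < t -> continuous (conv g (heat t)).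
Proof.
move=> t0; have [C HC] := heat_bounded (d := d) t0.
by apply: continuous_conv HC => //; exact: continuous_heat.
Qed.

Let measurable_shift (x : vec) (b : bool) i :
  measurable_fun setT (fun p : vec * vec => (x + (-1) ^+ b *: p.1 - p.2) ord0 i).
Proof.
apply: (eq_measurable_fun
    (fun p : vec * vec => x ord0 i + (-1) ^+ b * p.1 ord0 i - p.2 ord0 i)).
  by move=> p _; rewrite !mxE.
apply: measurable_funB.
  apply: measurable_funD => //; apply: measurable_funM => //.
  exact: measurable_fst_coord.
exact: measurable_snd_coord.
Qed.

(** Tonelli reduces the claim to two Gaussians. The boolean selects x + z or x - z, the two points
    of a second difference. *)
Lemma heat_semigroup s t (x : vec) (b : bool) : 0 < s -> 0 < t ->
  (\int[leb]_z (heat s z * conv g (heat t) (x + (-1) ^+ b *: z))%:E =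
   (conv g (heat (s + t)) x)%:E)%E.
Proof.
move=> s0 t0; have st0 : 0 < s + t by rewrite addr_gt0.
pose F (p : vec * vec) : \bar R :=
  (heat s p.1 * (heat t (x + (-1) ^+ b *: p.1 - p.2) * g p.2))%:E.
have mF : measurable_fun setT F.
  apply/measurable_EFinP; apply: measurable_funM.
    by apply: measurable_heat_comp => i; exact: measurable_fst_coord.
  apply: measurable_funM; first by apply: measurable_heat_comp => i; exact: measurable_shift.
  by apply: measurableT_comp => //; exact: measurable_snd.
have F0 p : (0 <= F p)%E by rewrite lee_fin mulr_ge0 ?heat_ge0// mulr_ge0 ?heat_ge0.
transitivity (\int[leb]_z \int[leb]_y F (z, y))%E.
  apply: eq_integral => z _; rewrite EFinM conv_heatE// -ge0_integralZl_EFin ?heat_ge0//.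
  - by move=> y _; rewrite lee_fin mulr_ge0 ?heat_ge0.
  - by have /integrableP[] := conv_heat_integrable (x + (-1) ^+ b *: z) t0.
rewrite (fubini_tonelli F)// conv_heatE//; apply: eq_integral => y _.
transitivity (\int[leb]_z ((g y)%:E * (heat s z * heat t ((x - y) + (-1) ^+ b *: z))%:E))%E.
  by apply: eq_integral => z _; rewrite /F /= -EFinM addrAC; congr EFin; ring.
rewrite ge0_integralZl_EFin//.
- rewrite EFinM muleC; congr (_ * _)%E.
  case: b {F mF F0} => /=.
    rewrite -(integral_heatMB _ s0 t0); apply: eq_integral => z _.
    by rewrite expr1 scaleN1r.
  rewrite -(integral_heatM _ s0 t0); apply: eq_integral => z _.
  by rewrite expr0 scale1r.
- by move=> z _; rewrite lee_fin mulr_ge0 ?heat_ge0.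
- apply/measurable_EFinP; apply: measurable_funM.
    by apply: measurable_heat_comp => i; exact: measurable_coord.
  apply: measurable_heat_comp => i.
  apply: (eq_measurable_fun (fun z : vec => (x - y) ord0 i + (-1) ^+ b * z ord0 i)).
    by move=> z _; rewrite !mxE.
  by apply: measurable_funD => //; apply: measurable_funM => //; exact: measurable_coord.
Qed.

Lemma integral_heat_subl t x : 0 < t -> (\int[leb]_y (heat t (x - y))%:E = 1)%E.
Proof.
move=> t0; rewrite -[RHS](integral_heat x t0); apply: eq_integral => y _.
by rewrite -heatN opprB.
Qed.

Lemma measurable_heat_subl t (x : vec) : measurable_fun setT (fun y : vec => heat t (x - y)).
Proof.
by apply: continuous_measurable_rV; apply: continuous_subC; exact: continuous_heat.
Qed.

(* Hoelder, with the conjugate norm of the heat kernel bounded through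
   [heat ^ q <= (sup heat) ^ (q - 1) * heat]. *)
Lemma conv_heat_le (p A t : R) x : 1 < p -> 0 < t ->
  (Lnorm leb p%:E (EFin \o g) <= A%:E)%E ->
  conv g (heat t) x <= (4 * pi * t) `^ (- (d%:R / (2 * p))) * A.
Proof.
move=> p1 t0 gA; have p0 : 0 < p by exact: lt_trans p1.
pose q := p / (p - 1); have p10 : 0 < p - 1 by rewrite subr_gt0.
have q0 : 0 < q by rewrite divr_gt0.
have q1 : 0 < q - 1 by rewrite subr_gt0 ltr_pdivlMr// mul1r gtrBl.
have pq : q^-1 + p^-1 = 1 by rewrite /q invf_div; field; rewrite gt_eqF.
pose P := (4 * pi * t) `^ (- (d%:R / 2)).
have P0 : 0 < P by rewrite powR_gt0// !mulr_gt0 ?pi_gt0.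
have mh := measurable_heat_subl t x.
have := @hoelder _ _ R leb (fun y => heat t (x - y)) g q p mh mg q0 p0 pq.
rewrite Lnorm1.
have -> : (\int[leb]_y `|(EFin \o ((fun y : vec => heat t (x - y)) \* g)%R) y|)%E =
    (conv g (heat t) x)%:E.
  rewrite conv_heatE//; apply: eq_integral => y _ /=.
  by rewrite ger0_norm// mulr_ge0 ?heat_ge0.
have Nq : (Lnorm leb q%:E (EFin \o (fun y => heat t (x - y))) <=
    ((4 * pi * t) `^ (- (d%:R / (2 * p))))%:E)%E.
  have -> : (4 * pi * t) `^ (- (d%:R / (2 * p))) = (P `^ (q - 1)) `^ q^-1.
    rewrite /P -!powRrM; congr (_ `^ _).
    have e : (q - 1) / q = p^-1 by rewrite mulrBl mulfV ?gt_eqF// mul1r -pq addrAC subrr add0r.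
    by rewrite e; field; rewrite gt_eqF.
  rewrite unlock -poweR_EFin; apply: gt0_ler_poweR.
  - by rewrite invr_ge0 ltW.
  - rewrite in_itv/= leey andbT; apply: integral_ge0 => y _.
    by rewrite lee_fin powR_ge0.
  - by rewrite in_itv/= leey andbT lee_fin powR_ge0.
  rewrite -[leRHS]mule1 -(integral_heat_subl x t0) -ge0_integralZl_EFin//; last 3 first.
  - by move=> y _; rewrite lee_fin heat_ge0.
  - exact/measurable_EFinP.
  - exact: powR_ge0.
  apply: ge0_le_integral => //.
  - by move=> y _; rewrite lee_fin powR_ge0.
  - apply/measurable_EFinP; apply: (measurableT_comp (measurable_powR q)).
    exact: measurableT_comp.
  - by apply: measurable_funeM; exact/measurable_EFinP.
  - move=> y _ /=; rewrite -EFinM lee_fin ger0_norm ?heat_ge0//.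
    have -> : heat t (x - y) `^ q = heat t (x - y) `^ (q - 1) * heat t (x - y).
      rewrite -[X in _ * X]powRr1 ?heat_ge0// -powRD ?subrK//.
      by rewrite gt_eqF// heat_gt0// implybT.
    rewrite ler_wpM2r ?heat_ge0// ge0_ler_powR ?nnegrE ?heat_ge0 ?(ltW P0) ?(ltW q1)//.
    exact: le_heat_peak.
move=> H; rewrite -lee_fin; apply: (le_trans H); rewrite [leRHS]EFinM.
by apply: lee_pmul => //; exact: Lnorm_ge0.
Qed.

End heat_conv.

(** * Subordination: integrals against the jump kernel as mixtures over heat kernels *)

Section laplacian.
Context {R : realType} {d : nat}.
Local Notation vec := ('rV[R]_d).
Local Notation leb := (@lebesgue_rV R d).
Variable m : {sigma_finite_measure set (measurableTypeR R) -> \bar R}.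
Hypothesis m1 : (\int[m]_(y in `]0%R, +oo[) (Num.min y 1)%:E < +oo)%E.
Hypothesis jfin : forall r : R, 0 < r -> (jump_kernel m d r < +oo)%E.
Local Notation D := (`]0%R, +oo[%classic : set (measurableTypeR R)).

Let mD : measurable D. Proof. exact: measurable_itv. Qed.

Let D0 s : D s -> 0 < s. Proof. by rewrite /= in_itv/= andbT. Qed.

(** Extension by 0 to nonpositive times makes the integrand jointly measurable on the whole product,
    where Fubini is applied. *)
Let heat_pos (p : vec * measurableTypeR R) : R :=
  if (0 : R) < p.2 then heat p.2 p.1 else 0.

Let heat_pos_ge0 p : 0 <= heat_pos p.
Proof. by rewrite /heat_pos; case: ifP => // _; exact: heat_ge0. Qed.

Let measurable_heat_pos : measurable_fun setT heat_pos.
Proof.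
rewrite (_ : heat_pos = fun p => if (0 : R) < p.2 then
    (4 * pi * p.2) `^ (- (d%:R / 2)) * expR (- (sqn p.1 * (4 * p.2) `^ (-1))) else 0).
  apply: measurable_fun_ifT => //.
    exact: measurable_fun_ltr.
  apply: measurable_funM.
    apply: (measurableT_comp (measurable_powR _)).
    exact: measurable_funM.
  apply: measurableT_comp => //; apply: measurableT_comp => //.
  apply: measurable_funM.
    by apply: measurable_sqn_comp => i; exact: measurable_fst_coord.
  apply: (measurableT_comp (measurable_powR _)).
  exact: measurable_funM.
apply/funext => p; rewrite /heat_pos; case: ifP => // p0.
by rewrite powR_inv1// mulr_ge0// ltW.
Qed.

Let jump_kernelE (z : vec) :
  jump_kernel m d (enorm z) = (\int[m]_s (heat_pos (z, s))%:E)%E.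
Proof.
rewrite /jump_kernel integral_mkcond; apply: eq_integral => s _.
rewrite patchE /heat_pos/=; case: ifPn => [/set_mem/D0 ->|].
  by rewrite /heat enorm_sqr.
by case: ifP => // s0; rewrite notin_setE/= in_itv/= s0.
Qed.

(** For large s the total mass gives 1, for small s the second moment gives a multiple of s.
    Together this is min(s, 1), exactly what the Levy condition integrates. *)
Lemma integral_min_sqn_heat_le s : 0 < s ->
  (\int[leb]_z (Num.min 1 (sqn z) * heat s z)%:E <=
   ((1 + 8 * 2 `^ (d%:R / 2)) * Num.min s 1)%:E)%E.
Proof.
move=> s0; set K := 8 * _; have K0 : 0 <= K by rewrite mulr_ge0// powR_ge0.
have mS : measurable_fun setT (fun z : vec => Num.min 1 (sqn z)).
  by apply: measurable_minr => //; exact: measurable_sqn.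
have mh (t : R) : measurable_fun setT (fun z : vec => heat t z).
  by apply: continuous_measurable_rV; exact: continuous_heat.
have min0 (z : vec) : 0 <= Num.min 1 (sqn z) by rewrite le_min ler01 sqn_ge0.
have ih (t : R) : 0 < t -> (\int[leb]_z (heat t z)%:E = 1)%E.
  move=> t0; rewrite -[RHS](integral_heat (0 : vec) t0).
  by apply: eq_integral => z _; rewrite subr0.
have b1 : (\int[leb]_z (Num.min 1 (sqn z) * heat s z)%:E <= 1)%E.
  rewrite -(ih _ s0); apply: ge0_le_integral => //.
  - by move=> z _; rewrite lee_fin mulr_ge0// heat_ge0.
  - by apply/measurable_EFinP; exact: measurable_funM.
  - exact/measurable_EFinP.
  - by move=> z _; rewrite lee_fin ler_piMl ?heat_ge0// ge_min lexx.
have b2 : (\int[leb]_z (Num.min 1 (sqn z) * heat s z)%:E <= (K * s)%:E)%E.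
  have s20 : 0 < 2 * s by rewrite mulr_gt0.
  rewrite -[leRHS]mule1 -(ih _ s20) -ge0_integralZl_EFin//; last 3 first.
  - by move=> z _; rewrite lee_fin heat_ge0.
  - exact/measurable_EFinP.
  - by rewrite mulr_ge0// ltW.
  apply: ge0_le_integral => //.
  - by move=> z _; rewrite lee_fin mulr_ge0// heat_ge0.
  - by apply/measurable_EFinP; exact: measurable_funM.
  - by apply: measurable_funeM; exact/measurable_EFinP.
  - move=> z _; rewrite -EFinM lee_fin.
    apply: (@le_trans _ _ (sqn z * heat s z)).
      by rewrite ler_wpM2r ?heat_ge0// ge_min lexx orbT.
    by rewrite (le_trans (sqn_heat_le z s0))// /K; rewrite [8 * s * _]mulrAC.
have [s1|s1] := leP s 1.
  by apply: (le_trans b2); rewrite lee_fin mulrDl mul1r lerDr ltW.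
by apply: (le_trans b1); rewrite mulr1 lee_fin lerDl.
Qed.

Let kern (z : vec) : R := fine (jump_kernel m d (enorm z)).

Section fubini.
Variables (S : vec -> R) (C : R).
Hypotheses (C0 : 0 <= C) (mS : measurable_fun setT S).
Hypothesis SC : forall z, `|S z| <= C * Num.min 1 (sqn z).

Let F (p : vec * measurableTypeR R) : \bar R := (S p.1 * heat_pos p)%:E.


Let mF : measurable_fun setT F.
Proof.
apply/measurable_EFinP; apply: measurable_funM => //.
by apply: measurableT_comp => //; exact: measurable_fst.
Qed.

Let iF : (leb \x m)%E.-integrable setT F.
Proof.
apply/integrable21ltyP => //.
apply: (@le_lt_trans _ _ (\int[m]_(s in D) ((C * (1 + 8 * 2 `^ (d%:R / 2))) * Num.min s 1)%:E)%E).
  rewrite [leRHS]integral_mkcond; apply: ge0_le_integral => //.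
  - by move=> s _; apply: integral_ge0.
  - apply: (measurable_fun_fubini_tonelli_G (abse \o F)) => //.
      exact: measurableT_comp.
    by move=> p; exact: abse_ge0.
  - apply/(measurable_restrictT _ mD).
    apply/measurable_EFinP/measurable_funM => //.
    by apply: measurable_funTS; exact: measurable_fun_min.
  - move=> s _; rewrite patchE; case: ifPn => [/set_mem/D0 s0|].
      have sC : (\int[leb]_z (C * (Num.min 1 (sqn z) * heat s z))%:E <=
         (C * (1 + 8 * 2 `^ (d%:R / 2)) * Num.min s 1)%:E)%E.
        under eq_integral do rewrite EFinM.
        rewrite ge0_integralZl_EFin//; last 2 first.
        - by move=> z _; rewrite lee_fin mulr_ge0 ?heat_ge0// le_min ler01 sqn_ge0.
        - apply/measurable_EFinP; apply: measurable_funM.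
            by apply: measurable_minr => //; exact: measurable_sqn.
          by apply: continuous_measurable_rV; exact: continuous_heat.
        by rewrite -mulrA EFinM lee_wpmul2l// integral_min_sqn_heat_le.
      apply: le_trans sC; apply: ge0_le_integral => //.
      + apply: measurableT_comp => //; exact: (measurableT_comp mF (measurable_pair2 s)).
      + apply/measurable_EFinP; apply: measurable_funM => //; apply: measurable_funM.
          by apply: measurable_minr => //; exact: measurable_sqn.
        by apply: continuous_measurable_rV; exact: continuous_heat.
      + move=> z _; rewrite /F/= /heat_pos/= s0 lee_fin normrM (ger0_norm (heat_ge0 _ _)).
        by rewrite [leRHS]mulrA ler_wpM2r// heat_ge0.
    rewrite notin_setE/= in_itv/= andbT => /negP/negbTE s0.
    by rewrite integral0_eq// => z _; rewrite /F /heat_pos/= s0 mulr0 normr0.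
have : m.-integrable D
    (EFin \o (fun s : measurableTypeR R => C * (1 + 8 * 2 `^ (d%:R / 2)) * Num.min s 1)).
  by apply: integrableZlR => //; exact: integrable_min.
move=> /integrableP[_]; apply: le_lt_trans; rewrite le_eqVlt; apply/orP; left; apply/eqP.
apply: eq_integral => s /set_mem/D0 s0 /=; rewrite ger0_norm//.
have K0 : 0 <= C * (1 + 8 * 2 `^ (d%:R / 2)).
  by rewrite mulr_ge0// addr_ge0// mulr_ge0// powR_ge0.
by rewrite mulr_ge0// le_min ler01 ltW.
Qed.

Let S0 : S 0 = 0.
Proof.
apply/eqP; rewrite -normr_le0; apply: (le_trans (SC 0)).
rewrite (_ : sqn 0 = 0); first by rewrite min_r// mulr0.
by rewrite /sqn big1// => i _; rewrite mxE expr0n.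
Qed.

Let FE z : (\int[m]_s F (z, s))%E = (S z * kern z)%:E.
Proof.
(* At the origin the kernel may be infinite and its [fine] part a default value; S vanishes there,
   so both sides are 0. *)
have [->|z0] := eqVneq z 0.
  by rewrite S0 mul0r integral0_eq// => s _; rewrite /F/= S0 mul0r.
have ez : 0 < enorm z.
  rewrite sqrtr_gt0 lt_neqAle sqn_ge0 andbT eq_sym.
  apply: contra z0 => /eqP z0; apply/eqP/rowP => i; rewrite mxE; apply/eqP.
  by rewrite -sqrf_eq0 -[_ == 0](andTb) eq_le sqr_ge0 andbT -z0 coord_sqr_le.
rewrite /kern EFinM fineK; last first.
  rewrite ge0_fin_numE ?jfin//; apply: integral_ge0 => s /D0 s0.
  by rewrite lee_fin mulr_ge0 ?powR_ge0 ?expR_ge0.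
have ih : m.-integrable setT (fun s => (heat_pos (z, s))%:E).
  apply/integrableP; split.
    by apply/measurable_EFinP; exact: (measurableT_comp measurable_heat_pos (measurable_pair1 z)).
  apply: le_lt_trans (jfin ez); rewrite jump_kernelE le_eqVlt; apply/orP; left; apply/eqP.
  by apply: eq_integral => s _; rewrite gee0_abs// lee_fin heat_pos_ge0.
rewrite jump_kernelE -integralZl//.
Qed.

Lemma integrable_kern : leb.-integrable setT (EFin \o (fun z => S z * kern z)).
Proof.
have := integrable_fubini_F iF.
by apply: eq_integrable => // z _ /=; rewrite -FE.
Qed.

Lemma integrable_sd_heat s : 0 < s -> leb.-integrable setT (EFin \o (fun z => S z * heat s z)).
Proof.
move=> s0; have ih : leb.-integrable setT (EFin \o (heat s : vec -> R)).
  apply/integrableP; split.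
    by apply/measurable_EFinP; apply: continuous_measurable_rV; exact: continuous_heat.
  rewrite (_ : (\int[_]_x _)%E = 1%E) ?ltry//.
  rewrite -[RHS](integral_heat (0 : vec) s0); apply: eq_integral => z _.
  by rewrite subr0 /= ger0_norm// heat_ge0.
apply: (@le_integrable _ _ _ leb _ measurableT _ (EFin \o (fun z => C * heat s z))).
- apply/measurable_EFinP; apply: measurable_funM => //.
  by apply: continuous_measurable_rV; exact: continuous_heat.
- move=> z _ /=; rewrite lee_fin (le_trans _ (ler_norm _))//.
  rewrite normrM (ger0_norm (heat_ge0 _ _)) ler_wpM2r ?heat_ge0//.
  by rewrite (le_trans (SC z))// ler_piMr// ge_min lexx.
- exact: integrableZlR.
Qed.

Let GE s : (\int[leb]_z F (z, s))%E =
  ((fun s => (\int[leb]_z (S z * heat s z))%:E) \_ D) s.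
Proof.
rewrite patchE; case: ifPn => [/set_mem/D0 s0|].
  rewrite Rintegral_EFin//; last exact: integrable_sd_heat.
  by apply: eq_integral => z _; rewrite /F /heat_pos/= s0.
rewrite notin_setE/= in_itv/= andbT => /negP/negbTE s0.
by rewrite integral0_eq// => z _; rewrite /F /heat_pos/= s0 mulr0.
Qed.

Lemma integral_kern : \int[leb]_z (S z * kern z) =
  \int[m]_(s in D) (\int[leb]_z (S z * heat s z)).
Proof.
have := Fubini iF.
rewrite (eq_integral (fun z => (S z * kern z)%:E)); last by move=> z _; rewrite FE.
rewrite [X in _ = X -> _](eq_integral ((fun s => (\int[leb]_z (S z * heat s z))%:E) \_ D));
  last by move=> s _; rewrite GE.
by rewrite -integral_mkcond /Rintegral => ->.
Qed.

End fubini.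

Definition second_difference (phi : vec -> R) (x z : vec) : R :=
  phi (x + z) + phi (x - z) - 2 * phi x.

Lemma psi_laplacianE phi x : psi_laplacian m phi x =
  2^-1 * \int[leb]_z (second_difference phi x z * kern z).
Proof. by []. Qed.

End laplacian.

(** * Second differences of the heat kernel *)

Section heat_second_difference.
Context {R : realType} {d : nat}.
Local Notation vec := ('rV[R]_d).

Definition ip (b z : vec) : R := \sum_(i < d) b ord0 i * z ord0 i.

Lemma sqnD (b z : vec) : sqn (b + z) = sqn b + 2 * ip b z + sqn z.
Proof.
rewrite /sqn /ip mulr_sumr -!big_split/=; apply: eq_bigr => i _.
by rewrite !mxE; ring.
Qed.

Lemma sqnB (b z : vec) : sqn (b - z) = sqn b - 2 * ip b z + sqn z.
Proof.
rewrite /sqn /ip mulr_sumr -sumrB -big_split/=; apply: eq_bigr => i _.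
by rewrite !mxE; ring.
Qed.

Lemma ip_sqr_le (b z : vec) : ip b z ^+ 2 <= sqn b * sqn z.
Proof.
have := sqn_ge0 b; rewrite le_eqVlt => /predU1P[b0|b0].
  have bi i : b ord0 i = 0.
    apply/eqP; rewrite -sqrf_eq0 eq_le sqr_ge0 andbT [leRHS]b0; exact: coord_sqr_le.
  by rewrite -b0 mul0r /ip big1 ?expr0n// => i _; rewrite bi mul0r.
have E : sqn (sqn b *: z - ip b z *: b) = sqn b * (sqn b * sqn z - ip b z ^+ 2).
  rewrite sqnB.
  have ipZ (a c : R) : ip (a *: z) (c *: b) = a * c * ip b z.
    by rewrite /ip mulr_sumr; apply: eq_bigr => i _; rewrite !mxE; ring.
  have sZ (c : R) (v : vec) : sqn (c *: v) = c ^+ 2 * sqn v.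
    by rewrite /sqn mulr_sumr; apply: eq_bigr => i _; rewrite mxE exprMn.
  by rewrite !sZ ipZ; ring.
have := sqn_ge0 (sqn b *: z - ip b z *: b).
by rewrite E pmulr_rge0// subr_ge0.
Qed.

(** For x >= 0 the left side is e^(-x) (e^x - 1)^2, and e^x - 1 <= x e^x. *)
Lemma cosh_sub1_le (x : R) : expR x + expR (- x) - 2 <= x ^+ 2 * expR `|x|.
Proof.
wlog x0 : x / 0 <= x.
  move=> H; have [/H//|/ltW x0] := leP 0 x.
  by have := H (- x); rewrite oppr_ge0 opprK normrN sqrrN [expR (- x) + _]addrC; exact.
rewrite ger0_norm//.
have e0 := expR_gt0 x; have en0 := expR_gt0 (- x).
have ee : expR x * expR (- x) = 1 by rewrite -expRD subrr expR0.
have e1 := expR_ge1Dx (- x); have e2 := expR_ge1Dx x.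
have h1 : expR x - 1 <= x * expR x.
  by rewrite -[X in _ - X]ee -[X in X - _]mulr1 -mulrBr mulrC ler_wpM2r ?(ltW e0)//; lra.
have h0 : 0 <= expR x - 1 by lra.
have -> : expR x + expR (- x) - 2 = expR (- x) * (expR x - 1) ^+ 2.
  have -> : expR (- x) * (expR x - 1) ^+ 2 =
    expR x * (expR x * expR (- x)) - 2 * (expR x * expR (- x)) + expR (- x) by ring.
  by rewrite ee; ring.
have -> : x ^+ 2 * expR x = expR (- x) * (x * expR x) ^+ 2.
  have -> : expR (- x) * (x * expR x) ^+ 2 =
    x ^+ 2 * expR x * (expR x * expR (- x)) by ring.
  by rewrite ee mulr1.
by rewrite ler_pM2l// ler_pXn2r ?nnegrE// mulr_ge0// ltW.
Qed.

(** The bound has to be uniform in the base point [b] to survive convolution with g. With A, Z, x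
    below, the expansion of |b + z|^2 and |b - z|^2 gives |x| <= 2 sqrt(A Z) <= A/2 + 2Z, so e^(-A)
    dominates the growth of the hyperbolic cosine. *)
Lemma heat_second_difference_le t : 0 < t -> exists2 C, 0 <= C & forall b z : vec,
  `|heat t (b + z) + heat t (b - z) - 2 * heat t b| <= C * Num.min 1 (sqn z).
Proof.
move=> t0; pose P : R := (4 * pi * t) `^ (- (d%:R / 2)); have P0 : 0 <= P by exact: powR_ge0.
have t4 : 0 < 4 * t by rewrite mulr_gt0.
(* For Z <= 1 the product e^(-A) 4 A Z e^(A/2 + 2) equals 8 e^2 Z times (A/2) e^(-A/2), whose last
   factor is at most 1. *)
pose C1 : R := 8 * expR 2; have C11 : 8 <= C1.
  by rewrite /C1 ler_peMr// -[leLHS]expR0 ler_expR.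
have C10 : 0 <= C1 by exact: le_trans C11.
have C20 : 0 <= C1 / (4 * t) by rewrite divr_ge0// ltW.
exists (P * (4 + C1 / (4 * t))); first by rewrite mulr_ge0// addr_ge0.
move=> b z; pose A : R := sqn b / (4 * t); pose Z : R := sqn z / (4 * t); pose x : R := ip b z / (2 * t).
have A0 : 0 <= A by rewrite divr_ge0 ?sqn_ge0// ltW.
have Z0 : 0 <= Z by rewrite divr_ge0 ?sqn_ge0// ltW.
have E : heat t (b + z) + heat t (b - z) - 2 * heat t b =
    P * (expR (- A) * (expR (- Z) * (expR x + expR (- x)) - 2)).
  have -> : heat t (b + z) = P * (expR (- A) * (expR (- Z) * expR (- x))).
    rewrite -!expRD /heat sqnD; congr (_ * expR _); rewrite /A /Z /x; field.
    by rewrite gt_eqF.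
  have -> : heat t (b - z) = P * (expR (- A) * (expR (- Z) * expR x)).
    rewrite -!expRD /heat sqnB; congr (_ * expR _); rewrite /A /Z /x; field.
    by rewrite gt_eqF.
  by rewrite /heat -/P -/(A : R) /A; ring.
set sd := LHS in E *.
have b1 : `|sd| <= P * 4.
  have h1 := le_heat_peak (b + z) t0; have h2 := le_heat_peak (b - z) t0.
  have h3 := le_heat_peak b t0; have h4 := heat_ge0 t (b + z).
  have h5 := heat_ge0 t (b - z); have h6 := heat_ge0 t b.
  by rewrite -/P in h1 h2 h3; rewrite ler_norml /sd; apply/andP; split; lra.
have b2 : `|sd| <= P * (C1 * Z).
  have [Z1|Z1] := leP Z 1; last first.
    apply: (le_trans b1); rewrite ler_wpM2l//; nra.
  rewrite E normrM (ger0_norm P0) ler_wpM2l// ler_norml.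
  have eA := expR_gt0 (- A); have eA1 : expR (- A) <= 1.
    by rewrite -[leRHS]expR0 ler_expR oppr_le0.
  have eZ := expR_gt0 (- Z); have eZ1 := expR_ge1Dx (- Z).
  have eZ2 : expR (- Z) <= 1 by rewrite -[leRHS]expR0 ler_expR oppr_le0.
  have ch := cosh_sub1_le x.
  have ex1 := expR_ge1Dx x; have ex2 := expR_ge1Dx (- x).
  have x2 : x ^+ 2 <= 4 * (A * Z).
    have := ip_sqr_le b z.
    have -> : x ^+ 2 = ip b z ^+ 2 / (4 * t ^+ 2) by rewrite /x; field; rewrite gt_eqF.
    have -> : 4 * (A * Z) = sqn b * sqn z / (4 * t ^+ 2).
      by rewrite /A /Z; field; rewrite gt_eqF.
    by rewrite ler_pM2r// invr_gt0 mulr_gt0// exprn_gt0.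
  have AZ0 : 0 <= A / 2 + 2 * Z by lra.
  have xA : `|x| <= A / 2 + 2 * Z.
    rewrite -ler_sqr ?nnegrE// real_normK ?num_real//.
    apply: (le_trans x2); rewrite -subr_ge0.
    have -> : (A / 2 + 2 * Z) ^+ 2 - 4 * (A * Z) = (A / 2 - 2 * Z) ^+ 2 by field.
    exact: sqr_ge0.
  have up : expR (- A) * (expR x + expR (- x) - 2) <= C1 * Z.
    apply: (@le_trans _ _ (expR (- A) * (4 * (A * Z) * expR (A / 2 + 2)))).
      rewrite ler_pM2l//; apply: (le_trans ch); rewrite ler_pM ?sqr_ge0 ?expR_ge0//.
      by rewrite ler_expR; apply: (le_trans xA); lra.
    have -> : expR (- A) * (4 * (A * Z) * expR (A / 2 + 2)) =
        C1 * Z * (A / 2 * expR (- (A / 2))).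
      have -> : expR (A / 2 + 2) = expR (A / 2) * expR 2 by rewrite expRD.
      have -> : expR (- (A / 2)) = expR (- A) * expR (A / 2).
        by rewrite -expRD; congr expR; field.
      by rewrite /C1; field.
    by apply: ler_piMr; [exact: mulr_ge0|exact: exprM_exp_le].
  apply/andP; split.
    have : -2 * Z <= expR (- Z) * (expR x + expR (- x)) - 2 by nra.
    by nra.
  apply: le_trans up; rewrite ler_pM2l// lerD2r.
  by rewrite ler_piMl// addr_ge0 ?expR_ge0.
have [s1|s1] := leP 1 (sqn z).
  by rewrite mulr1; apply: (le_trans b1); rewrite ler_wpM2l// lerDl.
apply: (le_trans b2).
have -> : P * (C1 * Z) = P * (C1 / (4 * t)) * sqn z by rewrite /Z; ring.
by rewrite ler_wpM2r ?sqn_ge0// ler_wpM2l// lerDr.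
Qed.

End heat_second_difference.

(** * The operator on sums and on heat convolutions *)

Section laplacian_values.
Context {R : realType} {d : nat}.
Local Notation vec := ('rV[R]_d).
Local Notation leb := (@lebesgue_rV R d).
Variable m : {sigma_finite_measure set (measurableTypeR R) -> \bar R}.
Hypothesis m1 : (\int[m]_(y in `]0%R, +oo[) (Num.min y 1)%:E < +oo)%E.
Hypothesis jfin : forall r : R, 0 < r -> (0 < jump_kernel m d r < +oo)%E.
Local Notation D := (`]0%R, +oo[%classic : set (measurableTypeR R)).
Local Notation kern := (fun z : vec => fine (jump_kernel m d (enorm z))).

Let mD : measurable D. Proof. exact: measurable_itv. Qed.

Let D0 s : D s -> 0 < s. Proof. by rewrite /= in_itv/= andbT. Qed.

Let jlty (r : R) : 0 < r -> (jump_kernel m d r < +oo)%E.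
Proof. by move=> /jfin/andP[]. Qed.

Lemma jump_kernel_ge0 (r : R) : (0 <= jump_kernel m d r)%E.
Proof.
by apply: integral_ge0 => s _; rewrite lee_fin mulr_ge0 ?powR_ge0 ?expR_ge0.
Qed.

Definition lap_integrable (phi : vec -> R) (x : vec) :=
  leb.-integrable setT (EFin \o (fun z => second_difference phi x z * kern z)).

Lemma psi_laplacianD phi psi x : lap_integrable phi x -> lap_integrable psi x ->
  lap_integrable (fun y => phi y + psi y) x /\
  psi_laplacian m (fun y => phi y + psi y) x =
    psi_laplacian m phi x + psi_laplacian m psi x.
Proof.
move=> i1 i2.
have E z : second_difference (fun y => phi y + psi y) x z * kern z =
    second_difference phi x z * kern z + second_difference psi x z * kern z.
  by rewrite /second_difference; ring.
split.
  rewrite /lap_integrable (_ : (fun z => _) = (fun z =>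
    second_difference phi x z * kern z + second_difference psi x z * kern z)).
    exact: integrableDR.
  by apply/funext => z; exact: E.
rewrite !psi_laplacianE -mulrDr -RintegralD//.
by congr (_ * _); apply: eq_Rintegral => z _; exact: E.
Qed.

Lemma psi_laplacianZ (a : R) phi x : lap_integrable phi x ->
  lap_integrable (fun y => a * phi y) x /\
  psi_laplacian m (fun y => a * phi y) x = a * psi_laplacian m phi x.
Proof.
move=> i1.
have E z : second_difference (fun y => a * phi y) x z * kern z =
    a * (second_difference phi x z * kern z).
  by rewrite /second_difference; ring.
split.
  rewrite /lap_integrable (_ : (fun z => _) = (fun z =>
    a * (second_difference phi x z * kern z))).
    exact: integrableZlR.
  by apply/funext => z; exact: E.
rewrite !psi_laplacianE [RHS]mulrCA -(RintegralZl a measurableT i1).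
by congr (_ * _); apply: eq_Rintegral => z _; exact: E.
Qed.

Lemma psi_laplacian_cst (a : R) x :
  lap_integrable (fun=> a) x /\ psi_laplacian m (fun=> a) x = 0.
Proof.
have E z : second_difference (fun=> a) x z * kern z = 0.
  by rewrite /second_difference; ring.
split.
  rewrite /lap_integrable (_ : (fun z => _) = cst 0); first exact: integrable0.
  by apply/funext => z; exact: E.
rewrite psi_laplacianE (@eq_Rintegral _ _ _ _ _ (cst 0)); last by move=> z _; exact: E.
by rewrite /Rintegral integral0 mulr0.
Qed.

Lemma psi_laplacian_sum n (u : nat -> R) (f : nat -> vec -> R) x :
  (forall i, (i < n)%N -> lap_integrable (f i) x) ->
  lap_integrable (fun y => \sum_(i < n) u i * f i y) x /\
  psi_laplacian m (fun y => \sum_(i < n) u i * f i y) x =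
    \sum_(i < n) u i * psi_laplacian m (f i) x.
Proof.
elim: n => [|n IH] fi.
  rewrite (_ : (fun y => _) = (fun=> 0)); last by apply/funext => y; rewrite big_ord0.
  by rewrite big_ord0; exact: psi_laplacian_cst.
have [i1 e1] := IH (fun i ni => fi i (ltnW ni)).
have [i2 e2] := psi_laplacianZ (u n) (fi n (leqnn _)).
have [i3 e3] := psi_laplacianD i1 i2.
rewrite (_ : (fun y => _) = (fun y => \sum_(i < n) u i * f i y + u n * f n y)).
  by rewrite e3 e1 e2 big_ord_recr.
by apply/funext => y; rewrite big_ord_recr.
Qed.

Section conv_heat.
Variable g : vec -> R.
Hypothesis ig : leb.-integrable setT (EFin \o g).
Hypothesis g0 : forall y, 0 <= g y.

Let conv_second_difference_le t x : 0 < t -> exists2 C, 0 <= C & forall z,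
  `|second_difference (conv g (heat t)) x z| <= C * Num.min 1 (sqn z).
Proof.
move=> t0; have [C C0 HC] := heat_second_difference_le (d := d) t0.
exists (C * \int[leb]_y g y); first by rewrite mulr_ge0// Rintegral_ge0.
move=> z; have iw v := conv_heat_integrable ig v t0.
have -> : second_difference (conv g (heat t)) x z =
    \int[leb]_y (heat t (x + z - y) * g y + heat t (x - z - y) * g y -
                 2 * (heat t (x - y) * g y)).
  rewrite RintegralB//; last 2 first.
  - exact: integrableDR.
  - exact: integrableZlR.
  by rewrite RintegralD// RintegralZl.
have iS : leb.-integrable setT (EFin \o (fun y => heat t (x + z - y) * g y +
    heat t (x - z - y) * g y - 2 * (heat t (x - y) * g y))).
  by apply: integrableBR => //; [exact: integrableDR|exact: integrableZlR].
apply: (le_trans (le_normr_Rintegral measurableT iS)).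
rewrite mulrAC -RintegralZl//; apply: le_Rintegral => //.
- exact: integrable_norm.
- exact: integrableZlR.
move=> y _; have := HC (x - y) z.
have -> : heat t (x + z - y) * g y + heat t (x - z - y) * g y - 2 * (heat t (x - y) * g y)
  = (heat t (x - y + z) + heat t (x - y - z) - 2 * heat t (x - y)) * g y.
  by rewrite [x + z - y]addrAC [x - z - y]addrAC; ring.
by move=> h; rewrite normrM (ger0_norm (g0 y)) ler_wpM2r.
Qed.

Lemma conv_heat_time_lipschitz eps : 0 < eps -> exists2 K, 0 <= K &
  forall x t t', eps <= t -> eps <= t' ->
    `|conv g (heat t) x - conv g (heat t') x| <= K * `|t - t'|.
Proof.
move=> e0; have [K K0 HK] := heat_time_lipschitz d e0.
exists (K * \int[leb]_y g y); first by rewrite mulr_ge0// Rintegral_ge0.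
move=> x t t' et et'; have t0 := lt_le_trans e0 et; have t'0 := lt_le_trans e0 et'.
have i1 := conv_heat_integrable ig x t0; have i2 := conv_heat_integrable ig x t'0.
rewrite /conv -RintegralB//.
apply: (le_trans (le_normr_Rintegral measurableT (integrableBR measurableT i1 i2))).
rewrite mulrAC -RintegralZl//; apply: le_Rintegral => //.
- by apply: integrable_norm; exact: integrableBR.
- exact: integrableZlR.
by move=> y _; rewrite -mulrBl normrM (ger0_norm (g0 y)) ler_wpM2r// HK.
Qed.

Lemma conv_heat_bounded eps : 0 < eps -> exists B, forall x t, eps <= t ->
  0 <= conv g (heat t) x <= B.
Proof.
move=> e0; exists ((4 * pi * eps) `^ (- (d%:R / 2)) * \int[leb]_y g y) => x t et.
have t0 := lt_le_trans e0 et.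
rewrite conv_heat_ge0//=.
rewrite -RintegralZl//; apply: le_Rintegral => //.
- exact: conv_heat_integrable.
- exact: integrableZlR.
move=> y _; rewrite ler_wpM2r//; apply: (le_trans (le_heat_peak _ t0)).
rewrite !powRN lef_pV2 ?posrE ?powR_gt0 ?mulr_gt0 ?pi_gt0//.
by rewrite ge0_ler_powR ?nnegrE ?mulr_ge0 ?pi_ge0 ?(ltW e0) ?(ltW t0)// ler_wpM2l// mulr_ge0// pi_ge0.
Qed.

(** Integrated against [heat s], each of the two shifted terms becomes w_(t+s)(x) by the semigroup
    law. The second difference thus gives 2 (w_(t+s) - w_t)(x), and the factor 2 cancels the half in
    the operator. *)
Lemma psi_laplacian_conv_heat t x : 0 < t ->
  lap_integrable (conv g (heat t)) x /\
  psi_laplacian m (conv g (heat t)) x =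
    \int[m]_(s in D) (conv g (heat (t + s)) x - conv g (heat t) x).
Proof.
move=> t0; have [C C0 HC] := conv_second_difference_le x t0.
have cw := continuous_conv_heat ig t0.
have mw (b : bool) : measurable_fun setT (fun z : vec => conv g (heat t) (x + (-1) ^+ b *: z)).
  apply: continuous_measurable_rV => z.
  apply: (continuous_comp (f := fun z : vec => x + (-1) ^+ b *: z)); last exact: cw.
  apply: (@continuousD _ _ _ (fun=> x) (fun z : vec => (-1) ^+ b *: z)).
    exact: cst_continuous.
  exact: scaler_continuous.
have E1 (z : vec) : x + z = x + (-1) ^+ false *: z by rewrite expr0 scale1r.
have E2 (z : vec) : x - z = x + (-1) ^+ true *: z by rewrite expr1 scaleN1r.
have mS : measurable_fun setT (second_difference (conv g (heat t)) x).
  apply: measurable_funB => //; apply: measurable_funD.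
    by under eq_fun do rewrite E1; exact: mw.
  by under eq_fun do rewrite E2; exact: mw.
split; first exact: (integrable_kern m1 jlty C0 mS HC).
rewrite psi_laplacianE (integral_kern m1 jlty C0 mS HC).
have ib (b : bool) s : 0 < s -> leb.-integrable setT
    (EFin \o (fun z : vec => heat s z * conv g (heat t) (x + (-1) ^+ b *: z))).
  move=> s0; apply/integrableP; split.
    apply/measurable_EFinP; apply: measurable_funM => //.
    by apply: continuous_measurable_rV; exact: continuous_heat.
  rewrite (_ : (\int[_]_x _)%E = (conv g (heat (s + t)) x)%:E) ?ltry//.
  rewrite -(heat_semigroup ig g0 x b s0 t0); apply: eq_integral => z _ /=.
  by rewrite ger0_norm// mulr_ge0 ?heat_ge0 ?conv_heat_ge0.
have ih s : 0 < s -> leb.-integrable setT (EFin \o (heat s : vec -> R)).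
  move=> s0; apply/integrableP; split.
    by apply/measurable_EFinP; apply: continuous_measurable_rV; exact: continuous_heat.
  rewrite (_ : (\int[_]_x _)%E = 1%E) ?ltry//.
  rewrite -[RHS](integral_heat (0 : vec) s0); apply: eq_integral => z _ /=.
  by rewrite subr0 ger0_norm// heat_ge0.
have Is s : 0 < s -> \int[leb]_z (second_difference (conv g (heat t)) x z * heat s z) =
    2 * (conv g (heat (t + s)) x - conv g (heat t) x).
  move=> s0; rewrite (@eq_Rintegral _ _ _ _ _ (fun z : vec =>
    heat s z * conv g (heat t) (x + (-1) ^+ false *: z) +
    heat s z * conv g (heat t) (x + (-1) ^+ true *: z) -
    2 * conv g (heat t) x * heat s z)); last first.
    move=> z _; rewrite /second_difference -(E1 z) -(E2 z).
    move: (conv _ _ (x + z)) (conv _ _ (x - z)) (conv _ _ x) (heat s z) => w1 w2 w0 h.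
    by ring.
  have i1 := ib false s s0; have i2 := ib true s s0.
  have i12 := integrableDR measurableT i1 i2.
  have i3 := integrableZlR measurableT (2 * conv g (heat t) x) (ih s s0).
  rewrite (RintegralB measurableT i12 i3) (RintegralD measurableT i1 i2).
  rewrite (RintegralZl _ measurableT (ih s s0)).
  have hs (b : bool) : \int[leb]_z (heat s z * conv g (heat t) (x + (-1) ^+ b *: z)) =
      conv g (heat (s + t)) x.
    by rewrite /Rintegral (heat_semigroup ig g0 x b s0 t0).
  have h1 : \int[leb]_z heat s z = 1.
    rewrite /Rintegral (_ : (\int[_]_x _)%E = 1%E)//.
    rewrite -[RHS](integral_heat (0 : vec) s0); apply: eq_integral => z _.
    by rewrite subr0.
  transitivity (conv g (heat (s + t)) x + conv g (heat (s + t)) x -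
                2 * conv g (heat t) x * 1).
    congr (_ + _ - _ * _); [exact: (hs false)|exact: (hs true)|exact: h1].
  rewrite (addrC s t); set w1 := conv _ _ _; set w0 := conv _ _ _.
  by ring.
have [K K0 HK] := conv_heat_time_lipschitz t0.
have [B HB] := conv_heat_bounded t0.
have iD := lattice_increment_integrable m1 K0 (HB x) (HK x) (lexx t).
rewrite (@eq_Rintegral _ _ _ m D (fun s => 2 * (conv g (heat (t + s)) x - conv g (heat t) x))).
  by rewrite (RintegralZl _ mD iD) mulrA mulVf// mul1r.
by move=> s /set_mem/D0 s0; exact: Is.
Qed.

End conv_heat.

End laplacian_values.

Section enorm.
Context {R : realType} {d : nat}.
Local Notation vec := ('rV[R]_d).

Lemma enorm_ge0 (x : vec) : 0 <= enorm x. Proof. exact: sqrtr_ge0. Qed.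

Lemma enormN (x : vec) : enorm (- x) = enorm x.
Proof. by rewrite /enorm; under eq_bigr do rewrite mxE sqrrN. Qed.

Lemma enormD (x y : vec) : enorm (x + y) <= enorm x + enorm y.
Proof.
rewrite -ler_sqr ?nnegrE ?addr_ge0 ?enorm_ge0// sqrrD !enorm_sqr sqnD lerD2r lerD2l.
rewrite -[enorm x * enorm y *+ 2]mulr_natl ler_wpM2l//.
apply: (le_trans (ler_norm _)); rewrite -ler_sqr ?nnegrE ?mulr_ge0 ?enorm_ge0//.
by rewrite real_normK ?num_real// exprMn !enorm_sqr ip_sqr_le.
Qed.

Lemma coord_le_enorm (x : vec) i : x ord0 i <= enorm x.
Proof.
apply: (le_trans (ler_norm _)); rewrite -ler_sqr ?nnegrE ?enorm_ge0//.
by rewrite real_normK ?num_real// enorm_sqr coord_sqr_le.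
Qed.

End enorm.

(** * Two explicit test functions: the quadratic cap and the indicator of a ball *)

Section barrier.
Context {R : realType} {d : nat}.
Local Notation vec := ('rV[R]_d).
Local Notation leb := (@lebesgue_rV R d).
Variable m : {sigma_finite_measure set (measurableTypeR R) -> \bar R}.
Hypothesis m1 : (\int[m]_(y in `]0%R, +oo[) (Num.min y 1)%:E < +oo)%E.
Hypothesis jfin : forall r : R, 0 < r -> (0 < jump_kernel m d r < +oo)%E.
Hypothesis d0 : (0 < d)%N.
Local Notation kern := (fun z : vec => fine (jump_kernel m d (enorm z))).
Local Notation D := (`]0%R, +oo[%classic : set (measurableTypeR R)).

Let mD : measurable D. Proof. exact: measurable_itv. Qed.

Let D0 s : D s -> 0 < s. Proof. by rewrite /= in_itv/= andbT. Qed.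

Let jlty (r : R) : 0 < r -> (jump_kernel m d r < +oo)%E.
Proof. by move=> /jfin/andP[]. Qed.

Lemma measurable_heat_time (r : R) :
  measurable_fun D (fun t : measurableTypeR R =>
    (4 * pi * t) `^ (- (d%:R / 2)) * expR (- (r ^+ 2 / (4 * t)))).
Proof.
apply: (eq_measurable_fun (fun t : measurableTypeR R =>
    (4 * pi * t) `^ (- (d%:R / 2)) * expR (- (r ^+ 2 * (4 * t) `^ (-1))))).
  by move=> t /set_mem/D0 t0; rewrite powR_inv1// mulr_ge0// ltW.
apply: measurable_funTS; apply: measurable_funM.
  by apply: (measurableT_comp (measurable_powR _)); exact: measurable_funM.
apply: measurableT_comp => //; apply: measurableT_comp => //.
apply: measurable_funM => //.
by apply: (measurableT_comp (measurable_powR _)); exact: measurable_funM.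
Qed.

Lemma jump_kernel_le (r r' : R) : 0 < r -> r <= r' ->
  fine (jump_kernel m d r') <= fine (jump_kernel m d r).
Proof.
move=> r0 rr'; have r'0 := lt_le_trans r0 rr'.
apply: fine_le.
- by rewrite ge0_fin_numE ?jump_kernel_ge0 ?jlty.
- by rewrite ge0_fin_numE ?jump_kernel_ge0 ?jlty.
apply: ge0_le_integral => //.
- by move=> s _; rewrite lee_fin mulr_ge0 ?powR_ge0 ?expR_ge0.
- by apply/measurable_EFinP; exact: measurable_heat_time.
- by apply/measurable_EFinP; exact: measurable_heat_time.
- move=> s /D0 s0; rewrite lee_fin ler_wpM2l ?powR_ge0// ler_expR lerN2.
  rewrite ler_wpM2r ?invr_ge0 ?mulr_ge0 ?(ltW s0)//.
  by rewrite ler_sqr ?nnegrE ?(ltW r0) ?(ltW r'0).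
Qed.

(** Bounded, equal to a quadratic near [x0], and positive elsewhere. Its second difference at its
    own centre does not involve the centre, so one bound serves all centres. *)
Definition quad_cap (x0 y : vec) : R := Num.min 1 (sqn (y - x0)).

Lemma quad_cap_second_difference (x0 z : vec) :
  second_difference (quad_cap x0) x0 z = 2 * Num.min 1 (sqn z).
Proof.
have s0 : sqn (0 : vec) = 0 by rewrite /sqn big1// => i _; rewrite mxE expr0n.
rewrite /second_difference /quad_cap subrr s0 [x0 + z]addrC addrK.
have -> : x0 - z - x0 = - z by rewrite addrAC subrr add0r.
have -> : sqn (- z) = sqn z by rewrite /sqn; under eq_bigr do rewrite mxE sqrrN.
by rewrite (min_r ler01) mulr0 subr0; ring.
Qed.

Lemma measurable_min_sqn : measurable_fun setT (fun z : vec => 2 * Num.min 1 (sqn z)).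
Proof.
by apply: measurable_funM => //; apply: measurable_minr => //; exact: measurable_sqn.
Qed.

Lemma psi_laplacian_quad_cap : exists2 J, 0 <= J & forall x0 : vec,
  lap_integrable m (quad_cap x0) x0 /\ psi_laplacian m (quad_cap x0) x0 <= J.
Proof.
have min0 (z : vec) : 0 <= Num.min 1 (sqn z) by rewrite le_min ler01 sqn_ge0.
have b2 (z : vec) : `|2 * Num.min 1 (sqn z)| <= 2 * Num.min 1 (sqn z).
  by rewrite ger0_norm// mulr_ge0.
have i2 := integrable_kern m1 jlty (ler0n _ 2) measurable_min_sqn b2.
exists (2^-1 * \int[leb]_z (2 * Num.min 1 (sqn z) * kern z)).
  rewrite mulr_ge0// Rintegral_ge0// => z _; rewrite mulr_ge0// ?mulr_ge0//.
  by rewrite fine_ge0// jump_kernel_ge0.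
move=> x0; split.
  rewrite /lap_integrable (_ : (fun z => _) = (fun z : vec => 2 * Num.min 1 (sqn z) * kern z))//.
  by apply/funext => z; rewrite quad_cap_second_difference.
rewrite psi_laplacianE ler_wpM2l// le_eqVlt; apply/orP; left; apply/eqP.
by apply: eq_Rintegral => z _; rewrite quad_cap_second_difference.
Qed.

Definition ball_cap (rho : R) (y : vec) : R := (enorm y < rho)%R%:R.

Lemma measurable_ball_cap rho : measurable_fun setT (ball_cap rho).
Proof.
rewrite (_ : ball_cap rho = (fun y : vec => if enorm y < rho then 1 else 0)).
  apply: measurable_fun_ifT => //; apply: measurable_fun_ltr => //.
  rewrite (_ : @enorm R d = Num.sqrt \o (@sqn R d))//.
  apply: measurableT_comp; last exact: measurable_sqn.
  by apply: continuous_measurable_fun; exact: sqrt_continuous.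
by apply/funext => y; rewrite /ball_cap; case: ifP.
Qed.

(** At an interior point all second differences are <= 0, and they vanish for |z| < 1. On the unit
    cube [Q] with coordinates in [2 rho, 2 rho + 1] both x + z and x - z leave the ball, so the
    difference is -2. The kernel decreases in the radius, hence is at least its value [k] at the
    largest radius [b] in [Q], and [Q] has volume 1. *)
Lemma psi_laplacian_ball_cap (rho : R) : 1 <= rho -> exists2 k, 0 < k &
  forall x : vec, enorm x <= rho - 1 ->
    lap_integrable m (ball_cap rho) x /\ psi_laplacian m (ball_cap rho) x <= - k.
Proof.
move=> rho1; have rho0 : 0 < rho by exact: lt_le_trans rho1.
pose a := 2 * rho; have a0 : 0 < a by rewrite mulr_gt0.
pose A (i : 'I_d) : set R := `[a, a + 1]%classic.
pose Q : set vec := [set z | forall i, A i (z ord0 i)].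
have mA i : measurable (A i) by exact: measurable_itv.
have mQ : measurable Q.
  rewrite (_ : Q = \bigcap_(i in [set: 'I_d]) ((fun z : vec => z ord0 i) @^-1` A i)).
    apply: fin_bigcap_measurable => [|i _]; first exact: finite_finset.
    by rewrite -[X in measurable X]setTI; exact: measurable_coord.
  by apply/seteqP; split => z /= zA i; [move=> _|]; exact: zA.
have Q1 : leb Q = 1%E.
  rewrite /Q lebesgue_rV_box//; rewrite big1// => i _.
  rewrite lebesgue_measure_itv/= lte_fin ltrDl ltr01 -EFinD.
  by congr EFin; ring.
pose b := Num.sqrt (d%:R * (a + 1) ^+ 2).
have b0 : 0 < b by rewrite sqrtr_gt0 mulr_gt0 ?ltr0n// exprn_gt0// addr_gt0.
pose k := fine (jump_kernel m d b).
have k0 : 0 < k by rewrite fine_gt0//; exact: jfin.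
have Qlow (z : vec) : Q z -> a <= enorm z.
  move=> Qz; have := Qz (Ordinal d0); rewrite /A/= in_itv/= => /andP[az _].
  exact: (le_trans az (coord_le_enorm _ _)).
have Qup (z : vec) : Q z -> enorm z <= b.
  move=> Qz; rewrite ler_wsqrtr//.
  apply: (@le_trans _ _ (\sum_(i < d) (a + 1) ^+ 2)); last first.
    by rewrite sumr_const card_ord mulr_natl.
  apply: ler_sum => i _; have := Qz i; rewrite /A/= in_itv/= => /andP[az za].
  rewrite ler_sqr ?nnegrE ?addr_ge0 ?(ltW a0)//.
  by apply: le_trans az; exact: ltW.
exists k => // x xrho.
have Bx : ball_cap rho x = 1.
  by rewrite /ball_cap (le_lt_trans xrho)// gtrBl.
have cap01 (y : vec) : 0 <= ball_cap rho y <= 1.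
  by rewrite /ball_cap; case: (_ < _); rewrite /= ?lexx ?ler01.
pose S := second_difference (ball_cap rho) x.
have S0 (z : vec) : S z <= 0.
  rewrite /S /second_difference Bx.
  have /andP[_ h1] := cap01 (x + z); have /andP[_ h2] := cap01 (x - z).
  by move: h1 h2; move: (ball_cap _ _) (ball_cap _ _) => u v; lra.
have SC (z : vec) : `|S z| <= 2 * Num.min 1 (sqn z).
  have [z1|z1] := ltP (enorm z) 1.
    rewrite /S /second_difference Bx /ball_cap.
    have -> : enorm (x + z) < rho.
      by apply: (le_lt_trans (enormD _ _)); move: (enorm x) (enorm z) xrho z1 => ? ?; lra.
    have -> : enorm (x - z) < rho.
      apply: (le_lt_trans (enormD _ _)); rewrite enormN.
      by move: (enorm x) (enorm z) xrho z1 => ? ?; lra.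
    rewrite (_ : 1%:R + 1%:R - 2 * 1 = 0 :> R); last by ring.
    by rewrite normr0 mulr_ge0// le_min ler01 sqn_ge0.
  rewrite min_l; last by rewrite -enorm_sqr expr_ge1// enorm_ge0.
  rewrite ler0_norm// /S /second_difference Bx.
  have /andP[h1 _] := cap01 (x + z); have /andP[h2 _] := cap01 (x - z).
  by move: h1 h2; move: (ball_cap _ _) (ball_cap _ _) => u v; lra.
have mS : measurable_fun setT S.
  have mt (s : R) : measurable_fun setT (fun z : vec => ball_cap rho (x + s *: z)).
    apply: (measurableT_comp (measurable_ball_cap rho)); apply: measurable_fun_rV => i.
    apply: (eq_measurable_fun (fun z : vec => x ord0 i + s * z ord0 i)).
      by move=> z _; rewrite !mxE.
    by apply: measurable_funD => //; apply: measurable_funM => //; exact: measurable_coord.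
  apply: measurable_funB => //; apply: measurable_funD.
    by apply: eq_measurable_fun (mt 1) => z _; rewrite scale1r.
  by apply: eq_measurable_fun (mt (-1)) => z _; rewrite scaleN1r.
have iS := integrable_kern m1 jlty (ler0n _ 2) mS SC.
split => //.
rewrite psi_laplacianE -/S.
have -> : - k = 2^-1 * (- (2 * k)) by field.
rewrite ler_wpM2l//.
have i1Q : leb.-integrable setT (EFin \o \1_Q).
  apply/integrableP; split.
    by apply/measurable_EFinP; exact: measurable_indic.
  rewrite (_ : (\int[_]_x _)%E = 1%E) ?ltry// -Q1 -[in RHS](setIT Q) -integral_indic//.
  by apply: eq_integral => z _ /=; rewrite ger0_norm// indicE ler0n.
have iQ := integrableZlR measurableT (- (2 * k)) i1Q.
apply: (@le_trans _ _ (\int[leb]_z (- (2 * k) * \1_Q z))).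
  apply: le_Rintegral => // z _; rewrite indicE.
  have kz : 0 <= fine (jump_kernel m d (enorm z)) by rewrite fine_ge0// jump_kernel_ge0.
  have [/set_mem Qz|_] := boolP (z \in Q); last first.
    by rewrite mulr0 mulr_le0_ge0.
  rewrite mulr1; have az := Qlow _ Qz.
  have out (y : vec) : enorm z <= enorm y + enorm x -> ball_cap rho y = 0.
    move=> h; rewrite /ball_cap ltNge (_ : rho <= enorm y)//.
    move: (enorm x) (enorm y) (enorm z) xrho az h rho1 => ? ? ?.
    by rewrite /a; lra.
  have S2 : S z = -2.
    rewrite /S /second_difference Bx !out; first by ring.
      rewrite -(enormN (x - z)) opprB; apply: le_trans (enormD _ _).
      by rewrite subrK.
    by rewrite -(enormN x); apply: le_trans (enormD _ _); rewrite addrAC subrr add0r.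
  have kk : k <= fine (jump_kernel m d (enorm z)).
    by apply: jump_kernel_le; [exact: lt_le_trans az|exact: Qup].
  by rewrite S2 mulNr lerN2 ler_pM2l.
rewrite (RintegralZl _ measurableT i1Q).
rewrite (_ : \int[leb]_z \1_Q z = 1) ?mulr1//.
by rewrite /Rintegral integral_indic// setIT; exact: (congr1 fine Q1).
Qed.

End barrier.

(** * Twice continuously differentiable functions *)

Section C2.
Context {R : realType} {d : nat}.
Local Notation vec := ('rV[R]_d).
Local Notation leb := (@lebesgue_rV R d).
Local Notation e_ j := (delta_mx ord0 j : vec).

(** The partial derivatives are carried as witnesses, so that closure under sums and convolutions
    only combines witnesses. *)
Definition is_C2 (f : vec -> R) := exists f1 : 'I_d -> vec -> R,
  exists f2 : 'I_d -> 'I_d -> vec -> R,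
  [/\ continuous f, forall i, continuous (f1 i), forall i j, continuous (f2 i j),
      forall x i, is_derive x (e_ i) f (f1 i x) &
      forall x i j, is_derive x (e_ j) (f1 i) (f2 i j x)].

Lemma is_C2D f g : is_C2 f -> is_C2 g -> is_C2 (fun y => f y + g y).
Proof.
move=> [f1 [f2 [a1 a2 a3 a4 a5]]] [g1 [g2 [b1 b2 b3 b4 b5]]].
exists (fun i y => f1 i y + g1 i y), (fun i j y => f2 i j y + g2 i j y).
split.
- by move=> y; apply: continuousD; [exact: a1|exact: b1].
- by move=> i y; apply: continuousD; [exact: a2|exact: b2].
- by move=> i j y; apply: continuousD; [exact: a3|exact: b3].
- by move=> x i; apply: is_deriveD.
- by move=> x i j; apply: is_deriveD.
Qed.

Lemma is_C2Z (a : R) f : is_C2 f -> is_C2 (fun y => a * f y).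
Proof.
move=> [f1 [f2 [a1 a2 a3 a4 a5]]].
have cZ (h : vec -> R) : continuous h -> continuous (fun y => a * h y).
  by move=> ch y; apply: (@continuousM _ _ (fun=> a) h); [exact: cst_continuous|exact: ch].
exists (fun i y => a * f1 i y), (fun i j y => a * f2 i j y); split.
- exact: cZ.
- by move=> i; exact: cZ.
- by move=> i j; exact: cZ.
- by move=> x i; exact: is_deriveZ.
- by move=> x i j; exact: is_deriveZ.
Qed.

Lemma is_C2_cst (a : R) : is_C2 (fun=> a).
Proof.
exists (fun _ _ => 0), (fun _ _ _ => 0); split.
- by move=> y; exact: cst_continuous.
- by move=> i y; exact: cst_continuous.
- by move=> i j y; exact: cst_continuous.
- by move=> x i; exact: is_derive_cst.
- by move=> x i j; exact: is_derive_cst.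
Qed.

Lemma is_C2_sum n (u : nat -> R) (f : nat -> vec -> R) :
  (forall i, (i < n)%N -> is_C2 (f i)) -> is_C2 (fun y => \sum_(i < n) u i * f i y).
Proof.
elim: n => [|n IH] fi.
  rewrite (_ : (fun y => _) = (fun=> 0)); first exact: is_C2_cst.
  by apply/funext => y; rewrite big_ord0.
rewrite (_ : (fun y => _) = (fun y => \sum_(i < n) u i * f i y + u n * f n y)).
  by apply: is_C2D; [apply: IH => i ni; apply: fi; exact: ltnW|exact/is_C2Z/fi].
by apply/funext => y; rewrite big_ord_recr.
Qed.

Lemma is_C2_sqnB (x0 : vec) : is_C2 (fun y => sqn (y - x0)).
Proof.
have cB (h : vec -> R) : continuous h -> continuous (fun y : vec => h (y - x0)).
  move=> ch y; apply: (continuous_comp (f := fun y : vec => y - x0)); last exact: ch.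
  by apply: (@continuousB _ _ _ id (fun=> x0)) => //; exact: cst_continuous.
have dB (h h' : vec -> R) (v : vec) : (forall x, is_derive x v h (h' x)) ->
    forall x, is_derive x v (fun y : vec => h (y - x0)) (h' (x - x0)).
  move=> dh x; apply: is_derive_line.
  rewrite (_ : (fun s : R => _) = (fun s : R => h (s *: v + (x - x0)))); last first.
    by apply/funext => s; rewrite addrA.
  by apply: derive_lineP; rewrite scale0r add0r.
exists (fun i y => 2 * (y - x0) ord0 i), (fun i j _ => 2 * (i == j)%:R); split.
- by apply: cB; exact: continuous_sqn.
- move=> i; apply: (cB (fun y => 2 * y ord0 i)) => y.
  apply: (@continuousM _ _ (fun=> 2) (fun y : vec => y ord0 i)).
    exact: cst_continuous.
  exact: continuous_coord.
- by move=> i j y; exact: cst_continuous.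
- by move=> x i; apply: (dB _ (fun y : vec => 2 * y ord0 i)) => y; exact: is_derive_sqn.
- move=> x i j; apply: (dB (fun y : vec => 2 * y ord0 i) (fun=> 2 * (i == j)%:R)) => y.
  by have := is_derive_coord y i j => h; exact: is_deriveZ.
Qed.

Lemma is_C2_conv_heat (g : vec -> R) t : leb.-integrable setT (EFin \o g) -> 0 < t ->
  is_C2 (conv g (heat t)).
Proof.
move=> ig t0.
have [C HC] := heat_bounded (d := d) t0.
have /choice[C1 HC1] := fun i => heat1_bounded (d := d) i t0.
have /choice[C2 HC2] : forall p : 'I_d * 'I_d, exists C, forall z : vec,
  `|heat2 p.1 p.2 t z| <= C by move=> p; exact: heat2_bounded.
exists (fun i => conv g (heat1 i t)), (fun i j => conv g (heat2 i j t)); split.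
- by apply: (continuous_conv ig _ HC); exact: continuous_heat.
- by move=> i; apply: (continuous_conv ig _ (HC1 i)); exact: continuous_heat1.
- by move=> i j; apply: (continuous_conv ig _ (HC2 (i, j))); exact: continuous_heat2.
- move=> x i; apply: (is_derive_conv ig _ _ HC (HC1 i)).
    exact: continuous_heat.
  by move=> z; exact: is_derive_heat.
- move=> x i j; apply: (is_derive_conv ig _ _ (HC1 i) (HC2 (i, j))).
    exact: continuous_heat1.
  by move=> z; exact: is_derive_heat1.
Qed.

Lemma near_eq_continuous (f g : vec -> R) (y : vec) : (\forall z \near y, f z = g z) ->
  {for y, continuous f} -> {for y, continuous g}.
Proof.
move=> fg cf; have fgy : f y = g y by exact: (nbhs_singleton fg).
rewrite /prop_for /continuous_at -fgy; apply: cvg_trans cf.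
have fg' : \forall z \near y, f z = g z by [].
exact: (near_eq_cvg fg').
Qed.

Lemma C2b_at_near (phi f : vec -> R) (x : vec) :
  bounded_fun phi -> measurable_fun setT phi -> is_C2 f ->
  (\forall y \near x, phi y = f y) -> C2b_at x phi.
Proof.
move=> bphi mphi [f1 [f2 [a1 a2 a3 a4 a5]]] E; split => //.
(* Second partials at y depend on first partials around y, hence on values around points near y;
   equality is therefore propagated to neighbourhoods of nearby points. *)
have E' : \forall y \near x, \forall z \near y, f z = phi z.
  by apply: near_join; apply: filterS E => y ->.
apply: filterS E' => y Ey.
have p1 i (y' : vec) : (\forall z \near y', f z = phi z) -> f1 i y' = partial i phi y'.
  move=> Ey'; rewrite /partial -(near_eq_derive _ Ey').
  by have /@derive_val -> := a4 y' i.
have p1n i (y' : vec) : (\forall z \near y', f z = phi z) ->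
    \forall z \near y', f1 i z = partial i phi z.
  by move=> /near_join; apply: filterS => z; exact: p1.
have p2 i j (y' : vec) : (\forall z \near y', f z = phi z) ->
    f2 i j y' = partial j (partial i phi) y'.
  move=> Ey'; rewrite {1}/partial -(near_eq_derive _ (p1n i _ Ey')).
  by have /@derive_val -> := a5 y' i j.
split; first exact: near_eq_continuous (a1 y).
move=> i; split.
- by apply: near_eq_derivable Ey _; have /@ex_derive := a4 y i.
- by apply: near_eq_continuous (a2 i y); exact: p1n.
- move=> j; split.
    by apply: (near_eq_derivable (p1n i y Ey)); have /@ex_derive := a5 y i j.
  apply: near_eq_continuous (a3 i j y).
  by move/near_join : Ey; apply: filterS => z; exact: p2.
Qed.

End C2.

(** * Heat approximation from below, uniform on compact sets *)

Section approximation.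
Context {R : realType} {d : nat}.
Local Notation vec := ('rV[R]_d).
Local Notation leb := (@lebesgue_rV R d).

Lemma compact_lower_unif (g : vec -> R) (K : set vec) (e : R) :
  continuous g -> compact K -> 0 < e ->
  exists2 rho : R, 0 < rho & forall x y, K x -> enorm (x - y) < rho -> g x - e <= g y.
Proof.
move=> cg cK e0.
have /compact_near_coveringP cov := cK.
have FF : Filter ((0 : R)^'+) by typeclasses eauto.
have := @cov R 0^'+ (fun rho x => forall y, ball x rho y -> g x - e <= g y) FF.
have H : forall x : vec, K x -> \forall x' \near x & rho \near 0^'+,
    forall y, ball x' rho y -> g x' - e <= g y.
  move=> x Kx; have e20 : 0 < e / 2 by rewrite divr_gt0.
  have /cvgrPdist_lt/(_ _ e20)/nbhs_ballP[r /= r0 Hr] := cg x.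
  have r20 : 0 < r / 2 by rewrite divr_gt0.
  exists (ball x (r / 2), [set rho : R | rho < r / 2]) => /=.
    split; first exact: nbhsx_ballx.
    by apply: nbhs_right_lt.
  move=> [x' rho] /= [xx' rhor] y x'y.
  have h1 : `|g x - g x'| < e / 2.
    by apply: Hr; apply: le_ball xx'; rewrite ler_pdivrMr// ler_peMr ?ler1n// ltW.
  have h2 : `|g x - g y| < e / 2.
    apply: Hr; rewrite [r]splitr; apply: ball_triangle xx' _.
    by apply: le_ball x'y; exact: ltW.
  by move: h1 h2; rewrite !ltr_norml => /andP[? ?] /andP[? ?]; lra.
move=> /(_ H) /= H0.
have : \forall rho \near (0 : R)^'+, 0 < rho /\
    (forall x, K x -> forall y, ball x rho y -> g x - e <= g y).
  near=> rho; split; first by near: rho; exact: nbhs_right_gt.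
  by near: rho; exact: H0.
move=> /filter_ex[rho [rho0 Hrho]].
exists rho => // x y Kx xy; apply: Hrho => //.
(* Balls are those of the sup norm, which is at most the Euclidean one. *)
split => // i j; rewrite (ord1 i); apply: le_lt_trans xy.
have := coord_le_enorm (x - y) j; have := coord_le_enorm (- (x - y)) j.
by rewrite enormN !mxE => h1 h2; rewrite ler_norml; apply/andP; split; lra.
Unshelve. all: by end_near. Qed.

(** Within distance rho of x the values of g are at least G = g x - e/2. Farther away the Gaussian
    at time [eps] is at most c times the one at time 2 eps, so that subtracting G c of the latter
    makes the integrand nonpositive there. The bound integrates to G - G c. *)
Lemma conv_heat_approx (g : vec -> R) (K : set vec) (M e : R) :
  continuous g -> leb.-integrable setT (EFin \o g) -> (forall y, 0 <= g y <= M) ->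
  compact K -> 0 < e ->
  exists2 e0, 0 < e0 & forall eps x, 0 < eps -> eps <= e0 -> K x ->
    g x - e <= conv g (heat eps) x.
Proof.
move=> cg ig gM cK e_gt0; have g0 y : 0 <= g y by case/andP: (gM y).
have M0 : 0 <= M by case/andP: (gM 0) => a b; exact: le_trans b.
have e20 : 0 < e / 2 by rewrite divr_gt0.
have [rho rho0 Hrho] := compact_lower_unif cg cK e20.
pose A : R := 2 `^ (d%:R / 2); have A0 : 0 < A by rewrite powR_gt0.
have M1 : 0 < M + 1 by rewrite ltr_wpDl.
(* Obtained by solving M c <= e/2 for [eps], after e^(-X) <= 1/X with X = rho^2/(8 eps). *)
exists (e / 2 * rho ^+ 2 / (8 * A * (M + 1))).
  by rewrite divr_gt0 ?mulr_gt0// exprn_gt0.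
move=> eps x eps0 epse Kx; have eps20 : 0 < 2 * eps by rewrite mulr_gt0.
have [gx|gx] := leP (g x) (e / 2).
  by apply: le_trans (conv_heat_ge0 _ _ _); rewrite // subr_le0; lra.
pose G := g x - e / 2; have G0 : 0 <= G by rewrite subr_ge0 ltW.
have GM : G <= M by case/andP: (gM x) => a b; rewrite /G; lra.
pose c := A * expR (- (rho ^+ 2 / (8 * eps))).
have c0 : 0 <= c by rewrite mulr_ge0 ?expR_ge0// ltW.
have Mc : M * c <= e / 2.
  pose X := rho ^+ 2 / (8 * eps).
  have X0 : 0 < X by rewrite divr_gt0 ?exprn_gt0// mulr_gt0.
  have h1 : expR (- X) <= X^-1.
    by rewrite -[leRHS]mul1r ler_pdivlMr// mulrC exprM_exp_le.
  apply: (@le_trans _ _ ((M + 1) * (A * X^-1))).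
    by apply: ler_pM => //; [rewrite lerDl|rewrite ler_pM2l].
  have -> : X^-1 = 8 * eps / rho ^+ 2.
    by rewrite /X invf_div.
  have -> : (M + 1) * (A * (8 * eps / rho ^+ 2)) = eps * (8 * A * (M + 1)) / rho ^+ 2.
    by ring.
  by rewrite ler_pdivrMr ?exprn_gt0// -ler_pdivlMr// !mulr_gt0.
have ih t : 0 < t -> leb.-integrable setT (EFin \o (fun y : vec => heat t (x - y))).
  move=> t0; apply/integrableP; split.
    by apply/measurable_EFinP; exact: measurable_heat_subl.
  rewrite (_ : (\int[_]_x _)%E = 1%E) ?ltry//.
  rewrite -[RHS](integral_heat_subl x t0); apply: eq_integral => z _ /=.
  by rewrite ger0_norm// heat_ge0.
have I1 t : 0 < t -> \int[leb]_y heat t (x - y) = 1.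
  by move=> t0; rewrite /Rintegral integral_heat_subl.
have i1 := integrableZlR measurableT G (ih _ eps0).
have i2 := integrableZlR measurableT (G * c) (ih _ eps20).
apply: (@le_trans _ _ (\int[leb]_y (G * heat eps (x - y) - G * c * heat (2 * eps) (x - y)))).
  rewrite (RintegralB measurableT i1 i2) (RintegralZl _ measurableT (ih _ eps0)).
  rewrite (RintegralZl _ measurableT (ih _ eps20)) !I1// !mulr1.
  have : G * c <= M * c by rewrite ler_wpM2r.
  by rewrite /G; lra.
apply: le_Rintegral => //.
- exact: integrableBR.
- exact: conv_heat_integrable.
move=> y _; have h0 := heat_ge0 eps (x - y); have h2 := heat_ge0 (2 * eps) (x - y).
have [xy|xy] := ltP (enorm (x - y)) rho.
  have := Hrho _ _ Kx xy; rewrite -/G => Gy.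
  have : G * heat eps (x - y) <= heat eps (x - y) * g y by rewrite mulrC ler_wpM2l.
  have : 0 <= G * c * heat (2 * eps) (x - y) by rewrite mulr_ge0// mulr_ge0.
  lra.
apply: (@le_trans _ _ 0); last by rewrite mulr_ge0.
rewrite subr_le0 -mulrA ler_wpM2l// heat_double// /c mulrAC ler_wpM2r//.
rewrite -/A ler_pM2l// ler_expR lerN2 ler_pM2r ?invr_gt0 ?mulr_gt0//.
by rewrite -enorm_sqr ler_sqr ?nnegrE ?enorm_ge0// ltW.
Qed.

End approximation.

(** * The approximate potential of g as a supersolution *)

Section supersolution.
Context {R : realType} {d : nat}.
Local Notation vec := ('rV[R]_d).
Local Notation leb := (@lebesgue_rV R d).
Variable m : {sigma_finite_measure set (measurableTypeR R) -> \bar R}.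
Hypothesis m1 : (\int[m]_(y in `]0%R, +oo[) (Num.min y 1)%:E < +oo)%E.
Hypothesis mD0 : m (`]0%R, +oo[%classic : set (measurableTypeR R)) != 0%E.
Hypothesis jfin : forall r : R, 0 < r -> (0 < jump_kernel m d r < +oo)%E.
Variable Psi : R -> R.
Hypothesis PsiE : forall x : R, 0 < x ->
  (Psi x)%:E = (\int[m]_(y in `]0%R, +oo[) (1 - expR (- (y * x)))%:E)%E.
Variables (mu c theta p : R).
Hypotheses (mu0 : 0 < mu) (c0 : 0 < c) (theta0 : 0 <= theta).
Hypothesis wlsc : WLSC Psi mu c theta.
Hypotheses (d0 : (0 < d)%N) (p1 : 1 < p) (pmu : d%:R / (2 * mu) < p).

(** The constants precede g, its bound M, the error e and the set K. Those only influence [eps] and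
    the lattice, on which neither the weighted sum of t_n^(-a) nor the cutoff time depends. *)
Lemma heat_supersolution : exists C1 C2 : R, [/\ 0 <= C1, 0 <= C2 &
  forall (g : vec -> R) (M A e : R) (K : set vec),
    continuous g -> leb.-integrable setT (EFin \o g) -> (forall y, 0 <= g y <= M) ->
    (Lnorm leb p%:E (EFin \o g) <= A%:E)%E -> compact K -> 0 < e ->
    exists w : vec -> R, [/\ is_C2 w, forall y, 0 <= w y <= C1 * A,
      forall x, lap_integrable m w x &
      forall x, K x -> psi_laplacian m w x <= C2 * A - g x + e]].
Proof.
have p0 : 0 < p by exact: lt_trans p1.
pose a : R := d%:R / (2 * p).
have a0 : 0 < a by rewrite divr_gt0 ?mulr_gt0// ltr0n.
have amu : a < mu.
  rewrite /a ltr_pdivrMr ?mulr_gt0//; move: pmu; rewrite ltr_pdivrMr ?mulr_gt0//.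
  by have -> : p * (2 * mu) = mu * (2 * p) by ring.
have [C1 [T [C10 T0 HW]]] := potential_weights m1 mD0 PsiE mu0 c0 theta0 wlsc a0 amu.
have pi4 : 0 < 4 * pi :> R by rewrite mulr_gt0 ?pi_gt0.
exists ((4 * pi) `^ (- a) * C1), ((4 * pi * T) `^ (- a)); split.
- by rewrite mulr_ge0 ?powR_ge0// ltW.
- exact: powR_ge0.
move=> g M A e K cg ig gM gA cK e_gt0.
have g0 y : 0 <= g y by case/andP: (gM y).
have A0 : 0 <= A by rewrite -lee_fin; apply: le_trans gA; exact: Lnorm_ge0.
have e20 : 0 < e / 2 by rewrite divr_gt0.
have [e0 e00 He0] := conv_heat_approx cg ig gM cK e20.
pose eps := Num.min e0 T.
have eps0 : 0 < eps by rewrite lt_min e00.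
have epsT : eps <= T by rewrite ge_min lexx orbT.
have [L L0 HL] := conv_heat_time_lipschitz ig g0 eps0.
have [B HB] := conv_heat_bounded ig g0 eps0.
(* Half of the error e pays for lattice rounding, the other half for replacing g by its heat
   approximation on K. *)
pose del := e / 2 / (L + 1).
have L1 : 0 < L + 1 by rewrite ltr_wpDl.
have del0 : 0 < del by rewrite divr_gt0.
have [N [u [t [u0 te uC Hu]]]] := HW _ _ eps0 epsT del0.
have t0 n : 0 < t n by exact: lt_le_trans (te n).
have lapn n x := psi_laplacian_conv_heat m1 jfin ig g0 x (t0 n).
exists (fun y => \sum_(n < N.+1) u n * conv g (heat (t n)) y); split.
- apply: (@is_C2_sum _ _ N.+1 u (fun n => conv g (heat (t n)))) => n _.
  exact: is_C2_conv_heat.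
- move=> y; apply/andP; split.
    by apply: sumr_ge0 => n _; rewrite mulr_ge0// conv_heat_ge0.
  apply: (@le_trans _ _ (\sum_(n < N.+1) u n * ((4 * pi * t n) `^ (- a) * A))).
    apply: ler_sum => n _; rewrite ler_wpM2l//.
    exact: conv_heat_le.
  have -> : \sum_(n < N.+1) u n * ((4 * pi * t n) `^ (- a) * A) =
      (4 * pi) `^ (- a) * (\sum_(n < N.+1) u n * t n `^ (- a)) * A.
    rewrite mulr_sumr mulr_suml; apply: eq_bigr => n _.
    by rewrite powRM ?(ltW pi4) ?(ltW (t0 n))//; ring.
  by rewrite ler_wpM2r// ler_wpM2l ?powR_ge0.
- move=> x; have [] // := @psi_laplacian_sum _ _ m N.+1 u (fun n => conv g (heat (t n))) x.
  by move=> n _; have [] := lapn n x.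
move=> x Kx.
have [|_ ->] := @psi_laplacian_sum _ _ m N.+1 u (fun n => conv g (heat (t n))) x.
  by move=> n _; have [] := lapn n x.
have -> : \sum_(i < N.+1) u i * psi_laplacian m (conv g (heat (t i))) x =
    \sum_(i < N.+1) u i *
      \int[m]_(s in `]0%R, +oo[) (conv g (heat (t i + s)) x - conv g (heat (t i)) x).
  by apply: eq_bigr => i _; have [_ ->] := lapn i x.
(* Past time T, Hoelder bounds the heat convolution by (4 pi T)^(-a) A; this value of [Om] is the
   source of the term C2 A. *)
apply: (le_trans (Hu (fun s => conv g (heat s) x) L B ((4 * pi * T) `^ (- a) * A) L0 _ _ _)).
- by move=> s; exact: HB.
- by move=> s s'; exact: HL.
- move=> s Ts; have s0 := lt_le_trans T0 Ts.
  apply: (le_trans (conv_heat_le ig g0 x p1 s0 gA)); rewrite -/a ler_wpM2r//.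
  rewrite !powRN lef_pV2 ?posrE ?powR_gt0 ?mulr_gt0 ?pi_gt0//.
  rewrite ge0_ler_powR ?nnegrE ?(ltW a0)//; last by rewrite ler_pM2l.
  - by rewrite mulr_ge0 ?(ltW pi4)// ltW.
  - by rewrite mulr_ge0 ?(ltW pi4)// ltW.
have h1 : L * del <= e / 2.
  rewrite /del mulrA ler_pdivrMr// mulrC ler_pM2l// lerDl//.
have epse : eps <= e0 by rewrite ge_min lexx.
have h2 := He0 _ _ eps0 epse Kx.
lra.
Qed.

End supersolution.

(** * Sigma-finiteness of the Levy measure, for Fubini *)

Section levy_sigma_finite.
Context {R : realType}.
Variable m : {measure set (measurableTypeR R) -> \bar R}.
Hypothesis m1 : (\int[m]_(y in `]0%R, +oo[) (Num.min y 1)%:E < +oo)%E.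
Local Notation D := (`]0%R, +oo[%classic : set (measurableTypeR R)).

Let mD : measurable D. Proof. exact: measurable_itv. Qed.

Definition levy_restr : set (measurableTypeR R) -> \bar R := mrestr m mD.
HB.instance Definition _ := Measure.on levy_restr.

Lemma levy_sigma_finite :
  exists nu : {sigma_finite_measure set (measurableTypeR R) -> \bar R},
    forall f : measurableTypeR R -> \bar R,
      (\int[m]_(t in D) f t = \int[nu]_(t in D) f t)%E.
Proof.
have sf : sigma_finite setT levy_restr.
  (* The half-line of nonpositive numbers is added to exhaust the real line; the restricted measure
     gives it mass 0, and the tails are finite. *)
  exists (fun n => `]-oo, 0%R] `|` `[n.+1%:R^-1, +oo[) => [|n].
    apply/esym; rewrite -subTset => x _.
    have [x0|x0] := leP x 0; first by exists 0%N => //; left; rewrite /= in_itv.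
    have [n _ /(_ n (leqnn n)) /= nx] := near_infty_natSinv_lt (PosNum x0).
    by exists n => //; right; rewrite /= in_itv/= andbT ltW.
  split; first by apply: measurableU; exact: measurable_itv.
  have n0 : 0 < n.+1%:R^-1 :> R by rewrite invr_gt0.
  have /integrableP[_] := integrable_tail m1 n0.
  apply: le_lt_trans; rewrite (eq_integral (fun s : measurableTypeR R => (\1_(`[n.+1%:R^-1, +oo[) s)%:E)).
    rewrite integral_indic//.
    rewrite /levy_restr /mrestr le_measure ?inE//.
    - apply: measurableI => //; apply: measurableU; exact: measurable_itv.
    - by apply: measurableI => //; exact: measurable_itv.
    - move=> x [[|//]]; rewrite /= !in_itv/= => x0 /andP[].
      by rewrite ltNge x0.
  by move=> s _ /=; rewrite ger0_norm// indicE ler0n.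
pose nu : {sigma_finite_measure set (measurableTypeR R) -> \bar R} :=
  HB.pack_for {sigma_finite_measure set (measurableTypeR R) -> \bar R}
    levy_restr (Measure_isSigmaFinite.Build _ _ _ levy_restr sf).
exists nu => f; apply: eq_measure_integral => A mA AD.
by rewrite /nu /= /levy_restr /mrestr setIidl.
Qed.

End levy_sigma_finite.

(** * Cutting off the positive part of f along superlevel sets of u *)

Section cutoff.
Context {R : realType} {d : nat}.
Local Notation vec := ('rV[R]_d).
Local Notation leb := (@lebesgue_rV R d).
Variables (D : set vec) (f u : vec -> R).
Hypotheses (oD : open D) (bD : bounded_set D).
Hypotheses (cf : {within D, continuous f}) (cu : continuous u).
Hypothesis uD : forall x, ~ D x -> u x <= 0.

Local Notation superlevel eta := ([set y | eta <= u y] : set vec).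

Lemma superlevel_sub (eta : R) y : 0 < eta -> eta <= u y -> D y.
Proof.
move=> eta0 etau; apply: contrapT => /uD; rewrite leNgt => /negP; apply.
exact: lt_le_trans etau.
Qed.

Lemma superlevel_compact (eta : R) : 0 < eta -> compact (superlevel eta).
Proof.
move=> eta0; apply: bounded_closed_compact.
  have [M [Mr bM]] := bD; exists M; split => // M' MM' y /(superlevel_sub eta0).
  exact: bM.
rewrite (_ : superlevel eta = u @^-1` [set x | eta <= x])//.
by apply: preimage_closed; [move=> x _; exact: cu|exact: closed_ge].
Qed.

Lemma coord_le_norm (x : vec) i : `|x ord0 i| <= `|x|.
Proof.
rewrite [leRHS](_ : _ = mx_norm x)// mx_normrE.
exact: (le_bigmax 0 (fun ij : 'I_1 * 'I_d => `|x ij.1 ij.2|) (ord0, i)).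
Qed.

Lemma bounded_measure_lty : (leb D < +oo)%E.
Proof.
have [r [_ /(_ (r + 1))]] := bD.
rewrite ltrDl ltr01 => /(_ isT) br.
pose A (i : 'I_d) : set R := `[- (r + 1), r + 1]%classic.
have mA i : measurable (A i) by exact: measurable_itv.
pose Q : set vec := [set z | forall i, A i (z ord0 i)].
have mQ : measurable Q.
  rewrite (_ : Q = \bigcap_(i in [set: 'I_d]) ((fun z : vec => z ord0 i) @^-1` A i)).
    apply: fin_bigcap_measurable => [|i _]; first exact: finite_finset.
    by rewrite -[X in measurable X]setTI; exact: measurable_coord.
  by apply/seteqP; split => z /= zA i; [move=> _|]; exact: zA.
apply: (@le_lt_trans _ _ (leb Q)).
  rewrite le_measure ?inE//; first exact: sub_sigma_algebra.
  move=> z Dz i; rewrite /A/= in_itv/= -ler_norml.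
  by apply: le_trans (br z Dz); exact: coord_le_norm.
rewrite lebesgue_rV_box// ltey_eq prode_fin_num// => i _.
by rewrite lebesgue_measure_itv/=; case: ifP.
Qed.

Lemma measurable_pos_patch : measurable_fun setT (f^\+%R \_ D).
Proof.
have mD : measurable D by exact: sub_sigma_algebra.
apply/(measurable_restrictT _ mD); apply: measurable_funrpos.
apply: (measurability _ (RGenOInfty.measurableE R)).
move=> _ [_ [a ->] <-]; apply: sub_sigma_algebra => /=.
move: cf; rewrite continuous_open_subspace// => cf'.
rewrite openE => x [Dx]; rewrite /= in_itv/= andbT => ax.
apply: filterI; first exact: open_nbhs_nbhs.
have := cf' x (mem_set Dx) `]a, +oo[%classic.
by apply; apply: open_nbhs_nbhs; split; [exact: interval_open|rewrite /= in_itv/= ax].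
Qed.

(** f may be unbounded near the boundary of D. The superlevel set of u at eta/2 is a compact subset
    of D, so cutting off along u yields a continuous bounded function on the whole space. *)
Lemma cutoff_exists (eta : R) : 0 < eta -> exists (g : vec -> R) (M : R),
  [/\ continuous g, leb.-integrable setT (EFin \o g),
      forall y, 0 <= g y <= M, forall y, g y <= (f^\+%R \_ D) y &
      forall y, eta <= u y -> g y = f^\+%R y].
Proof.
move=> eta0; have eta20 : 0 < eta / 2 by rewrite divr_gt0.
(* A ramp in u, from 0 at eta/2 to 1 at eta. *)
pose chi (y : vec) : R := Num.min 1 (Num.max 0 (2 * (u y / eta) - 1)).
have chi01 y : 0 <= chi y <= 1 by rewrite /chi le_min ler01 le_max lexx ge_min lexx.
pose g (y : vec) : R := (f^\+%R \_ D) y * chi y.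
have fp0 y : 0 <= (f^\+%R \_ D) y.
  by rewrite patchE; case: ifP => // _; rewrite /funrpos le_max lexx orbT.
have chi0 y : u y <= eta / 2 -> chi y = 0.
  move=> uy; have : u y / eta <= 2^-1 by rewrite ler_pdivrMr// mulrC.
  by move=> h; rewrite /chi max_l ?min_r//; lra.
have cchi : continuous chi.
  move=> y; apply: (@continuous_min R vec (fun=> 1)); first exact: cst_continuous.
  apply: (@continuous_max R vec (fun=> 0)); first exact: cst_continuous.
  apply: (@continuousB _ R^o vec (fun z => 2 * (u z / eta)) (fun=> 1)); last exact: cst_continuous.
  apply: (@continuousM R vec (fun=> 2) (fun z => u z / eta)); first exact: cst_continuous.
  by apply: (@continuousM R vec u (fun=> eta^-1)); [exact: cu|exact: cst_continuous].
have g0 y : 0 <= g y by rewrite mulr_ge0//; case/andP: (chi01 y).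
have cfD y : D y -> {for y, continuous f}.
  by move: cf; rewrite continuous_open_subspace// => + Dy; apply; exact: mem_set.
have cg : continuous g.
  move=> y; have [Dy|nDy] := pselect (D y).
    have cp : {for y, continuous (fun z => f^\+%R z * chi z)}.
      apply: continuousM; last exact: cchi.
      apply: (@continuous_max R vec f (fun=> 0)); last exact: cst_continuous.
      exact: cfD.
    apply: near_eq_continuous cp.
    have : nbhs y D by exact: open_nbhs_nbhs.
    by apply: filterS => z Dz; rewrite /g patchE mem_set.
  apply: (@near_eq_continuous _ _ (fun=> 0)); last exact: cst_continuous.
  have uy : u y < eta / 2 by apply: le_lt_trans eta20; exact: uD.
  have : \forall z \near y, u z < eta / 2 by exact: (cvgr_lt (u y) (@cu y)).
  by apply: filterS => z /ltW /chi0 gz; rewrite /g gz mulr0.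
have gout y : u y < eta / 2 -> g y = 0 by move=> /ltW /chi0 gy; rewrite /g gy mulr0.
have [M HM] : exists M, forall y, g y <= M.
  have : bounded_set (g @` superlevel (eta / 2)).
    apply: compact_bounded; apply: continuous_compact; first exact: continuous_subspaceT.
    exact: superlevel_compact.
  move=> [M [_ /(_ (`|M| + 1))]]; rewrite (le_lt_trans (ler_norm M)) ?ltrDl// => /(_ isT) bM.
  exists (`|M| + 1) => y; have [yu|/gout ->] := leP (eta / 2) (u y); last by rewrite addr_ge0.
  by apply: le_trans (ler_norm _) _; apply: bM; exists y.
have gf y : g y <= (f^\+%R \_ D) y by rewrite ler_piMr//; case/andP: (chi01 y).
exists g, M; split => //.
- have mD : measurable D by exact: sub_sigma_algebra.
  rewrite (_ : EFin \o g = (EFin \o g) \_ D); last first.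
    apply/funext => y; rewrite patchE; case: ifPn => //= /negP yD.
    congr EFin; apply: gout; apply: le_lt_trans eta20; apply: uD => Dy.
    by apply: yD; exact: mem_set.
  apply/integrable_restrict => //; rewrite setTI.
  apply: measurable_bounded_integrable => //; first exact: bounded_measure_lty.
    apply: measurable_funTS; exact: continuous_measurable_rV.
  exists M; split; first exact: num_real.
  by move=> M' MM' y _ /=; rewrite ger0_norm// (le_trans (HM y)) ?ltW.
- by move=> y; rewrite g0 HM.
- move=> y etau; have Dy := superlevel_sub eta0 etau.
  rewrite /g patchE mem_set//.
  have -> : chi y = 1; last by rewrite mulr1.
  have : 1 <= u y / eta by rewrite ler_pdivlMr ?mul1r.
  by move=> h; rewrite /chi min_l// le_max; apply/orP; right; lra.
Qed.

End cutoff.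

Section Lnorm_mono.
Context {disp : measure_display} {T : measurableType disp} {R : realType}.
Variable mu : {measure set T -> \bar R}.

Lemma ge0_le_Lnorm (p : R) (f g : T -> R) : 0 < p ->
  measurable_fun setT f -> measurable_fun setT g ->
  (forall x, 0 <= f x <= g x) ->
  (Lnorm mu p%:E (EFin \o f) <= Lnorm mu p%:E (EFin \o g))%E.
Proof.
move=> p0 mf mg fg; rewrite unlock /=.
have I (h : T -> R) : (0 <= \int[mu]_x (`|h x| `^ p)%:E)%E.
  by apply: integral_ge0 => x _; rewrite lee_fin powR_ge0.
apply: gt0_ler_poweR; rewrite ?invr_ge0 ?(ltW p0)// ?in_itv/= ?andbT ?leey ?I//.
have mp (h : T -> R) : measurable_fun setT h -> measurable_fun setT (fun x : T => (`|h x| `^ p)%:E).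
  move=> mh; apply/measurable_EFinP.
  rewrite (_ : (fun x => _) = (@powR R ^~ p) \o (Num.norm \o h))//.
  apply: measurableT_comp; first exact: measurable_powR.
  by apply: measurableT_comp => //; exact: measurable_normr.
apply: ge0_le_integral => //; try exact: mp.
move=> x _; have /andP[f0 fgx] := fg x; rewrite lee_fin.
  by rewrite !ger0_norm ?(le_trans f0)// ge0_ler_powR ?nnegrE ?(ltW p0) ?(le_trans f0).
Qed.

End Lnorm_mono.

Lemma sqn_gt0 {R : realType} {d : nat} (z : 'rV[R]_d) : z != 0 -> 0 < sqn z.
Proof.
move=> z0; rewrite lt0r sqn_ge0 andbT; apply: contra z0 => /eqP z0.
apply/eqP/rowP => i; rewrite mxE; apply/eqP; rewrite -sqrf_eq0; apply/eqP.
by move/psumr_eq0P : z0; apply => // j _; exact: sqr_ge0.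
Qed.

(** * Comparison at a touching point *)

Section maximum_principle.
Context {R : realType} {d : nat}.
Local Notation vec := ('rV[R]_d).
Local Notation leb := (@lebesgue_rV R d).
Variable m : {sigma_finite_measure set (measurableTypeR R) -> \bar R}.
Hypothesis m1 : (\int[m]_(y in `]0%R, +oo[) (Num.min y 1)%:E < +oo)%E.
Hypothesis mD0 : m (`]0%R, +oo[%classic : set (measurableTypeR R)) != 0%E.
Hypothesis jfin : forall r : R, 0 < r -> (0 < jump_kernel m d r < +oo)%E.
Variable Psi : R -> R.
Hypothesis PsiE : forall x : R, 0 < x ->
  (Psi x)%:E = (\int[m]_(y in `]0%R, +oo[) (1 - expR (- (y * x)))%:E)%E.
Variables (mu c theta p : R).
Hypotheses (mu0 : 0 < mu) (c0 : 0 < c) (theta0 : 0 <= theta).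
Hypothesis wlsc : WLSC Psi mu c theta.
Hypotheses (d0 : (0 < d)%N) (p1 : 1 < p) (pmu : d%:R / (2 * mu) < p).

(** If u exceeded the bound, the function [phi] below would touch it strictly from above at a point
    of D, where the viscosity inequality would read - f <= - f^+ - 2e. *)
Lemma subsolution_le (delta : R) : exists2 C : R, 0 < C &
  forall (D : set vec) (f u : vec -> R) (A : R),
    open D -> bounded_set D -> (forall x, D x -> enorm x <= delta) ->
    {within D, continuous f} ->
    viscosity_subsolution m ([set x | 0 < u x] `&` D) (fun x => - f x) u ->
    (forall x, ~ D x -> u x <= 0) ->
    (Lnorm leb p%:E (EFin \o (f^\+%R \_ D)) <= A%:E)%E ->
    forall x, u x <= C * A.
Proof.
have [C1 [C2 [C10 C20 HS]]] :=
  heat_supersolution m1 mD0 jfin PsiE mu0 c0 theta0 wlsc d0 p1 pmu.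
pose rho := `|delta| + 1.
have rho1 : 1 <= rho by rewrite lerDr.
have [k k0 Hk] := psi_laplacian_ball_cap m1 jfin d0 rho1.
have [J J0 HJ] := psi_laplacian_quad_cap m1 jfin.
exists (C1 + C2 / k + 1); first by rewrite ltr_wpDl// addr_ge0// divr_ge0// ltW.
move=> D f u A oD bD Ddelta cf [_ [cu _] visc] uD fA x1.
have A0 : 0 <= A by rewrite -lee_fin; apply: le_trans fA; exact: Lnorm_ge0.
have C2k : 0 <= C2 / k by rewrite divr_ge0// ltW.
rewrite leNgt; apply/negP => ltu.
pose CA := (C1 + C2 / k) * A.
have CA0 : 0 <= CA by rewrite mulr_ge0// addr_ge0.
have CAu : CA < u x1.
  by apply: le_lt_trans ltu; rewrite ler_wpM2r// lerDl.
(* A quarter of the assumed excess: the barrier height uses one [eta], the cutoff level another, and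
   strict inequalities remain. *)
pose eta := (u x1 - CA) / 4.
have eta0 : 0 < eta by rewrite divr_gt0// subr_gt0.
have eta_u : CA + 4 * eta = u x1 by rewrite /eta; field.
have [g [M [cg ig gM gf gK]]] := cutoff_exists oD bD cf cu uD eta0.
pose K : set vec := [set y | eta <= u y].
have cK : compact K by exact: (superlevel_compact bD cu uD eta0).
have gA : (Lnorm leb p%:E (EFin \o g) <= A%:E)%E.
  apply: le_trans fA; apply: ge0_le_Lnorm.
  - exact: lt_trans p1.
  - exact: continuous_measurable_rV.
  - exact: measurable_pos_patch.
  - by move=> y; case/andP: (gM y) => -> _; rewrite gf.
pose e := k * eta / 4.
have e0 : 0 < e by rewrite divr_gt0// mulr_gt0.
have [w [wC2 wb wl wK]] := HS g M A e K cg ig gM gA cK e0.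
have cw : continuous w by case: wC2 => f1 [f2 []].
have [x0 /set_mem x0K x0max] : exists2 x0, x0 \in K &
    forall t, t \in K -> u t - w t <= u x0 - w x0.
  apply: compact_EVT_max => //; first by exists x1; rewrite /K/=; lra.
  apply: continuous_subspaceT => y; apply: continuousB; [exact: cu|exact: cw].
have ux0 : 0 < u x0 by exact: lt_le_trans x0K.
have Dx0 : D x0 by exact: (superlevel_sub uD eta0).
pose M0 := u x0 - w x0.
have M0ge : CA + 4 * eta - C1 * A <= M0.
  rewrite eta_u; apply: (le_trans _ (x0max x1 _)).
    by rewrite lerB//; case/andP: (wb x1).
  by rewrite inE /K/=; lra.
(* Chosen so that L k = C2 A + 4e: the ball indicator cancels C2 A and leaves 4e against one e from
   [w] and one from the quadratic cap. *)
pose L := C2 / k * A + eta.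
have L0 : 0 < L by rewrite ltr_wpDl// mulr_ge0.
have M0L : eta < M0 - L.
  by move: M0ge; rewrite /L /CA mulrDl; lra.
pose tau := e / (J + 1).
have J1 : 0 < J + 1 by rewrite ltr_wpDl.
have tau0 : 0 < tau by rewrite divr_gt0.
pose phi (y : vec) : R :=
  (w y + L * ball_cap rho y) + ((M0 - L) + tau * quad_cap x0 y).
have ball1 (y : vec) : D y -> ball_cap rho y = 1.
  move=> /Ddelta yd; rewrite /ball_cap (le_lt_trans yd)//.
  by rewrite (le_lt_trans (ler_norm _))// ltrDl.
have ball01 (y : vec) : 0 <= ball_cap rho y <= 1.
  by rewrite /ball_cap; case: (_ < _); rewrite ?lexx ?ler01.
have quad01 (y : vec) : 0 <= quad_cap x0 y <= 1.
  by rewrite /quad_cap le_min ler01 sqn_ge0 ge_min lexx.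
have quad0 : quad_cap x0 x0 = 0.
  rewrite /quad_cap subrr /sqn big1 ?min_r// => i _.
  by rewrite mxE expr0n.
have phix0 : phi x0 = u x0 by rewrite /phi quad0 ball1// /M0; ring.
have phigt (y : vec) : y != x0 -> u y < phi y.
  move=> yx0; have [yK|yK] := leP eta (u y).
    have Dy : D y by exact: (superlevel_sub uD eta0).
    have q0 : 0 < tau * quad_cap x0 y.
      by rewrite mulr_gt0// /quad_cap lt_min ltr01 sqn_gt0// subr_eq0.
    have : u y - w y <= M0 by apply: x0max; rewrite inE.
    by move: q0; rewrite /phi ball1//; move: (tau * _) => q; lra.
  (* Below level [eta] nothing is known about u - w; there the additive constant M0 - L alone
     exceeds [eta], all other terms being nonnegative. *)
  have /andP[w0 _] := wb y; have /andP[b0 _] := ball01 y.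
  have /andP[q0 _] := quad01 y.
  have Lb : 0 <= L * ball_cap rho y by rewrite mulr_ge0// ltW.
  have tq : 0 <= tau * quad_cap x0 y by rewrite mulr_ge0// ltW.
  rewrite /phi; apply: (lt_trans yK); apply: (lt_le_trans M0L).
  by move: (L * _) (tau * _) Lb tq => a b; lra.
have sC2 := is_C2_sqnB x0.
have phiC2 : C2b_at x0 phi.
  apply: (@C2b_at_near _ _ _
    (fun y => w y + (M0 + tau * sqn (y - x0)))).
  - exists (C1 * A + L + (`|M0 - L| + tau)); split; first exact: num_real.
    move=> B /ltW BM y _ /=; apply: le_trans BM.
    have /andP[w0 w1] := wb y; have /andP[b0 b1] := ball01 y.
    have /andP[q0 q1] := quad01 y.
    apply: le_trans (ler_normD _ _) _; apply: lerD.
      apply: le_trans (ler_normD _ _) _; apply: lerD; first by rewrite ger0_norm.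
      by rewrite ger0_norm; [rewrite ler_piMr// ltW|apply: mulr_ge0 => //; exact: ltW].
    apply: le_trans (ler_normD _ _) _; apply: lerD => //.
    by rewrite ger0_norm; [rewrite ler_piMr// ltW|apply: mulr_ge0 => //; exact: ltW].
  - apply: measurable_funD; apply: measurable_funD.
    + exact: continuous_measurable_rV.
    + by apply: measurable_funM; [exact: measurable_cst|exact: measurable_ball_cap].
    + exact: measurable_cst.
    + apply: measurable_funM; first exact: measurable_cst.
      apply: measurable_minr; first exact: measurable_cst.
      by apply: continuous_measurable_rV; case: sC2 => f1 [f2 []].
  (* Near x0, which lies in the open set D, the ball indicator is 1 and the cap is the plain
     quadratic, so [phi] agrees with a function that is C2 everywhere. *)
  - apply: is_C2D => //; apply: is_C2D; first exact: is_C2_cst.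
    exact: is_C2Z.
  - have : \forall y \near x0, sqn (y - x0) < 1.
      have cs : {for x0, continuous (fun y : vec => sqn (y - x0))}.
        by case: sC2 => f1 [f2 [/(_ x0)]].
      apply: (cvgr_lt _ cs); rewrite subrr /sqn big1 ?ltr01// => i _.
      by rewrite mxE expr0n.
    have : nbhs x0 D by exact: open_nbhs_nbhs.
    apply: filterS2 => y Dy /ltW s1.
    by rewrite /phi ball1// /quad_cap min_r//; ring.
have := visc x0 (conj ux0 Dx0) phi phiC2 phix0 phigt.
have x0rho : enorm x0 <= rho - 1.
  by rewrite /rho addrK (le_trans (Ddelta _ Dx0))// ler_norm.
have [bl bL] := Hk x0 x0rho; have [ql qL] := HJ x0.
have [Lbl LbE] := psi_laplacianZ L bl; have [tql tqE] := psi_laplacianZ tau ql.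
have [cl cE] := psi_laplacian_cst m (M0 - L) x0.
have [l1 E1] := psi_laplacianD (wl x0) Lbl.
have [l2 E2] := psi_laplacianD cl tql.
have [_ E3] := psi_laplacianD l1 l2.
rewrite /phi E3 E1 E2 cE LbE tqE add0r.
have wle := wK x0 x0K; rewrite gK// in wle.
have fle : f x0 <= f^\+%R x0 by rewrite /funrpos le_max lexx.
have LkE : L * k = C2 * A + 4 * e.
  by rewrite /L /e; field; rewrite gt_eqF.
have Lb : L * psi_laplacian m (ball_cap rho) x0 <= - (C2 * A + 4 * e).
  by rewrite -LkE -mulrN ler_wpM2l// ltW.
have tq : tau * psi_laplacian m (quad_cap x0) x0 <= e.
  apply: (@le_trans _ _ (tau * J)); first by rewrite ler_wpM2l// ltW.
  by rewrite /tau mulrAC ler_pdivrMr// ler_wpM2l// ?lerDl ltW.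
move: wle fle Lb tq e0.
move: (psi_laplacian m w x0) (L * _) (tau * _) => a b q.
move: (C2 * A) (f x0) (f^\+%R x0) => r s t.
lra.
Qed.

End maximum_principle.

Lemma le_enorm_diam {R : realType} {d : nat} (D : set 'rV[R]_d) (x y : 'rV[R]_d) :
  bounded_set D -> D x -> D y -> enorm (x - y) <= diam D.
Proof.
move=> [M [_ /(_ (`|M| + 1))]]; rewrite (le_lt_trans (ler_norm M)) ?ltrDl// => /(_ isT) bM.
move=> Dx Dy; apply: sup_upper_bound; last by exists x => //; exists y.
split; first by exists (enorm (x - y)); exists x => //; exists y.
exists (Num.sqrt (\sum_(i < d) (2 * (`|M| + 1)) ^+ 2)) => _ [a Da [b Db] <-].
rewrite /enorm; apply: ler_wsqrtr; apply: ler_sum => i _.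
rewrite -[leLHS]real_normK ?num_real// ler_sqr ?nnegrE ?mulr_ge0 ?addr_ge0// !mxE.
apply: (le_trans (ler_normB _ _)); rewrite mulrDl mul1r.
by apply: lerD; apply: le_trans (coord_le_norm _ _) _; [exact: (bM a)|exact: (bM b)].
Qed.

Theorem theorem3p1 (R : realType) (d : nat) (Psi : R -> R)
    (m : {measure set (measurableTypeR R) -> \bar R}) (mu c theta : R) :
  (2 <= d)%N ->
  bernstein_function0 Psi ->
  zero_drift_measure Psi m ->
  (forall r : R, 0 < r -> (0 < jump_kernel m d r < +oo)%E) ->
  0 < mu -> 0 < c <= 1 -> 0 <= theta -> WLSC Psi mu c theta ->
  forall p delta : R, d%:R / (2 * mu) < p ->
  exists2 C : R, 0 < C &
    forall (D : set 'rV[R]_d) (f u : 'rV[R]_d -> R),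
      C11_domain D -> bounded_set D -> D 0 -> diam D = delta ->
      {within D, continuous f} ->
      viscosity_subsolution m ([set x | 0 < u x] `&` D) (fun x => - f x) u ->
      (forall x, ~ D x -> u x <= 0) ->
      (ereal_sup [set (u^\+ x)%R%:E | x in D] <=
       C%:E * Lnorm (lebesgue_rV d) p%:E
                (EFin \o (f^\+%R \_ D)))%E.
Proof.
move=> d2 _ [m1 PsiE] jfin mu0 /andP[c0 _] theta0 wlsc p delta pmu.
(* Only integrals over (0, +oo) occur, so [m] may be exchanged for its sigma-finite restriction in
   all the data. *)
have [nu nuE] := levy_sigma_finite m1.
have jE : jump_kernel nu d = jump_kernel m d.
  by apply/funext => r; rewrite /jump_kernel nuE.
have lapE (phi : 'rV[R]_d -> R) x : psi_laplacian nu phi x = psi_laplacian m phi x.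
  by rewrite /psi_laplacian jE.
have nu1 : (\int[nu]_(y in `]0%R, +oo[) (Num.min y 1)%:E < +oo)%E by rewrite -nuE.
have jfin' r : 0 < r -> (0 < jump_kernel nu d r < +oo)%E by rewrite jE; exact: jfin.
have PsiE' x : 0 < x ->
    (Psi x)%:E = (\int[nu]_(y in `]0%R, +oo[) (1 - expR (- (y * x)))%:E)%E.
  by move=> /PsiE ->; exact: nuE.
have nu0 : nu (`]0%R, +oo[%classic : set (measurableTypeR R)) != 0%E.
  (* A null measure on (0, +oo) would make the jump kernel vanish, against its positivity at radius
     1. *)
  apply/eqP => nu0; have /andP[+ _] := jfin' 1 ltr01.
  rewrite /jump_kernel null_set_integral ?ltxx//.
  by apply/measurable_EFinP; exact: measurable_heat_time.
have mu1 : mu <= 1 := WLSC_le1 nu0 PsiE' c0 theta0 wlsc.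
have p1 : 1 < p.
  apply: le_lt_trans pmu; rewrite ler_pdivlMr ?mulr_gt0// mul1r.
  by apply: (@le_trans _ _ 2); [rewrite ler_piMr|rewrite ler_nat].
have d0 : (0 < d)%N by exact: leq_trans d2.
have [C C0 HC] :=
  subsolution_le nu1 nu0 jfin' PsiE' mu0 c0 theta0 wlsc d0 p1 pmu delta.
exists C => // D f u [oD _ _ _] bD D0 diamD cf [oU Cbu visc] uD.
set N := Lnorm _ _ _; have N0 : (0 <= N)%E by exact: Lnorm_ge0.
(* An infinite norm makes the claim trivial since C > 0; otherwise the norm is a real number and can
   serve as A. *)
have [Ninf|] := eqVneq N +oo%E.
  by rewrite Ninf gt0_muley ?lte_fin// leey.
rewrite -ltey => Nfin; have NE : N = (fine N)%:E by rewrite fineK// ge0_fin_numE.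
apply: ge_ereal_sup => _ [x Dx <-]; rewrite NE -EFinM lee_fin.
rewrite /funrpos ge_max mulr_ge0 ?fine_ge0 ?(ltW C0)// andbT.
apply: (HC D f u) => //.
(* As 0 lies in D, the diameter bounds the distance to the origin. *)
- by move=> y Dy; rewrite -diamD -[y]subr0; exact: le_enorm_diam.
- by split => // y Uy phi phi2 py pl; rewrite lapE; exact: visc.
- by rewrite -NE.
Qed.
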